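(* Let $K$ be an infinite field, $n\ge 2$, $r\ge 1$, and let $\lambda\in\Lambda(n,r)$ satisfy: $\lambda_n\neq 0$ if $\mathrm{char}\,K=0$; and $\lambda_n\ne 0$, $\lambda_{n-1}<p^{d+1}-1$ if $\mathrm{char}\,K=p>0$, where $d\ge 0$ is defined by $p^d\le\lambda_n<p^{d+1}$. Then the sequence of left $S(B^+)$-modules $$0\to U_\lambda\xrightarrow{\ f\ }E(\lambda)\xrightarrow{\ g\ }K_\lambda\to 0,$$ where $f(z)=(z,0)$ and $g(z',c)=c$ for all $z\in U_\lambda$, $(z',c)\in E(\lambda)$, is an Auslander-Reiten sequence.
   Context: Multi-indices. $I(n,r)=\{1,\dots,n\}^r$, and $\Lambda(n,r)$ is the set of $\lambda=(\lambda_1,\dots,\lambda_n)$ of non-negative integers with sum $r$. The symmetric group $\Sigma_r$ acts on the right on $I(n,r)$ by $i\pi=(i_{\pi1},\dots,i_{\pi r})$ and diagonally on $I(n,r)\times I(n,r)$; $\sim$ means ''in the same orbit''. $i\le j$ means $i_\rho\le j_\rho$ for all $\rho$. $i$ has weight $\lambda$ if $\lambda_\nu=\#\{\rho: i_\rho=\nu\}$ for all $\nu$. For $\lambda\in\Lambda(n,r)$, $l=l(\lambda)=(1^{\lambda_1},2^{\lambda_2},\dots,n^{\lambda_n})$. For $1\le\nu\le n-1$ and $0\le m\le\lambda_{\nu+1}$, $\lambda(\nu,m)=(\lambda_1,\dots,\lambda_\nu+m,\lambda_{\nu+1}-m,\dots,\lambda_n)$ and $l(\nu,m)=l(\lambda(\nu,m))$.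 For $i\in I(n,r)$, $T^\lambda_i$ is the tableau of row lengths $\lambda_1,\dots,\lambda_n$ filled with $i_1,\dots,i_r$ row by row, left to right; it is row-semistandard if its rows weakly increase. $J(\lambda)=\{j\in I(n,r): j\ge l(\lambda),\ T^\lambda_j\text{ row-semistandard}\}$ (for any composition $\lambda$). Algebras. The Schur algebra $S(n,r)$ is the image of $K\mathrm{GL}_n(K)$ in $\mathrm{End}_K((K^n)^{\otimes r})$ and the Borel-Schur algebra $S(B^+)=S(B^+,n,r)$ is the image of $KB^+$, $B^+$ the group of upper triangular matrices in $\mathrm{GL}_n(K)$. With $e_1,\dots,e_n$ the standard basis of $K^n$ and $e_i=e_{i_1}\otimes\dots\otimes e_{i_r}$, $\xi_{i,j}\in S(n,r)$ is the endomorphism $e_k\mapsto\sum_{h:(h,k)\sim(i,j)}e_h$; $\xi_{i,j}=\xi_{k,h}$ iff $(i,j)\sim(k,h)$. The distinct $\xi_{i,j}$ with $i\le j$ form a basis of $S(B^+)$. For $i$ of weight $\alpha$, $\xi_\alpha:=\xi_{i,i}$ (an idempotent). $K_\lambda$ is the one-dimensional simple left $S(B^+)$-module $K$ on which $\xi_\lambda$ acts as the identity and all other basis elements $\xi_{i,j}$ ($i\le j$) act as zero. The modules. Put $P_0^t=\xi_\lambda S(B^+)$ and let $P_1^t$ be the right $S(B^+)$-module $\bigoplus_{\nu=1}^{n-1}\xi_{\lambda(\nu,1)}S(B^+)$ over all $\nu$ with $\lambda_{\nu+1}\geq 1$ if $\mathrm{char}K=0$, and $\bigoplus_{\nu=1}^{n-1}\bigoplus_{1\le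 p^{d'}\le\lambda_{\nu+1}}\xi_{\lambda(\nu,p^{d'})}S(B^+)$ if $\mathrm{char}K=p$. Let $p_1^t\colon P_0^t\to P_1^t$ be the map $p_1^t(\eta)=\sum_{\nu}\xi_{l(\nu,1),l}\,\eta$ if $\mathrm{char}K=0$, resp. $p_1^t(\eta)=\sum_{\nu}\sum_{1\le p^{d'}\le\lambda_{\nu+1}}\xi_{l(\nu,p^{d'}),l}\,\eta$ if $\mathrm{char}K=p$ (each term in the corresponding summand; throughout only $\nu$ with $\lambda_{\nu+1}\ge1$ contribute). Bases of $P_1^t$. If $\mathrm{char}K=0$, let $\overline B_1=\{\xi_{l(\nu,1),j}: j\in J(\lambda(\nu,1)),\ 1\le\nu\le n-2\}\cup\{\xi_{l(n-1,1),j}: j\in J(\lambda(n-1,1))\setminus J(\lambda)\}\cup\{p_1^t(\xi_{l,j}): j\in J(\lambda)\}$. If $\mathrm{char}K=p$: for $j\in J(\lambda)$ let $a=a(j)$ be the number of entries $n$ in row $n-1$ of $T^\lambda_j$, with $p$-adic expansion $a=a_0+a_1p+\dots+a_dp^d$; let $m(j)=\min\{t: a_t<p-1\}$ (exists by the condition on $\lambda$), and $J(\lambda,d')=\{j\in J(\lambda): m(j)=d'\}$. Let $\overline B_2=\{\xi_{l(\nu,p^{d'}),j}: j\in J(\lambda(\nu,p^{d'})),\ 1\le p^{d'}\le\lambda_{\nu+1},\ 1\le\nu\le n-2\}\cup\{\xi_{l(n-1,p^{d'}),j}: j\in J(\lambda(n-1,p^{d'}))\setminus J(\lambda,d'),\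 0\le d'\le d\}\cup\{p_1^t(\xi_{l,j}): j\in J(\lambda)\}$. Under the hypothesis on $\lambda$, $\overline B_1$ (resp. $\overline B_2$) is a $K$-basis of $P_1^t$. Let $DP_1^t=\mathrm{Hom}_K(P_1^t,K)$, a left $S(B^+)$-module via $(\xi\psi)(x)=\psi(x\xi)$. Let $B_1^*$ (resp. $B_2^*$) be the basis of $DP_1^t$ dual to $\overline B_1$ (resp. $\overline B_2$), and $z_{l,j}$ the element dual to $p_1^t(\xi_{l,j})$. $U_\lambda$ is the subspace of $DP_1^t$ with basis $B_1^*\setminus\{z_{l,j}:j\in J(\lambda)\}$ (resp. $B_2^*\setminus\{z_{l,j}:j\in J(\lambda)\}$); it is an $S(B^+)$-submodule. $E(\lambda)=\{(z,c)\in DP_1^t\oplus K_\lambda: z\in U_\lambda+c\,z_{l,l}\}$. A short exact sequence $0\to N\xrightarrow{f}E\xrightarrow{g}S\to0$ of finite-dimensional modules is Auslander-Reiten if it is not split, $S$ and $N$ are indecomposable, and for every indecomposable module $X$ every non-invertible homomorphism $h\colon X\to S$ factors through $g$. *)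

(* Defs.v *)
From HB Require Import structures.
From mathcomp Require Import all_boot all_order all_algebra all_fingroup all_field.
From mathcomp Require Import boolp classical_sets functions cardinality.

Set Implicit Arguments.
Unset Strict Implicit.
Unset Printing Implicit Defensive.

Import GRing.Theory.
Local Open Scope ring_scope.

Section SpanOf.

Variables (K : fieldType) (V : vectType K) (P : V -> Prop).

Fact span_of_subproof :
  exists s : seq V, (forall v, v \in s -> P v) /\ (forall v, P v -> v \in <<s>>%VS).
Proof.
pose Q d := `[< exists s : seq V, (forall v, v \in s -> P v) /\ \dim <<s>>%VS = d >].
have Q0 : exists d, Q d.
  by exists 0; apply/asboolP; exists [::]; rewrite span_nil dimv0.
have Qmax d : Q d -> (d <= \dim {:V})%N.
  by move/asboolP=> [s [_ <-]]; apply/dimvS/subvf.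
case: (ex_maxnP Q0 Qmax) => d /asboolP[s [sP ds]] dmax.
exists s; split=> // v Pv.
have sub : (<<s>> <= <<v :: s>>)%VS by apply: sub_span => w ws; rewrite inE ws orbT.
have /dmax le : Q (\dim <<v :: s>>%VS).
  apply/asboolP; exists (v :: s); split=> // w.
  by rewrite inE => /orP[/eqP-> // | /sP].
have /eqP -> : (<<s>> == <<v :: s>>)%VS by rewrite eqEdim sub ds.
by rewrite memv_span ?mem_head.
Qed.

Definition span_of : {vspace V} := <<sval (cid span_of_subproof)>>%VS.

Lemma mem_span_of v : P v -> v \in span_of.
Proof. by rewrite /span_of; case: cid => s [_ /= gens] /gens. Qed.

Lemma span_of_subv (U : {vspace V}) :
  (forall v, P v -> v \in U) -> (span_of <= U)%VS.
Proof.
move=> PU; rewrite /span_of; case: cid => s [sP _] /=.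
by apply/span_subvP => v /sP /PU.
Qed.

End SpanOf.

Section Modules.

Variables (K : fieldType) (A : falgType K).

Record fdmod := FdMod {
  fdmod_sort :> vectType K;
  act : {linear A -> 'End(fdmod_sort)};
  act1 : act 1 = \1%VF;
  actM : forall a b, act (a * b) = (act a \o act b)%VF
}.

Definition is_hom (M N : fdmod) (f : 'Hom(M, N)) : Prop :=
  forall (a : A) (x : M), f (act M a x) = act N a (f x).

Definition invertible_hom (M N : fdmod) (f : 'Hom(M, N)) : Prop :=
  exists f' : 'Hom(N, M),
    [/\ is_hom f', (f' \o f = \1)%VF & (f \o f' = \1)%VF].

Definition is_submod (M : fdmod) (U : {vspace M}) : Prop :=
  forall (a : A) (x : M), x \in U -> act M a x \in U.

Definition indecomposable (M : fdmod) : Prop :=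
  (fullv : {vspace M}) != 0%VS /\
  forall U V : {vspace M}, is_submod U -> is_submod V ->
    (U + V = fullv)%VS -> (U :&: V = 0)%VS -> U = 0%VS \/ V = 0%VS.

Section SubModule.

Variables (M : fdmod) (U : {vspace M}) (hU : is_submod U).

Definition subact_fun (a : A) (x : subvs_of U) : subvs_of U :=
  Subvs (hU a (subvsP x)).

Fact subact_fun_linear a : linear (subact_fun a).
Proof. by move=> k x y; apply: val_inj; rewrite /= !linearP. Qed.
HB.instance Definition _ a :=
  GRing.isLinear.Build K _ _ _ (subact_fun a) (subact_fun_linear a).

Definition subact (a : A) : 'End(subvs_of U) := linfun (subact_fun a).

Fact subact_linear : linear subact.
Proof.
move=> k a b; apply/lfunP => x; apply: val_inj.
by rewrite /subact add_lfunE scale_lfunE !lfunE /= linearP add_lfunE scale_lfunE.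
Qed.
HB.instance Definition _ := GRing.isLinear.Build K _ _ _ subact subact_linear.

Fact subact1 : subact 1 = \1%VF.
Proof. by apply/lfunP => x; apply: val_inj; rewrite !lfunE /= act1 lfunE. Qed.

Fact subactM a b : subact (a * b) = (subact a \o subact b)%VF.
Proof.
by apply/lfunP => x; apply: val_inj; rewrite comp_lfunE !lfunE /= actM comp_lfunE.
Qed.

Definition submod : fdmod := FdMod subact1 subactM.

End SubModule.

Section SumModule.

Variables M N : fdmod.

Definition sumact_fun (a : A) (x : M * N) : M * N := (act M a x.1, act N a x.2).

Fact sumact_fun_linear a : linear (sumact_fun a).
Proof. by move=> k x y; rewrite /sumact_fun /= !linearP. Qed.
HB.instance Definition _ a :=
  GRing.isLinear.Build K _ _ _ (sumact_fun a) (sumact_fun_linear a).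

Definition sumact (a : A) : 'End((M * N)%type) := linfun (sumact_fun a).

Fact sumact_linear : linear sumact.
Proof.
move=> k a b; apply/lfunP => x.
rewrite /sumact add_lfunE scale_lfunE !lfunE /= /sumact_fun !linearP.
by rewrite !add_lfunE !scale_lfunE.
Qed.
HB.instance Definition _ := GRing.isLinear.Build K _ _ _ sumact sumact_linear.

Fact sumact1 : sumact 1 = \1%VF.
Proof.
by apply/lfunP => -[x y]; rewrite !lfunE /= /sumact_fun !act1 !lfunE.
Qed.

Fact sumactM a b : sumact (a * b) = (sumact a \o sumact b)%VF.
Proof.
by apply/lfunP => x; rewrite comp_lfunE !lfunE /= /sumact_fun !actM !comp_lfunE.
Qed.

Definition summod : fdmod := FdMod sumact1 sumactM.

End SumModule.

Record short_exact (N E S : fdmod) (f : 'Hom(N, E)) (g : 'Hom(E, S)) : Prop := {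
  short_exact_homl : is_hom f;
  short_exact_homr : is_hom g;
  short_exact_inj : lker f = 0%VS;
  short_exact_mid : limg f = lker g;
  short_exact_surj : limg g = fullv
}.

Definition split_epi (E S : fdmod) (g : 'Hom(E, S)) : Prop :=
  exists s : 'Hom(S, E), is_hom s /\ (g \o s = \1)%VF.

Record auslander_reiten (N E S : fdmod) (f : 'Hom(N, E)) (g : 'Hom(E, S)) :
    Prop := {
  ar_exact : short_exact f g;
  ar_nonsplit : ~ split_epi g;
  ar_indecr : indecomposable S;
  ar_indecl : indecomposable N;
  ar_factor : forall (X : fdmod) (h : 'Hom(X, S)),
    indecomposable X -> is_hom h -> ~ invertible_hom h ->
    exists k : 'Hom(X, E), is_hom k /\ h = (g \o k)%VF
}.

End Modules.

(* n >= 2 is written m.+2, and rows and entries are counted from 0: 1, ..., n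
   are the elements of 'I_n, and nu : 'I_m.+1 stands for 1 <= nu <= n - 1. *)

Section Combinatorics.

Variables m r : nat.
Local Notation n := m.+2.

Definition mindex := r.-tuple 'I_n.
HB.instance Definition _ := Finite.on mindex.

Definition weight := n.-tuple nat.

Definition mact (i : mindex) (s : 'S_r) : mindex :=
  [tuple tnth i (s rho) | rho < r].

Definition same_orbit (i j k h : mindex) : bool :=
  [exists s : 'S_r, (k == mact i s) && (h == mact j s)].

Definition mle (i j : mindex) : bool :=
  [forall rho : 'I_r, (tnth i rho <= tnth j rho)%N].

(* The default value is only reached when lam does not sum up to r. *)
Definition mi_l (lam : weight) : mindex :=
  insubd (nseq_tuple r ord0)
    (flatten [seq nseq (tnth lam i) i | i <- enum 'I_n]).

Lemma val_mi_l (lam : weight) : (\sum_(i < n) tnth lam i = r)%N ->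
  mi_l lam = flatten [seq nseq (tnth lam i) i | i <- enum 'I_n] :> seq 'I_n.
Proof.
move=> lam_sum; rewrite /mi_l -[LHS]/(val _) val_insubd size_flatten /shape.
rewrite -map_comp (eq_map (g := tnth lam)); last by move=> i; rewrite /= size_nseq.
by rewrite sumnE big_map big_enum /= lam_sum eqxx.
Qed.

Definition row (nu : 'I_m.+1) : 'I_n := widen_ord (leqnSn _) nu.
Definition next_row (nu : 'I_m.+1) : 'I_n := lift ord0 nu.

Definition wshift (lam : weight) (nu : 'I_m.+1) (k : nat) : weight :=
  [tuple if i == row nu then (tnth lam i + k)%N
         else if i == next_row nu then (tnth lam i - k)%N
         else tnth lam i | i < n].

Definition tableau (lam : weight) (j : mindex) : seq (seq 'I_n) :=
  reshape lam j.

Definition row_semistandard (t : seq (seq 'I_n)) : bool :=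
  all (sorted (fun x y : 'I_n => (x <= y)%N)) t.

Definition Jset (lam : weight) : {set mindex} :=
  [set j | mle (mi_l lam) j && row_semistandard (tableau lam j)].

(* Throughout, p is the characteristic of the ground field, 0 included. *)
Variable p : nat.

Definition num_last (lam : weight) (j : mindex) : nat :=
  count_mem (ord_max : 'I_n) (nth [::] (tableau lam j) m).

Definition digit (a t : nat) : nat := (a %/ p ^ t) %% p.

(* For p > 1 the digit of a in position a is 0, so the minimum is reached
   before the end of the range. *)
Definition first_small_digit (a : nat) : nat :=
  find (fun t => (digit a t < p.-1)%N) (iota 0 a.+1).

(* In characteristic 0 only d = 0 is used, and the whole of J(lam) is meant. *)
Definition Jdig (lam : weight) (d : nat) : {set mindex} :=
  [set j in Jset lam |
     (p == 0%N) || (first_small_digit (num_last lam j) == d)].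

(* Labels (nu, d) of the summands of P_1: 1 <= p ^ d <= lam_(nu + 1).  As
   0 ^ 0 = 1 and 0 ^ d.+1 = 0, for p = 0 only d = 0 is left, with step 1.  For
   p > 1 and lam of sum r, the bound d <= r follows from p ^ d <= r. *)
Definition is_step (lam : weight) (s : 'I_m.+1 * 'I_r.+1) : bool :=
  (0 < p ^ s.2 <= tnth lam (next_row s.1))%N.

Definition step (lam : weight) := {s : 'I_m.+1 * 'I_r.+1 | is_step lam s}.
HB.instance Definition _ lam := Finite.on (step lam).

Definition step_row lam (s : step lam) : 'I_m.+1 := (val s).1.
Definition step_exp lam (s : step lam) : nat := (val s).2.
Definition step_weight lam (s : step lam) : weight :=
  wshift lam (step_row s) (p ^ step_exp s).

(* nu = ord_max is row n - 1. *)
Definition Jstep lam (s : step lam) : {set mindex} :=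
  if step_row s == ord_max then Jset (step_weight s) :\: Jdig lam (step_exp s)
  else Jset (step_weight s).

Definition admissible (lam : weight) : Prop :=
  tnth lam ord_max != 0%N /\
  (p != 0%N -> exists2 d, (p ^ d <= tnth lam ord_max < p ^ d.+1)%N
                     & (tnth lam (row ord_max) < (p ^ d.+1).-1)%N).

End Combinatorics.

Section Algebra.

Variables (K : fieldType) (m r : nat).
Local Notation n := m.+2.
Local Notation I := (mindex m r).

(* End_K((K^n)^{(x) r}) in the basis (e_i): the entry (h, k) of an endomorphism
   is the coefficient of e_h in the image of e_k. *)
Definition tensor_end := 'M[K]_(#|{: I}|).
HB.instance Definition _ := GRing.Lmodule.on tensor_end.
HB.instance Definition _ := Vector.on tensor_end.
HB.instance Definition _ := GRing.PzRing.on tensor_end.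

Fact tensor_end_nonzero : (1 : tensor_end) != 0.
Proof.
pose i0 := enum_rank (nseq_tuple r ord0 : I).
apply/eqP => /matrixP/(_ i0 i0) /eqP.
by rewrite !mxE eqxx oner_eq0.
Qed.
HB.instance Definition _ :=
  GRing.PzSemiRing_isNonZero.Build tensor_end tensor_end_nonzero.

Fact tensor_end_scaleAl (k : K) (x y : tensor_end) : k *: (x * y) = (k *: x) * y.
Proof. exact: scalemxAl. Qed.
HB.instance Definition _ :=
  GRing.Lmodule_isLalgebra.Build K tensor_end tensor_end_scaleAl.

Fact tensor_end_scaleAr (k : K) (x y : tensor_end) : k *: (x * y) = x * (k *: y).
Proof. exact: scalemxAr. Qed.
HB.instance Definition _ :=
  GRing.Lalgebra_isAlgebra.Build K tensor_end tensor_end_scaleAr.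

HB.instance Definition _ := Algebra_isFalgebra.Build K tensor_end.

Definition coef (x : tensor_end) (h k : I) : K := x (enum_rank h) (enum_rank k).

Definition xi (i j : I) : tensor_end :=
  \matrix_(h, k) (same_orbit (enum_val h) (enum_val k) i j)%:R.

Definition xi_wt (lam : weight m) : tensor_end := xi (mi_l r lam) (mi_l r lam).

Definition tensor_pow (g : 'M[K]_n) : tensor_end :=
  \matrix_(h, k) \prod_(rho < r)
    g (tnth (enum_val h) rho) (tnth (enum_val k) rho).

(* is_trig_mx means lower triangular *)
Definition in_Bplus (g : 'M[K]_n) : bool := (g \in unitmx) && is_trig_mx g^T.

Definition borel_span : {vspace tensor_end} :=
  span_of (fun x => exists2 g, in_Bplus g & x = tensor_pow g).

Lemma coefE (x : tensor_end) h k : x h k = coef x (enum_val h) (enum_val k).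
Proof. by rewrite /coef !enum_valK. Qed.

Lemma coefM x y h k : coef (x * y) h k = \sum_i coef x h i * coef y i k.
Proof.
rewrite /coef mxE (reindex (@enum_rank I)) //=.
by apply: onW_bij; exact: enum_rank_bij.
Qed.

Lemma coef_pow g h k :
  coef (tensor_pow g) h k = \prod_(rho < r) g (tnth h rho) (tnth k rho).
Proof. by rewrite /coef mxE !enum_rankK. Qed.

Lemma coef_xi i j h k : coef (xi i j) h k = (same_orbit h k i j)%:R.
Proof. by rewrite /coef mxE !enum_rankK. Qed.

Lemma tensor_end_eq x y : (forall h k, coef x h k = coef y h k) -> x = y.
Proof. by move=> xy; apply/matrixP => h k; rewrite !coefE xy. Qed.

Lemma tensor_powM g g' : tensor_pow (g *m g') = tensor_pow g * tensor_pow g'.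
Proof.
apply: tensor_end_eq => h k; rewrite coefM coef_pow.
under eq_bigr do rewrite mxE.
rewrite bigA_distr_bigA /=.
rewrite (reindex (fun i : I => [ffun rho => tnth i rho])) /=; last first.
  exists (fun f : {ffun 'I_r -> 'I_n} => [tuple f rho | rho < r]) => x _.
    by apply: eq_from_tnth => rho; rewrite tnth_mktuple ffunE.
  by apply/ffunP => rho; rewrite ffunE tnth_mktuple.
apply: eq_bigr => i _; rewrite !coef_pow -big_split /=.
by apply: eq_bigr => rho _; rewrite ffunE.
Qed.

Lemma tensor_pow1 : tensor_pow 1%:M = 1.
Proof.
apply: tensor_end_eq => h k; rewrite coef_pow /coef mxE (inj_eq enum_rank_inj).
have [-> | neq] := eqVneq h k.
  by rewrite big1 // => rho _; rewrite mxE eqxx.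
have [rho hk] : exists rho, tnth h rho != tnth k rho.
  apply/existsP; apply: contraNT neq; rewrite negb_exists => /forallP hk.
  by apply/eqP/eq_from_tnth => rho; apply/eqP; move: (hk rho); rewrite negbK.
by rewrite (bigD1 rho) //= mxE (negbTE hk) mul0r.
Qed.

Lemma in_BplusM g g' : in_Bplus g -> in_Bplus g' -> in_Bplus (g *m g').
Proof.
case/andP=> ug tg /andP[ug' tg']; rewrite /in_Bplus unitmx_mul ug ug' /=.
apply/is_trig_mxP => i j ij; rewrite !mxE big1 // => k _.
move/is_trig_mxP in tg; move/is_trig_mxP in tg'.
case: (ltnP k j) => [kj | jk].
  by move: (tg k j kj); rewrite mxE => ->; rewrite mul0r.
by move: (tg' i k (leq_trans ij jk)); rewrite mxE => ->; rewrite mulr0.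
Qed.

Lemma borel_span1 : 1 \in borel_span.
Proof.
apply: mem_span_of; exists 1%:M; last by rewrite tensor_pow1.
rewrite /in_Bplus unitmx1 trmx1; apply/is_trig_mxP => i j ij.
by rewrite mxE; case: eqP ij => // ->; rewrite ltnn.
Qed.

Fact borel_aspace : is_aspace borel_span.
Proof.
rewrite /is_aspace has_algid1 ?borel_span1 //=.
apply/prodvP => x y xB yB.
have memW z w : (w \in (amull z @^-1: borel_span)%VS) = (z * w \in borel_span).
  by rewrite -memv_preim lfunE.
have memWr z w : (w \in (amulr z @^-1: borel_span)%VS) = (w * z \in borel_span).
  by rewrite -memv_preim lfunE.
rewrite -memW; apply: (subvP _ _ yB); apply: span_of_subv => _ [g' Bg' ->].
rewrite memW -memWr; apply: (subvP _ _ xB); apply: span_of_subv => _ [g Bg ->].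
rewrite memWr -tensor_powM; apply: mem_span_of; exists (g *m g') => //.
exact: in_BplusM.
Qed.

Definition borel_schur : {aspace tensor_end} := ASpace borel_aspace.
Definition SB := subvs_of borel_schur.
HB.instance Definition _ := Falgebra.on SB.

Lemma SB_upper (a : SB) (i j : I) : ~~ mle i j -> coef (val a) i j = 0.
Proof.
move=> ij.
pose c (x : tensor_end) : K^o := coef x i j.
have c_lin : linear c by move=> k x y; rewrite /c /coef !mxE.
pose cl : {linear tensor_end -> K^o} := HB.pack c (GRing.isLinear.Build _ _ _ _ c c_lin).
suff: vsval a \in lker (linfun cl) by rewrite memv_ker lfunE => /eqP.
apply: (subvP _ _ (subvsP a)); apply: span_of_subv => _ [g /andP[_ /is_trig_mxP tg] ->].
rewrite memv_ker lfunE /= /c coef_pow.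
move: ij; rewrite /mle negb_forall => /existsP[rho]; rewrite -ltnNge => lt.
by rewrite (bigD1 rho) //=; move: (tg _ _ lt); rewrite mxE => ->; rewrite mul0r.
Qed.

(* The coefficient at (l, l) of an element of S(B^+) is its coordinate along
   xi_lam in the basis of the xi_{i,j}, i <= j; see simple_act_xi_wt and
   simple_act_xi below. *)
Section Simple.

Variable lam : weight m.
Local Notation l := (mi_l r lam).

Definition simple_act (a : SB) : 'End(K^o) := coef (val a) l l *: \1%VF.

Fact simple_act_linear : linear simple_act.
Proof. by move=> k a b; rewrite /simple_act /coef !mxE scalerDl scalerA. Qed.
HB.instance Definition _ :=
  GRing.isLinear.Build K SB _ _ simple_act simple_act_linear.

Lemma mle_anti (i j : I) : mle i j -> mle j i -> i = j.
Proof.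
move=> /forallP ij /forallP ji; apply: eq_from_tnth => rho.
by apply/val_inj/eqP; rewrite eqn_leq ij ji.
Qed.

Fact algid_borel : algid borel_schur = 1.
Proof. by rewrite -[LHS]mulr1 algidl //; exact: borel_span1. Qed.

Fact simple_act1 : simple_act 1 = \1%VF.
Proof. by rewrite /simple_act /= algid_borel /coef mxE eqxx scale1r. Qed.

Fact simple_actM a b : simple_act (a * b) = (simple_act a \o simple_act b)%VF.
Proof.
rewrite /simple_act /= coefM (bigD1 l) //= big1 ?addr0 => [|i il].
  apply/lfunP => c.
  by rewrite comp_lfunE !scale_lfunE !id_lfunE scalerA.
have [li | /SB_upper->] := boolP (mle l i); last by rewrite mul0r.
have [/(mle_anti li) eq | /SB_upper->] := boolP (mle i l); last by rewrite mulr0.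
by rewrite eq eqxx in il.
Qed.

Definition simple_mod : fdmod SB := @FdMod K SB _ simple_act simple_act1 simple_actM.

Lemma simple_act_xi_wt (a : SB) (c : simple_mod) :
  val a = xi_wt lam -> act simple_mod a c = c.
Proof.
rewrite /= => av; rewrite /simple_act /= av coef_xi.
have -> : same_orbit l l l l.
  apply/existsP; exists 1%g; rewrite andbb; apply/eqP/eq_from_tnth => rho.
  by rewrite tnth_mktuple perm1.
by rewrite scale1r id_lfunE.
Qed.

Lemma simple_act_xi (a : SB) (c : simple_mod) i j :
  val a = xi i j -> ~~ same_orbit l l i j -> act simple_mod a c = 0.
Proof.
rewrite /= => av /negbTE nij; rewrite /simple_act /= av coef_xi nij.
by rewrite scale0r zero_lfunE.
Qed.

End Simple.

Section Sequence.

Variables (p : nat) (lam : weight m).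
Local Notation l := (mi_l r lam).
Local Notation step := (step r p lam).

(* The right ideal xi_mu S(B^+) *)
Definition right_proj (mu : weight m) : {vspace tensor_end} :=
  (amull (xi_wt mu) @: borel_schur)%VS.

Definition P1_ambient := {ffun step -> tensor_end}.
HB.instance Definition _ := Vector.on P1_ambient.

Definition P1_inj (s : step) (x : tensor_end) : P1_ambient :=
  [ffun t => if t == s then x else 0].

Fact P1_inj_linear s : linear (P1_inj s).
Proof.
move=> k x y; apply/ffunP => t; rewrite !ffunE.
by case: eqP; rewrite // scaler0 addr0.
Qed.
HB.instance Definition _ s :=
  GRing.isLinear.Build K tensor_end P1_ambient _ (P1_inj s) (P1_inj_linear s).

Definition P1 : {vspace P1_ambient} :=
  (\sum_s linfun (P1_inj s) @: right_proj (step_weight s))%VS.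

Lemma mem_P1 (x : P1_ambient) :
  (x \in P1) <-> (forall s, x s \in right_proj (step_weight s)).
Proof.
split=> [/memv_sumP[y yP ->] s | xP].
  rewrite sum_ffunE; apply: memv_suml => t _.
  have /memv_imgP[z zP ->] := yP t isT.
  by rewrite lfunE ffunE; case: eqP => [-> // | _]; rewrite mem0v.
have -> : x = \sum_s P1_inj s (x s).
  apply/ffunP => s; rewrite sum_ffunE (bigD1 s) //= ffunE eqxx.
  by rewrite big1 ?addr0 // => t /negbTE ts; rewrite ffunE eq_sym ts.
by apply: memv_sumr => s _; rewrite -(lfunE (P1_inj s)) memv_img.
Qed.

(* p_1 is the restriction of this map to P_0 = right_proj lam. *)
Definition p1 (eta : tensor_end) : P1_ambient :=
  [ffun s : step => xi (mi_l r (step_weight s)) l * eta].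

(* The basis \overline B of P_1: B_free lists its members
   xi_{l(nu, p ^ d), j}, B_im the elements p_1(xi_{l,j}) with j in J(lam). *)
Definition B_free : seq P1_ambient :=
  [seq P1_inj s (xi (mi_l r (step_weight s)) j)
     | s <- enum {: step}, j <- enum (Jstep s)].
Definition B_im : seq P1_ambient := [seq p1 (xi l j) | j <- enum (Jset r lam)].
Definition B_all : seq P1_ambient := B_free ++ B_im.

Definition P1_mulr (x : P1_ambient) (a : SB) : P1_ambient :=
  [ffun s => x s * val a].

Lemma P1_mulr_mem (x : P1_ambient) a : x \in P1 -> P1_mulr x a \in P1.
Proof.
move/mem_P1 => xP; apply/mem_P1 => s; rewrite ffunE.
have /memv_imgP[y yB ->] := xP s.
have -> z : amull (xi_wt (step_weight s)) y * z =
            amull (xi_wt (step_weight s)) (y * z) by rewrite !lfunE /= mulrA.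
apply: memv_img.
exact: subvP (asubv borel_schur) _ (memv_mul yB (subvsP a)).
Qed.

Definition P1_act (a : SB) (x : subvs_of P1) : subvs_of P1 :=
  Subvs (P1_mulr_mem a (subvsP x)).

Fact P1_act_linear a : linear (P1_act a).
Proof.
move=> k x y; apply: val_inj; apply/ffunP => s.
by rewrite !ffunE mulrDl scalerAl.
Qed.
HB.instance Definition _ a :=
  GRing.isLinear.Build K _ _ _ (P1_act a) (P1_act_linear a).

Definition DP1_space : vectType K := 'Hom(subvs_of P1, K^o).

Definition DP1_act_fun (a : SB) (psi : DP1_space) : DP1_space :=
  (psi \o linfun (P1_act a))%VF.

Fact DP1_act_fun_linear a : linear (DP1_act_fun a).
Proof.
by move=> k x y; rewrite /DP1_act_fun comp_lfunDl comp_lfunZl.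
Qed.
HB.instance Definition _ a :=
  GRing.isLinear.Build K _ _ _ (DP1_act_fun a) (DP1_act_fun_linear a).

Definition DP1_act (a : SB) : 'End(DP1_space) := linfun (DP1_act_fun a).

Lemma DP1_actE a (psi : DP1_space) x : DP1_act a psi x = psi (P1_act a x).
Proof. by rewrite lfunE /= comp_lfunE lfunE. Qed.

Fact DP1_act_linear : linear DP1_act.
Proof.
move=> k a b; apply/lfunP => psi; apply/lfunP => x.
rewrite !(add_lfunE, scale_lfunE) !DP1_actE -linearP; congr (fun_of_lfun psi _).
by apply: val_inj; apply/ffunP => s; rewrite !ffunE /= mulrDr scalerAr.
Qed.
HB.instance Definition _ := GRing.isLinear.Build K SB _ _ DP1_act DP1_act_linear.

Fact DP1_act1 : DP1_act 1 = \1%VF.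
Proof.
apply/lfunP => psi; apply/lfunP => x; rewrite DP1_actE lfunE /=.
congr (fun_of_lfun psi _); apply: val_inj; apply/ffunP => s.
by rewrite !ffunE /= algid_borel mulr1.
Qed.

Fact DP1_actM a b : DP1_act (a * b) = (DP1_act a \o DP1_act b)%VF.
Proof.
apply/lfunP => psi; apply/lfunP => x; rewrite comp_lfunE !DP1_actE.
congr (fun_of_lfun psi _); apply: val_inj; apply/ffunP => s.
by rewrite !ffunE /= mulrA.
Qed.

Definition DP1 : fdmod SB := @FdMod K SB _ DP1_act DP1_act1 DP1_actM.

(* The coordinate along the member b of B_all; coord is meaningful because
   B_all is a basis of P_1 whenever lam is admissible. *)
Definition dual_coord (b : P1_ambient) (x : subvs_of P1) : K^o :=
  oapp (fun i => coord (in_tuple B_all) i (val x)) 0 (insub (index b B_all)).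

Fact dual_coord_linear b : linear (dual_coord b).
Proof.
move=> k x y; rewrite /dual_coord; case: insub => [i|] /=; first by rewrite linearP.
by rewrite scaler0 addr0.
Qed.
HB.instance Definition _ b :=
  GRing.isLinear.Build K (subvs_of P1) K^o _ (dual_coord b) (dual_coord_linear b).

Definition dual_elt (b : P1_ambient) : DP1 := linfun (dual_coord b).

Definition z_elt (j : I) : DP1 := dual_elt (p1 (xi l j)).

(* The span of the dual basis of B_all minus the z_elt j. *)
Definition Uspace : {vspace DP1} := <<[seq dual_elt b | b <- B_free]>>%VS.

Definition amb_mod : fdmod SB := summod DP1 (simple_mod lam).

Definition E_diff (w : amb_mod) : DP1 := w.1 - (w.2 : K) *: z_elt l.

Fact E_diff_linear : linear E_diff.
Proof.
move=> k w w'; rewrite /E_diff /= scalerDl scalerBr scalerA opprD.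
by rewrite addrACA.
Qed.
HB.instance Definition _ :=
  GRing.isLinear.Build K amb_mod DP1 _ E_diff E_diff_linear.

Definition Espace : {vspace amb_mod} := (linfun E_diff @^-1: Uspace)%VS.

Lemma mem_Espace (w : amb_mod) :
  (w \in Espace) = (w.1 - (w.2 : K) *: z_elt l \in Uspace).
Proof. by rewrite -memv_preim lfunE. Qed.

Section Maps.

Variables (hU : is_submod Uspace) (hE : is_submod Espace).

Fact AR_f_subproof (z : submod hU) : ((vsval z, 0) : amb_mod) \in Espace.
Proof. by rewrite mem_Espace /= scale0r subr0 subvsP. Qed.

Definition AR_f_fun (z : submod hU) : submod hE := Subvs (AR_f_subproof z).

Fact AR_f_fun_linear : linear AR_f_fun.
Proof.
by move=> k x y; apply: val_inj; congr pair; rewrite /= scaler0 addr0.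
Qed.
HB.instance Definition _ :=
  GRing.isLinear.Build K (submod hU) (submod hE) _ AR_f_fun AR_f_fun_linear.

Definition AR_f : 'Hom(submod hU, submod hE) := linfun AR_f_fun.

Lemma AR_fE z : vsval (AR_f z) = (vsval z, 0).
Proof. by rewrite lfunE. Qed.

Definition AR_g_fun (w : submod hE) : simple_mod lam := (vsval w).2.

Fact AR_g_fun_linear : linear AR_g_fun.
Proof. by []. Qed.
HB.instance Definition _ :=
  GRing.isLinear.Build K (submod hE) (simple_mod lam) _ AR_g_fun AR_g_fun_linear.

Definition AR_g : 'Hom(submod hE, simple_mod lam) := linfun AR_g_fun.

Lemma AR_gE w : AR_g w = (vsval w).2.
Proof. by rewrite lfunE. Qed.

End Maps.

End Sequence.

End Algebra.

Definition has_char (K : fieldType) (p : nat) : Prop :=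
  if p is 0 then [pchar K] =i pred0 else p \in [pchar K].

(* Main.v *)
From HB Require Import structures.
Require Import Defs.
From mathcomp Require Import boolp classical_sets cardinality.
From mathcomp Require Import all_boot all_algebra perm all_field.
From mathcomp Require Import zify.

(** Why the sequence is almost split.

    Write S for the Borel-Schur algebra, e for the idempotent of weight lambda
    and, for a step s = (nu, p^d), e_s for the idempotent of the weight
    lambda(s) and a_s = xi_{l(s),l} for the element of e_s S e that is called
    an arrow below.  Then P_1 is the sum of the right ideals e_s S and p_1
    sends eta in e S to the family (a_s eta)_s.

    Everything about the module U comes from one description: U consists of
    the functionals on P_1 that vanish on p_1(e S), and E of the pairs (z, c)
    with z(p_1 eta) = c eta_{l,l} for eta in e S, where eta_{l,l} is the
    coordinate of eta along e.  This needs the family B to be a basis of P_1.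
    For s = (n - 1, p^d) the arrow acts by a scalar: a_s xi_{l,j}
    is a binomial coefficient binom(a(j) + p^d, p^d) times xi_{l(s),j}
    (arrow_last_row), because the last row of every tableau in J(lambda)
    consists of n's.  Modulo p this scalar is the digit of a(j) in position d
    plus one, and in characteristic 0 it is a(j) + 1, so it is invertible
    where p_1(xi_{l,j}) has replaced xi_{l(s),j} in B; hence B is free
    (B_all_free) and spans (P1_sub_span).

    From the description, U and E are submodules and the sequence is exact.  A
    splitting would give (z, 1) in E with z killed by the arrows, yet
    z(p_1 e) = 1 is a sum of values of the functionals a_s z.

    Lifting.  Let h : X -> K_lambda be a homomorphism.  Homomorphisms from X to
    the dual of P_1 are families of functionals on X, and h lifts to E as soon
    as h factors through x |-> (a_s x)_s, that is, as soon as h vanishes on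
    the vectors killed by all arrows (factor_through).  If h does not vanish
    on such a vector x, chosen of weight lambda, then every divided power of
    positive order of a simple root vector kills x, because 'C(d, p^i) is invertible for the
    largest p^i <= d; so the simple root subgroups fix x, the torus scales it,
    and these generate the Borel group.  Thus K x is a submodule (stable_line),
    X is the sum of K x and the kernel of h, and for X indecomposable h is an
    isomorphism (killed_invertible).

    Indecomposability of U.  Let pi be the projection of U onto a direct
    summand.  As U is a space of functionals on P_1, pi is induced by left
    multiplication by a matrix (y_{ts}) with y_{ts} in e_t S, and
    pi(psi)(p_1 e) = 0 forces sum_s y_{ts} a_s = a_t eta for some eta in e S.
    The arrows are minimal generators: the coefficient of a_t in y a_s
    vanishes for s <> t, since the only possible contribution is a binomial
    coefficient binom(p^i, p^j) with j < i.  Comparing the coefficients of a_t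
    gives that all diagonal entries y_{tt} have the same coordinate c along
    e_t.  Ordering the steps by size makes the matrix triangular, so that
    every nonzero psi in U has a value on which pi acts as the scalar c
    (pi_eigenvector).  Hence pi cannot have both a nonzero image and a nonzero
    kernel. *)

Set Implicit Arguments.
Unset Strict Implicit.
Unset Printing Implicit Defensive.

Import GRing.Theory.

(** * Binomial coefficients in characteristic p *)

Section Binomials.

Lemma dvdn_bin_pexp p d k : prime p -> 0 < k < p ^ d -> p %| 'C(p ^ d, k).
Proof.
move=> p_pr /andP[k_gt0 k_lt]; apply: contraLR k_lt => pC; rewrite -leqNgt.
apply: dvdn_leq => //.
have cop : coprime (p ^ d) 'C(p ^ d, k) by rewrite coprimeXl // prime_coprime.
rewrite -(Gauss_dvdl _ cop) -(prednK k_gt0) -mul_bin_diag.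
by rewrite dvdn_mulr.
Qed.

Local Open Scope ring_scope.
Variables (K : fieldType) (p : nat).
Hypothesis p_char : p \in [pchar K].

(** Splitting off p^d elements in Vandermonde's identity leaves only the two
    extreme terms modulo p, so m |-> 'C(m, p^d) grows by one whenever m grows
    by p^d. *)
Lemma bin_pexp_char d m : 'C(m, p ^ d)%:R = (m %/ p ^ d)%:R :> K.
Proof.
have p_pr := pcharf_prime p_char; have q_gt0 : (0 < p ^ d)%N by rewrite expn_gt0 prime_gt0.
have [n] := ubnP m; elim: n m => // n IHn m; rewrite ltnS => m_n.
have [m_lt|m_ge] := ltnP m (p ^ d); first by rewrite bin_small ?divn_small.
have -> : (m %/ p ^ d = (m - p ^ d) %/ p ^ d + 1)%N.
  by rewrite -{1}(subnK m_ge) divnDr ?dvdnn // divnn q_gt0.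
rewrite natrD -IHn; last by rewrite (leq_trans _ m_n) // ltn_subrL q_gt0 (leq_trans q_gt0).
have := @dvdn_bin_pexp p d ^~ p_pr.
rewrite -{1}(subnKC m_ge) -binomial.Vandermonde natr_sum.
case: (p ^ d)%N q_gt0 => // q _ p_dvd; rewrite big_ord_recl big_ord_recr /=.
rewrite bin0 mul1n subn0 binn mul1n subnn bin0 big1 ?add0r // => i _.
by apply/eqP; rewrite natrM mulf_eq0 -!(dvdn_pcharf p_char) p_dvd //= ltnS ltn_ord.
Qed.

(** The quotient of m by p^d is then the leading p-adic digit of m. *)
Lemma bin_leading_pexp_char d m : (p ^ d <= m < p ^ d.+1)%N -> 'C(m, p ^ d)%:R != 0 :> K.
Proof.
move=> /andP[m_ge m_lt]; have p_pr := pcharf_prime p_char.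
rewrite bin_pexp_char -(dvdn_pcharf p_char); apply: contraL m_lt => dv.
rewrite -leqNgt expnSr (leq_trans _ (leq_trunc_div m (p ^ d))) // mulnC leq_mul2r.
by apply/orP; right; apply: dvdn_leq => //; rewrite divn_gt0 // expn_gt0 prime_gt0.
Qed.

(** Adding p^d raises digit d by one, and the new digit is nonzero when no carry
    occurs. *)
Lemma bin_addr_pexp_char a d : (digit p a d < p.-1)%N -> 'C(a + p ^ d, p ^ d)%:R != 0 :> K.
Proof.
move=> a_d; have p_pr := pcharf_prime p_char.
have q_gt0 : (0 < p ^ d)%N by rewrite expn_gt0 prime_gt0.
rewrite bin_pexp_char -(dvdn_pcharf p_char) divnDr ?dvdnn // divnn q_gt0 /dvdn.
rewrite -modnDml modn_small ?addn1 //.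
by rewrite -ltn_predRL.
Qed.

End Binomials.

(** If the d lowest digits of a are all p - 1, then p^d divides a + 1. *)
Lemma digit_max p a d : 1 < p -> (forall t, t < d -> p.-1 <= digit p a t) ->
  (p ^ d).-1 <= a.
Proof.
move=> p_gt1 digs; have p_gt0 := ltnW p_gt1.
have q_gt0 t : 0 < p ^ t by rewrite expn_gt0 p_gt0.
rewrite -ltnS prednK //; suff : p ^ d %| a.+1 by apply: dvdn_leq.
elim: d digs => [|d IHd] digs; first by rewrite dvd1n.
have /dvdnP[b def_a] : p ^ d %| a.+1 by apply: IHd => t td; apply: digs; apply: ltnW.
have b_gt0 : 0 < b by case: b def_a.
have -> : a.+1 = (p ^ d) * (b.-1 + 1) by rewrite addn1 prednK // mulnC.
rewrite expnSr dvdn_pmul2l //.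
have def_ad : a %/ p ^ d = b.-1.
  have -> : a = b.-1 * p ^ d + (p ^ d).-1.
    apply: succn_inj; rewrite def_a -addnS prednK // -{1}(prednK b_gt0) mulSn addnC //.
  by rewrite divnMDl // divn_small ?addn0 // prednK.
have := digs d (ltnSn d); rewrite /digit def_ad => b_mod.
have b_lt : b.-1 %% p < p by rewrite ltn_mod.
have -> : b.-1 + 1 = (b.-1 %/ p) * p + p.
  rewrite {1}(divn_eq b.-1 p) -addnA addn1; congr (_ + _).
  by apply/eqP; rewrite eqn_leq b_lt -{1}(prednK p_gt0) ltnS.
by rewrite dvdn_add ?dvdn_mull.
Qed.

Lemma first_small_digitP p a d : 1 < p -> a < (p ^ d).-1 ->
  digit p a (first_small_digit p a) < p.-1 /\ first_small_digit p a < d.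
Proof.
move=> p_gt1 a_lt; have p_gt0 := ltnW p_gt1.
set P := fun t => digit p a t < p.-1.
have hasP : has P (iota 0 a.+1).
  apply/hasP; exists a; first by rewrite mem_iota /= add0n.
  rewrite /P /digit (divn_small (ltn_expl a p_gt1)) mod0n.
  by rewrite -subn1 subn_gt0.
have lt_find : find P (iota 0 a.+1) < a.+1 by rewrite -{2}(size_iota 0 a.+1) -has_find.
split; first by have := nth_find 0 hasP; rewrite nth_iota.
rewrite ltnNge; apply/negP => d_le; move: a_lt; rewrite ltnNge digit_max // => t t_d.
have t_lt := leq_trans t_d d_le.
have := before_find 0 t_lt; rewrite nth_iota ?add0n; last exact: ltn_trans lt_find.
by rewrite /P ltnNge => /negbFE.
Qed.

(** * Orbits of pairs of multi-indices *)

Section Orbits.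

Variables m r : nat.
Local Notation n := m.+2.
Local Notation I := (mindex m r).
Implicit Types (h k i j : I) (q : 'I_n * 'I_n) (mu : weight m).

(** Orbits are handled through the sequence of pairs (h_rho, k_rho): two pairs of
    multi-indices lie in the same orbit iff these sequences are permutations of
    each other, and the lexicographically sorted sequence is a canonical
    representative. *)
Definition pairs h k : seq ('I_n * 'I_n) := zip h k.

Lemma size_pairs h k : size (pairs h k) = r.
Proof. by rewrite size_zip !size_tuple minnn. Qed.

Lemma pairsE h k : pairs h k = [seq (tnth h rho, tnth k rho) | rho <- enum 'I_r].
Proof.
rewrite /pairs -{1}[val h]map_tnth_enum -{1}[val k]map_tnth_enum.
by elim: (enum 'I_r) => //= rho s ->.
Qed.

Lemma count_pairs (P : pred ('I_n * 'I_n)) h k :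
  count P (pairs h k) = #|[set rho | P (tnth h rho, tnth k rho)]|.
Proof.
by rewrite pairsE count_map cardsE cardE size_filter enumT; apply: eq_count.
Qed.

Lemma all_pairs (P : pred ('I_n * 'I_n)) h k :
  all P (pairs h k) = [forall rho, P (tnth h rho, tnth k rho)].
Proof.
rewrite pairsE all_map; apply/allP/forallP => /= [Pall rho | Pall rho _]; last exact: Pall.
by apply: Pall; rewrite mem_enum.
Qed.

Lemma map_fst_pairs h k : map fst (pairs h k) = h.
Proof. by rewrite -/(unzip1 _) unzip1_zip ?size_tuple. Qed.

Lemma map_snd_pairs h k : map snd (pairs h k) = k.
Proof. by rewrite -/(unzip2 _) unzip2_zip ?size_tuple. Qed.

Lemma count_fst h k (P : pred 'I_n) : count (P \o fst) (pairs h k) = count P h.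
Proof. by rewrite -count_map map_fst_pairs. Qed.

Lemma count_snd h k (P : pred 'I_n) : count (P \o snd) (pairs h k) = count P k.
Proof. by rewrite -count_map map_snd_pairs. Qed.

Lemma perm_pairs_fst h k h' k' : perm_eq (pairs h k) (pairs h' k') -> perm_eq h h'.
Proof. by move/(perm_map fst); rewrite !map_fst_pairs. Qed.

Lemma perm_pairs_snd h k h' k' : perm_eq (pairs h k) (pairs h' k') -> perm_eq k k'.
Proof. by move/(perm_map snd); rewrite !map_snd_pairs. Qed.

Lemma same_orbitE i j k h : same_orbit i j k h = perm_eq (pairs k h) (pairs i j).
Proof.
pose z i j : r.-tuple ('I_n * 'I_n) := [tuple (tnth i rho, tnth j rho) | rho < r].
have zE i' j' : pairs i' j' = z i' j' by rewrite pairsE.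
rewrite (zE k) (zE i).
apply/existsP/tuple_permP => [[s /andP[/eqP-> /eqP->]] | [s eqz]]; exists s.
  by congr val; apply: eq_from_tnth => rho; rewrite !tnth_mktuple.
have {}eqz : z k h = [tuple tnth (z i j) (s rho) | rho < r] by apply: val_inj.
by apply/andP; split; apply/eqP/eq_from_tnth => rho;
  have := congr1 (fun t : r.-tuple _ => tnth t rho) eqz; rewrite !tnth_mktuple => -[].
Qed.

Lemma mleP i j : reflect (forall rho, tnth i rho <= tnth j rho) (mle i j).
Proof. exact: forallP. Qed.

Lemma mleE i j : mle i j = all (fun q => q.1 <= q.2) (pairs i j).
Proof. by rewrite all_pairs. Qed.

Lemma mle_refl i : mle i i.
Proof. exact/mleP. Qed.

Lemma mle_trans j i k : mle i j -> mle j k -> mle i k.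
Proof. by move=> /mleP ij /mleP jk; apply/mleP => rho; apply: leq_trans (jk rho). Qed.

Definition pair_le q q' : bool := (q.1 < q'.1) || ((q.1 == q'.1) && (q.2 <= q'.2)).

Lemma pair_le_trans : transitive pair_le.
Proof.
move=> [a b] [c d] [e f]; rewrite /pair_le /= -!val_eqE /=.
move=> /orP[ca|/andP[/eqP-> db]] /orP[ae|/andP[/eqP<- bf]].
- by rewrite (ltn_trans ca ae).
- by rewrite ca.
- by rewrite ae.
- by rewrite eqxx (leq_trans db bf) orbT.
Qed.

Lemma pair_le_total : total pair_le.
Proof.
move=> [a b] [c d]; rewrite /pair_le /= -!val_eqE /=.
by case: ltngtP => //= _; apply: leq_total.
Qed.

Lemma pair_le_anti : antisymmetric pair_le.
Proof.
move=> [a b] [c d]; rewrite /pair_le /= -!val_eqE /=.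
case: ltngtP => //= /val_inj -> le; congr (_, _).
by apply/val_inj/eqP; rewrite eqn_leq.
Qed.

Definition lex_sorted h k : bool := sorted pair_le (pairs h k).

Lemma lex_sorted_inj h k h' k' : lex_sorted h k -> lex_sorted h' k' ->
  perm_eq (pairs h k) (pairs h' k') -> h = h' /\ k = k'.
Proof.
move=> c c' /(sorted_eq pair_le_trans pair_le_anti c c') eqp.
split; apply: val_inj; first by rewrite -[LHS](map_fst_pairs h k) eqp map_fst_pairs.
by rewrite -[LHS](map_snd_pairs h k) eqp map_snd_pairs.
Qed.

Lemma lex_sorted_exists h k :
  exists h', exists k', lex_sorted h' k' /\ perm_eq (pairs h' k') (pairs h k).
Proof.
set s := sort pair_le (pairs h k).
have s1 : size (map fst s) == r by rewrite size_map size_sort size_pairs.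
have s2 : size (map snd s) == r by rewrite size_map size_sort size_pairs.
exists (Tuple s1), (Tuple s2).
have -> : pairs (Tuple s1) (Tuple s2) = s by rewrite /pairs /= zip_unzip.
by rewrite /lex_sorted /pairs /= zip_unzip sort_sorted ?perm_sort //; apply: pair_le_total.
Qed.

Lemma lex_sorted_fst h k : lex_sorted h k ->
  sorted (fun x y : 'I_n => x <= y) h.
Proof.
rewrite /lex_sorted -(map_fst_pairs h k) sorted_map; apply: sub_sorted => -[a b] [c d].
by rewrite /pair_le /= => /orP[/ltnW|/andP[/eqP->]].
Qed.

Section Weight.

Variable mu : weight m.
Hypothesis mu_sum : \sum_(i < n) tnth mu i = r.
Local Notation l := (mi_l r mu).

Lemma count_mi_l v : count_mem v l = tnth mu v.
Proof.
rewrite (val_mi_l mu_sum) count_flatten -map_comp sumnE big_map big_enum /=.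
rewrite (bigD1 v) //= count_nseq /= eqxx mul1n big1 ?addn0 // => i iv.
by rewrite count_nseq /= (negbTE iv).
Qed.

Lemma sorted_mi_l : sorted (fun x y : 'I_n => x <= y) l.
Proof.
have le_tr : transitive (fun x y : 'I_n => x <= y) by move=> ? ? ?; apply: leq_trans.
rewrite (val_mi_l mu_sum).
have: sorted (fun x y : 'I_n => x < y) (enum 'I_n).
  have := iota_ltn_sorted 0 n; rewrite -val_enum_ord sorted_map; exact: sub_sorted.
rewrite !sorted_pairwise //; last by move=> ? ? ?; apply: ltn_trans.
elim: (enum 'I_n) => //= x s IHs /andP[x_s /IHs s_srt].
rewrite pairwise_cat s_srt andbT; apply/andP; split.
  apply/allrelP => y z; rewrite mem_nseq => /andP[_ /eqP->].
  case/flattenP => t /mapP[w ws ->]; rewrite mem_nseq => /andP[_ /eqP->].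
  by have /allP/(_ w ws)/ltnW := x_s.
by elim: (tnth mu x) => //= c ->; rewrite andbT all_nseq leqnn orbT.
Qed.

Lemma perm_mi_lP i : perm_eq i l = [forall v, count_mem v i == tnth mu v].
Proof.
apply/allP/forallP => [il v | il v _]; last by rewrite /= count_mi_l.
by rewrite -count_mi_l; apply/eqP; have /seq.permP -> : perm_eq i l by apply/allP.
Qed.

Lemma sorted_perm_mi_l i :
  sorted (fun x y : 'I_n => x <= y) i -> perm_eq i l -> i = l.
Proof.
move=> i_srt il; apply/val_inj.
have le_tr : transitive (fun x y : 'I_n => x <= y) by move=> ? ? ?; apply: leq_trans.
have le_anti : antisymmetric (fun x y : 'I_n => x <= y).
  by move=> x y; rewrite -eqn_leq => /eqP/val_inj.
exact: (sorted_eq le_tr le_anti i_srt sorted_mi_l il).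
Qed.

End Weight.

Lemma sorted_pair_le_nseq x (u : seq 'I_n) :
  sorted pair_le (zip (nseq (size u) x) u) = sorted (fun x y : 'I_n => x <= y) u.
Proof.
case: u => //= a u; elim: u a => //= b u IHu a.
by rewrite IHu /pair_le /= ltnn eqxx.
Qed.

(** The rows of the tableau of shape mu are the positions where l(mu) is constant,
    so that sorting within the rows is sorting the pairs (l(mu)_rho, j_rho)
    lexicographically.  Induction on the rows requires an arbitrary strictly
    increasing list s of row labels. *)
Lemma row_semistandard_reshape (c : 'I_n -> nat) (s u : seq 'I_n) :
    sorted (fun x y : 'I_n => x < y) s -> size u = \sum_(x <- s) c x ->
  row_semistandard (reshape (map c s) u) =
  sorted pair_le (zip (flatten [seq nseq (c x) x | x <- s]) u).
Proof.
have lt_tr : transitive (fun x y : 'I_n => x < y) by move=> ? ? ?; apply: ltn_trans.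
rewrite !sorted_pairwise //; last exact: pair_le_trans.
elim: s u => [|x s IHs] u /=; first by case: u.
case/andP => x_s /IHs {}IHs; rewrite big_cons => size_u.
rewrite -[in RHS](cat_take_drop (c x) u).
have sz_take : size (take (c x) u) = c x by rewrite size_takel // size_u leq_addr.
rewrite zip_cat ?size_nseq // pairwise_cat /row_semistandard /= -/(row_semistandard _).
rewrite IHs ?size_drop ?size_u ?addKn //.
have := sorted_pair_le_nseq x (take (c x) u); rewrite sz_take sorted_pairwise => [->|]; last exact: pair_le_trans.
suff -> : allrel pair_le (zip (nseq (c x) x) (take (c x) u))
    (zip (flatten [seq nseq (c x) x | x <- s]) (drop (c x) u)) by [].
apply/allrelP => -[a b] [a' b'] /(map_f fst) + /(map_f fst); rewrite /= -!/(unzip1 _).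
rewrite !unzip1_zip ?size_nseq ?sz_take //; last first.
  by rewrite size_drop size_u addKn size_flatten sumnE big_map big_map;
    under eq_bigr do rewrite size_nseq.
rewrite mem_nseq => /andP[_ /eqP->] /flattenP[t /mapP[w ws ->]].
rewrite mem_nseq => /andP[_ /eqP->]; rewrite /pair_le /=.
by have /allP/(_ w ws) -> := x_s.
Qed.

Lemma count_zip_nseq (x y : 'I_n) (u : seq 'I_n) :
  count_mem (x, y) (zip (nseq (size u) x) u) = count_mem y u.
Proof. by elim: u => //= a u ->; rewrite xpair_eqE eqxx. Qed.

Lemma count_nth_reshape (c : 'I_n -> nat) (s u : seq 'I_n) x y :
    uniq s -> x \in s -> size u = \sum_(x <- s) c x ->
  count_mem y (nth [::] (reshape (map c s) u) (index x s)) =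
  count_mem (x, y) (zip (flatten [seq nseq (c x) x | x <- s]) u).
Proof.
elim: s u => //= a s IHs u /andP[a_s s_uniq]; rewrite inE big_cons => x_as size_u.
have sz_take : size (take (c a) u) = c a by rewrite size_takel // size_u leq_addr.
rewrite -[in RHS](cat_take_drop (c a) u) zip_cat ?size_nseq // count_cat.
have szd : size (drop (c a) u) = \sum_(x <- s) c x by rewrite size_drop size_u addKn.
have count_out b t v : x \notin t -> count_mem (x, y) (zip t v) = b -> b = 0.
  move=> x_t <-; apply/count_memPn; apply: contra x_t => /(map_f fst) /=.
  elim: t v {b} => [|b t IHt] [|z v] //=; rewrite !inE.
  by case/orP => [->//|/IHt ->]; rewrite orbT.
case: eqVneq => [ax | ax] /=.
  rewrite (count_out _ _ _ _ (erefl (count_mem _ (zip (flatten _) _)))) ?addn0; last first.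
    rewrite -ax; apply: contra a_s => /flattenP[t /mapP[w ws ->]].
    by rewrite mem_nseq => /andP[_ /eqP->].
  have := count_zip_nseq x y (take (c a) u); by rewrite sz_take ax => ->.
rewrite (count_out _ _ _ _ (erefl (count_mem _ (zip (nseq _ _) _)))); last first.
  by rewrite mem_nseq negb_and eq_sym ax orbT.
rewrite IHs //.
by move: x_as; rewrite eq_sym (negbTE ax).
Qed.

(** By this characterization the xi_{l(mu),j} with j in J(mu) are indexed by the
    canonical representatives of the orbits with first member l(mu). *)
Lemma mem_JsetE mu j : \sum_(i < n) tnth mu i = r ->
  (j \in Jset r mu) = mle (mi_l r mu) j && lex_sorted (mi_l r mu) j.
Proof.
move=> mu_sum; rewrite inE; congr (_ && _).
rewrite /tableau -[X in reshape X](map_tnth_enum) row_semistandard_reshape.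
- by rewrite /lex_sorted /pairs (val_mi_l mu_sum).
- by have := iota_ltn_sorted 0 n; rewrite -val_enum_ord sorted_map; exact: sub_sorted.
- by rewrite size_tuple big_enum.
Qed.

Lemma num_lastE mu j : \sum_(i < n) tnth mu i = r ->
  num_last mu j = count_mem (Defs.row ord_max, ord_max) (pairs (mi_l r mu) j).
Proof.
move=> mu_sum; rewrite /pairs (val_mi_l mu_sum) -count_nth_reshape ?enum_uniq ?mem_enum //; last first.
  by rewrite size_tuple big_enum.
by rewrite /num_last /tableau -[X in reshape X](map_tnth_enum) index_enum_ord.
Qed.

End Orbits.

(** * Changing entries of a multi-index from b to a *)

Section Lowering.

Variables m r : nat.
Local Notation n := m.+2.
Local Notation I := (mindex m r).
Implicit Types (h k i j c : I) (q : 'I_n * 'I_n) (mu : weight m) (D : {set 'I_r}).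

Definition recolor D (v : 'I_n) h : I :=
  [tuple if rho \in D then v else tnth h rho | rho < r].

Lemma tnth_recolor D v h rho :
  tnth (recolor D v h) rho = if rho \in D then v else tnth h rho.
Proof. by rewrite tnth_mktuple. Qed.

Section Step.

Variables a b : 'I_n.
Hypothesis ab : a != b.

(** h arises from c by changing d entries b into a.  Stated with pairs, the
    relation is visibly invariant under the symmetric group. *)
Definition lowers (d : nat) h c : bool :=
  all (fun q => (q.1 == q.2) || (q == (a, b))) (pairs h c)
  && (count_mem (a, b) (pairs h c) == d).

Definition places h c : {set 'I_r} := [set rho | (tnth h rho, tnth c rho) == (a, b)].

Lemma lowersE d h c :
  lowers d h c = [forall rho, (tnth h rho == tnth c rho) || (rho \in places h c)]
                 && (#|places h c| == d).
Proof.
rewrite /lowers all_pairs count_pairs; congr (_ && _).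
by apply: eq_forallb => rho; rewrite inE.
Qed.

Lemma perm_lowers d h c h' c' : perm_eq (pairs h c) (pairs h' c') ->
  lowers d h c = lowers d h' c'.
Proof. by move=> hc; rewrite /lowers (perm_all _ hc) (seq.permP hc). Qed.

Lemma lowers_le d h c : a <= b -> lowers d h c -> mle h c.
Proof.
move=> a_b /andP[/allP hc _]; rewrite mleE; apply/allP => -[x y] /hc /=.
by case/orP => [/eqP->|/eqP[-> ->]].
Qed.

Lemma diag_neq x : ((x, x) == (a, b)) = false.
Proof. by rewrite xpair_eqE; apply: contraNF ab => /andP[/eqP<- /eqP<-]. Qed.

Lemma lowers_count_snd d h c v : lowers d h c ->
  count_mem v c = count_mem (v, v) (pairs h c) + (v == b) * d.
Proof.
case/andP=> + /eqP <-; rewrite -(count_snd h c).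
elim: (pairs h c) => [|[x y] s IHs] /=; first by rewrite muln0.
case/andP => xy /IHs ->; case/orP: xy => [/eqP-> | /eqP[-> ->]].
  by rewrite diag_neq add0n xpair_eqE andbb addnA.
rewrite eqxx mulnDr addnCA addnA xpair_eqE muln1 eq_sym [a == v]eq_sym.
case: (eqVneq v b) => [->|_]; last by rewrite andbF !mul0n !addn0.
by rewrite [b == a]eq_sym (negbTE ab) /= add0n addnA.
Qed.

Lemma lowers_count_fst d h c v : lowers d h c ->
  count_mem v h = count_mem (v, v) (pairs h c) + (v == a) * d.
Proof.
case/andP=> + /eqP <-; rewrite -(count_fst h c).
elim: (pairs h c) => [|[x y] s IHs] /=; first by rewrite muln0.
case/andP => xy /IHs ->; case/orP: xy => [/eqP-> | /eqP[-> ->]].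
  by rewrite diag_neq add0n xpair_eqE andbb addnA.
rewrite eqxx mulnDr addnCA addnA xpair_eqE muln1 eq_sym [b == v]eq_sym.
case: (eqVneq v a) => [->|_]; last by rewrite !mul0n !addn0.
by rewrite (negbTE ab) /= add0n addnA.
Qed.

(** The multiset of pairs (h_rho, c_rho) is determined by d and the weight of c. *)
Lemma lowers_perm d h c h' c' : lowers d h c -> lowers d h' c' ->
  perm_eq c c' -> perm_eq (pairs h c) (pairs h' c').
Proof.
move=> hc hc' /seq.permP cc'; apply/seq.permP => P; move: P; apply/seq.permP/allP => -[x y] _ /=.
have [<-|xy] := eqVneq x y.
  have := lowers_count_snd x hc; rewrite cc' (lowers_count_snd x hc') => /eqP.
  by rewrite eqn_add2r eq_sym.
have [/andP[/allP hcP /eqP hcd] /andP[/allP hcP' /eqP hcd']] := (hc, hc').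
have [->|nab] := eqVneq (x, y) (a, b); first by rewrite hcd hcd'.
have out s : (forall q, q \in s -> (q.1 == q.2) || (q == (a, b))) -> count_mem (x, y) s = 0.
  by move=> sP; apply/count_memPn; apply/negP => /sP; rewrite /= (negbTE xy) (negbTE nab).
by rewrite !out.
Qed.

Lemma placesE d h c : lowers d h c -> c = recolor (places h c) b h.
Proof.
rewrite lowersE => /andP[/forallP hc _]; apply: eq_from_tnth => rho.
rewrite tnth_recolor; have := hc rho; case: ifP => [|_]; last by rewrite orbF => /eqP.
by rewrite inE => /eqP[].
Qed.

Lemma places_recolor D h : D \subset [set rho | tnth h rho == a] ->
  places h (recolor D b h) = D.
Proof.
move=> /subsetP Da; apply/setP => rho; rewrite inE tnth_recolor.
case: ifP => [/Da|_]; first by rewrite inE => /eqP->; rewrite eqxx.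
exact: diag_neq.
Qed.

Lemma lowers_recolor D h : D \subset [set rho | tnth h rho == a] ->
  lowers #|D| h (recolor D b h).
Proof.
move=> Da; rewrite lowersE places_recolor // eqxx andbT; apply/forallP => rho.
by rewrite tnth_recolor; case: ifP; rewrite ?orbT ?eqxx.
Qed.

Lemma sum_lowers (R : nmodType) d h (G : I -> R) :
  (\sum_(c | lowers d h c) G c =
   \sum_(D : {set 'I_r} | (D \subset [set rho | tnth h rho == a]) && (#|D| == d))
     G (recolor D b h))%R.
Proof.
rewrite (reindex_onto (fun D => recolor D b h) (places h)) /=; last first.
  by move=> c hc; rewrite -(placesE hc).
apply: eq_bigl => D; apply/andP/andP => [[hD /eqP DE] | [Da /eqP<-]]; last first.
  by rewrite lowers_recolor // places_recolor.
split; last by move: hD; rewrite lowersE => /andP[_]; rewrite DE.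
rewrite -DE; apply/subsetP => rho; rewrite !inE => /eqP[-> _]; exact: eqxx.
Qed.

(** The intermediate multi-indices between h and c correspond to the d-subsets of
    the d + e places where h and c differ. *)
Lemma card_lowers_split d e h c :
  #|[set D : {set 'I_r} | [&& D \subset [set rho | tnth h rho == a], #|D| == d
      & lowers e (recolor D b h) c]]| = lowers (d + e) h c * 'C(d + e, d).
Proof.
have [hc|hc] := boolP (lowers _ _ _); last first.
  rewrite mul0n; apply: eq_card0 => D; rewrite inE; apply: contraNF hc.
  case/and3P => /subsetP Da /eqP <-; rewrite !lowersE => /andP[/forallP Dc /eqP <-].
  have dis : [disjoint D & places (recolor D b h) c].
    rewrite -setI_eq0; apply/eqP/setP => rho; rewrite !inE tnth_recolor.
    case: ifP => //= _; rewrite xpair_eqE eq_sym (negbTE ab) //.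
  have -> : places h c = D :|: places (recolor D b h) c.
    apply/setP => rho; rewrite !inE tnth_recolor; have := Dc rho.
    rewrite inE tnth_recolor; case: ifP => //= rD.
    rewrite xpair_eqE [b == a]eq_sym (negbTE ab) /= orbF xpair_eqE.
    by have := Da rho rD; rewrite inE => -> /eqP<-; rewrite eqxx.
  rewrite cardsU (disjoint_setI0 dis) cards0 subn0 eqxx andbT.
  apply/forallP => rho; rewrite inE; have := Dc rho.
  rewrite !inE tnth_recolor; case: (rho \in D) => /=; last by case/orP => -> //; rewrite orbT.
  by rewrite orbT.
rewrite mul1n; have := hc; rewrite lowersE => /andP[/forallP hcP /eqP hcd].
rewrite -hcd -cards_draws; apply: eq_card => D; rewrite !inE.
have sub_a : places h c \subset [set rho | tnth h rho == a].
  by apply/subsetP => rho; rewrite !inE => /eqP[-> _].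
apply/and3P/andP => [[/subsetP Da /eqP Dd] | [Dpl /eqP Dd]].
  rewrite lowersE => /andP[/forallP Dc _]; rewrite Dd eqxx; split=> //.
  apply/subsetP => rho rD; have := Dc rho; rewrite !inE tnth_recolor rD.
  rewrite xpair_eqE [b == a]eq_sym (negbTE ab) /= orbF xpair_eqE.
  by have := Da rho rD; rewrite inE => -> /eqP<-; rewrite eqxx.
rewrite Dd eqxx (subset_trans Dpl sub_a); split=> //.
have pl : places (recolor D b h) c = places h c :\: D.
  apply/setP => rho; rewrite !inE tnth_recolor; case: ifP => //= rD.
  by rewrite xpair_eqE [b == a]eq_sym (negbTE ab).
rewrite lowersE pl cardsD (setIidPr Dpl) hcd Dd addKn eqxx andbT.
apply/forallP => rho; rewrite inE tnth_recolor; case: ifP => /= rD; last exact: hcP.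
by have := subsetP Dpl rho rD; rewrite inE => /eqP[_ ->]; rewrite eqxx.
Qed.

Lemma count_recolor D h c q : D \subset places h c ->
  count_mem q (pairs (recolor D b h) c) + #|D| * (q == (a, b)) =
  count_mem q (pairs h c) + #|D| * (q == (b, b)).
Proof.
have countE h' c' : count_mem q (pairs h' c') = \sum_rho ((tnth h' rho, tnth c' rho) == q).
  rewrite -sum1_count big_mkcond pairsE big_map big_enum /=.
  by apply: eq_bigr => rho _; case: eqP.
move=> /subsetP Dpl; rewrite !countE.
rewrite (bigID [in D]) [in RHS](bigID [in D]) /= -!sum_nat_const.
rewrite addnAC -[RHS]addnAC; congr (_ + _); last first.
  by apply: eq_bigr => rho /negbTE rD; rewrite tnth_recolor rD.
rewrite addnC; congr (_ + _); apply: eq_bigr => rho rD.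
  by have := Dpl rho rD; rewrite inE => /eqP ->; rewrite eq_sym.
by have := Dpl rho rD; rewrite inE tnth_recolor rD => /eqP[_ ->]; rewrite eq_sym.
Qed.

Lemma exists_lowers d c : d <= count_mem b c -> exists h, lowers d h c.
Proof.
move=> d_le; set B := [set rho | tnth c rho == b].
have cB : #|B| = count_mem b c by rewrite -(count_snd c c) count_pairs.
have /card_gt0P[D] : 0 < #|[set D : {set 'I_r} | D \subset B & #|D| == d]|.
  by rewrite cards_draws bin_gt0 cB.
rewrite inE => /andP[/subsetP DB /eqP <-]; exists (recolor D a c).
have pl : places (recolor D a c) c = D.
  apply/setP => rho; rewrite inE tnth_recolor; case: ifP => [/DB|].
    by rewrite inE => /eqP->; rewrite eqxx.
  by rewrite diag_neq.
rewrite lowersE pl eqxx andbT; apply/forallP => rho; rewrite tnth_recolor.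
by case: ifP => //=; rewrite ?orbT ?eqxx.
Qed.

End Step.

Section Shift.

Variables (mu : weight m) (nu : 'I_m.+1) (d : nat).
Local Notation a := (Defs.row nu).
Local Notation b := (next_row nu).

Lemma row_neq_next : a != b.
Proof. by rewrite -val_eqE /= /bump /= add1n neq_ltn ltnSn. Qed.

Lemma tnth_wshift v : tnth (wshift mu nu d) v =
  if v == a then tnth mu v + d else if v == b then tnth mu v - d else tnth mu v.
Proof. by rewrite tnth_mktuple. Qed.

Hypothesis d_le : d <= tnth mu b.

Lemma sum_wshift : \sum_(i < n) tnth (wshift mu nu d) i = \sum_(i < n) tnth mu i.
Proof.
have ba : b != a by rewrite eq_sym row_neq_next.
rewrite (bigD1 a) // (bigD1 b) //= [in RHS](bigD1 a) // [in RHS](bigD1 b) //=.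
rewrite !tnth_wshift !eqxx (negbTE ba).
under eq_bigr => v /andP[/negbTE va /negbTE vb] do rewrite tnth_wshift va vb.
by rewrite addnA -[_ + d + _]addnA subnKC // addnA.
Qed.

Hypothesis mu_sum : \sum_(i < n) tnth mu i = r.

(** Lower d entries of l(mu) anywhere and sort the resulting pairs: as b follows
    a immediately, the second members remain sorted, hence still form l(mu), and
    the first members are sorted of the weight of l(nu, d). *)
Lemma lowers_mi_l : lowers a b d (mi_l r (wshift mu nu d)) (mi_l r mu).
Proof.
have ab := row_neq_next.
have [h hl] : exists h, lowers a b d h (mi_l r mu).
  by apply: exists_lowers => //; rewrite count_mi_l.
have [h' [c' [canon hc']]] := lex_sorted_exists h (mi_l r mu).
have hl' : lowers a b d h' c' by rewrite (perm_lowers _ _ _ hc').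
have c'E : c' = mi_l r mu.
  apply: sorted_perm_mi_l => //; last exact: perm_pairs_snd hc'.
  rewrite -(map_snd_pairs h' c') sorted_map.
  case/andP: hl' => allq _; apply: (sub_in_sorted _ allq canon).
  move=> [x y] [x' y']; rewrite !unfold_in /= => /orP[/eqP->|/eqP[-> ->]] /orP[/eqP->|/eqP[-> ->]];
    rewrite /pair_le /= -?val_eqE /= /bump /= ?add1n.
  - by case: ltngtP.
  - by case: ltngtP => //= /ltnW/leqW.
  - by case: ltngtP => //= _ /leqW /ltnW.
  - by [].
suff <- : h' = mi_l r (wshift mu nu d) by rewrite -c'E.
have mu_sum' : \sum_(i < n) tnth (wshift mu nu d) i = r by rewrite sum_wshift.
apply: sorted_perm_mi_l => //; first exact: lex_sorted_fst canon.
rewrite perm_mi_lP //; apply/forallP => v; apply/eqP.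
rewrite (lowers_count_fst _ v hl') // tnth_wshift.
have := lowers_count_snd ab v hl'; rewrite c'E count_mi_l // => ->.
have [->|va] := eqVneq v a; first by rewrite (negbTE ab) !addn0 mul1n.
by case: eqP => _; rewrite ?mul1n ?mul0n ?addn0 ?addnK.
Qed.

End Shift.

End Lowering.

(** * Interpolation over an infinite field *)

Section Interpolation.

Import VectorInternalTheory.

Local Open Scope ring_scope.
Variable K : fieldType.
Hypothesis infK : infinite_set [set: K]%classic.

Lemma nonzero_uniq_seq N : exists s : seq K, [/\ uniq s, 0 \notin s & size s = N].
Proof.
elim: N => [|N [s [s_uniq s0 sN]]]; first by exists [::].
have [t ts] : exists t, t \notin 0 :: s.
  apply: contrapT => all_s; apply: infK; apply: (sub_finite_set _ (finite_seq (0 :: s))) => t _ /=.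
  by apply/negPn/negP => ts; apply: all_s; exists t.
move: ts; rewrite inE negb_or => /andP[t0 ts]; exists (t :: s).
by rewrite /= ts s_uniq inE negb_or eq_sym t0 s0 sN.
Qed.

Lemma poly_eq0_nonzero (q : {poly K}) : (forall t, t != 0 -> q.[t] = 0) -> q = 0.
Proof.
move=> q0; have [s [s_uniq s0 sN]] := nonzero_uniq_seq (size q).
apply/eqP; apply: contraT => /max_poly_roots/(_ _ s_uniq); rewrite sN ltnn => -> //.
by apply/allP => t ts; apply/rootP/q0; apply: contraNneq s0 => <-.
Qed.

(** Modulo V the coordinates of the sum are polynomials in t that vanish at
    infinitely many points. *)
Lemma vandermonde_mem (W : vectType K) (V : {vspace W}) N (f : nat -> W) :
    (forall t, t != 0 -> \sum_(d < N) t ^+ d *: f d \in V) ->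
  forall d, (d < N)%N -> f d \in V.
Proof.
move=> fV d dN; pose g e := f e - projv V (f e).
suff: g d = 0 by move/eqP; rewrite subr_eq0 => /eqP ->; apply: memv_proj.
apply: (can_inj v2rK); apply/rowP => i; rewrite linear0 [RHS]mxE.
pose q := \poly_(e < N) v2r (g e) 0 i.
suff q0 : q = 0 by have := coef_poly N (fun e => v2r (g e) 0 i) d; rewrite -/q q0 coef0 dN.
apply: poly_eq0_nonzero => t /fV /projv_id sum_f; rewrite horner_poly.
have : v2r (\sum_(e < N) t ^+ e *: g e) 0 i = 0.
  rewrite (_ : \sum_(e < N) _ = 0) ?linear0 ?mxE //.
  rewrite /g; under eq_bigr do rewrite scalerBr -linearZ.
  by rewrite sumrB -(linear_sum (projv V)); apply/eqP; rewrite subr_eq0; apply/eqP/esym.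
rewrite linear_sum summxE => sum0; rewrite -[RHS]sum0; apply: eq_bigr => e _.
by rewrite linearZ mxE mulrC.
Qed.

End Interpolation.

(** The multiplicity of v in s is the digit in position v of the sum in base N. *)
Lemma expn_digits N (s s' : seq nat) : size s < N -> size s' < N ->
  \sum_(c <- s) N ^ c = \sum_(c <- s') N ^ c -> perm_eq s s'.
Proof.
move=> sN s'N eq_sum; apply/allP => v _ /=; apply/eqP.
have N_gt0 : 0 < N by apply: leq_ltn_trans sN.
suff dig u : size u < N -> count_mem v u = (\sum_(c <- u) N ^ c) %/ N ^ v %% N.
  by rewrite !dig // eq_sum.
move=> uN.
have low : \sum_(c <- u | c < v) N ^ c < N ^ v.
  case: v => [|v]; first by rewrite big1.
  apply: leq_ltn_trans (_ : size u * N ^ v < _); last by rewrite expnS ltn_pmul2r ?expn_gt0 ?N_gt0.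
  rewrite -sum1_size big_distrl /= big_mkcond leq_sum // => c _; rewrite mul1n.
  by case: ifP => // cv; rewrite leq_pexp2l.
(* The terms above position v contribute a multiple of N^(v+1). *)
have [q high] : exists q, \sum_(c <- u | v < c) N ^ c = q * N * N ^ v.
  exists (\sum_(c <- u | v < c) N ^ (c - v.+1)); rewrite -mulnA -expnS big_distrl /=.
  by apply: eq_bigr => c vc; rewrite -expnD subnK.
have -> : \sum_(c <- u) N ^ c =
    (q * N + count_mem v u) * N ^ v + \sum_(c <- u | c < v) N ^ c.
  rewrite mulnDl -high (bigID (fun c => c < v)) addnC /=; congr (_ + _).
  rewrite (bigID (fun c => v < c)) /=; congr (_ + _).
    by apply: eq_bigl => c; case: ltngtP.
  rewrite -sum1_count big_distrl /= (eq_bigl (fun c => c == v)).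
    by apply: eq_bigr => c /eqP->; rewrite mul1n.
  by move=> c; case: ltngtP.
rewrite divnMDl ?expn_gt0 ?N_gt0 // (divn_small low) addn0 modnMDl modn_small //.
exact: leq_ltn_trans (count_size _ _) uN.
Qed.

(** * The Borel-Schur algebra inside the tensor endomorphisms *)

Section Coefficients.

Local Open Scope ring_scope.
Variables (K : fieldType) (m r : nat).
Local Notation n := m.+2.
Local Notation I := (mindex m r).
Local Notation End := (tensor_end K m r).
Implicit Types (h k i j : I) (x y : End).

Lemma entryD x y h k : coef (x + y) h k = coef x h k + coef y h k.
Proof. by rewrite /coef mxE. Qed.

Lemma entryZ (c : K) x h k : coef (c *: x) h k = c * coef x h k.
Proof. by rewrite /coef mxE. Qed.

Lemma entry0 h k : coef (0 : End) h k = 0.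
Proof. by rewrite /coef mxE. Qed.

Lemma entry_sum (T : Type) (s : seq T) (P : pred T) (F : T -> End) h k :
  coef (\sum_(t <- s | P t) F t) h k = \sum_(t <- s | P t) coef (F t) h k.
Proof.
by apply: (big_morph (fun x => coef x h k)) => [x y|]; rewrite ?entryD ?entry0.
Qed.

Lemma coef_xiE i j h k : coef (xi K i j) h k = (perm_eq (pairs h k) (pairs i j))%:R.
Proof. by rewrite coef_xi same_orbitE perm_sym. Qed.

Definition orbit_inv x : Prop := forall h k h' k',
  perm_eq (pairs h k) (pairs h' k') -> coef x h k = coef x h' k'.

Definition upper x : Prop := forall h k, ~~ mle h k -> coef x h k = 0.

Lemma perm_mle h k h' k' : perm_eq (pairs h k) (pairs h' k') -> mle h k = mle h' k'.
Proof. by rewrite !mleE; apply: perm_all. Qed.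

Lemma xi_expansion x : orbit_inv x ->
  x = \sum_(hk : I * I | lex_sorted hk.1 hk.2) coef x hk.1 hk.2 *: xi K hk.1 hk.2.
Proof.
move=> x_inv; apply: tensor_end_eq => h k; rewrite entry_sum.
have [h0 [k0 [canon hk0]]] := lex_sorted_exists h k.
rewrite (bigD1 (h0, k0)) //= entryZ coef_xiE perm_sym hk0 mulr1 big1 ?addr0.
  by apply: x_inv; rewrite perm_sym.
move=> [h' k'] /= /andP[canon' ne]; rewrite entryZ coef_xiE.
case: (boolP (perm_eq _ _)) => hk'; last by rewrite mulr0.
have [] := lex_sorted_inj canon canon' (perm_trans hk0 hk').
by move=> eh ek; rewrite -eh -ek eqxx in ne.
Qed.

Section Borel.

Hypothesis infK : infinite_set [set: K]%classic.

(** Kronecker substitution: putting t^((r+1)^c) at the c-th entry of a matrix turns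
    the monomials of degree r in its entries, that is, the orbits of pairs of
    multi-indices, into pairwise distinct powers of one variable t. *)
Definition kronecker_code (q : 'I_n * 'I_n) : nat := enum_rank q.
Definition kronecker_exp h k : nat :=
  \sum_(c <- map kronecker_code (pairs h k)) r.+1 ^ c.

Definition kronecker_mx (t : K) : 'M[K]_n :=
  \matrix_(a, b) (if (a <= b)%N then t ^+ (r.+1 ^ kronecker_code (a, b)) else 0).

Lemma kronecker_mx_Bplus t : t != 0 -> in_Bplus (kronecker_mx t).
Proof.
move=> t0; have trig : is_trig_mx (kronecker_mx t)^T.
  by apply/is_trig_mxP => i j ij; rewrite !mxE leqNgt ij.
rewrite /in_Bplus trig andbT unitmxE -det_tr det_trig // unitfE.
by apply/prodf_neq0 => i _; rewrite !mxE leqnn expf_neq0.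
Qed.

Lemma coef_pow_kronecker t h k :
  coef (tensor_pow r (kronecker_mx t)) h k =
  if mle h k then t ^+ kronecker_exp h k else 0.
Proof.
rewrite coef_pow; case: ifP => [/mleP hk | /negbT].
  rewrite /kronecker_exp pairsE big_map big_map expr_sum big_enum.
  by apply: eq_bigr => rho _; rewrite mxE hk.
rewrite negb_forall => /existsP[rho hk].
by rewrite (bigD1 rho) //= mxE (negbTE hk) mul0r.
Qed.

Lemma kronecker_exp_inj h k h' k' :
  (kronecker_exp h k == kronecker_exp h' k') = perm_eq (pairs h k) (pairs h' k').
Proof.
apply/eqP/idP => [|hk]; last by apply: perm_big; apply: perm_map.
move/expn_digits; rewrite !size_map !size_pairs => /(_ (ltnSn r) (ltnSn r)).
by apply: perm_map_inj => q q' /val_inj/enum_rank_inj.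
Qed.

(** The image of the triangular matrix with entries t^((r+1)^c) is a polynomial in
    t whose coefficients are the xi_{i,j} with i <= j, so that interpolation
    recovers each of them from points of the Borel group. *)
Lemma xi_borel i j : mle i j -> xi K i j \in borel_span K m r.
Proof.
move=> ij; pose M := (\max_(hk : I * I) kronecker_exp hk.1 hk.2).+1.
pose v d : End := \matrix_(h, k) (mle (enum_val h) (enum_val k) &&
   (kronecker_exp (enum_val h) (enum_val k) == d))%:R.
have coef_v d h k : coef (v d) h k = (mle h k && (kronecker_exp h k == d))%:R.
  by rewrite /coef mxE !enum_rankK.
have lt_M h k : (kronecker_exp h k < M)%N.
  by rewrite ltnS (leq_bigmax (F := fun hk : I * I => kronecker_exp hk.1 hk.2) (h, k)).
have -> : xi K i j = v (kronecker_exp i j).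
  apply: tensor_end_eq => h k; rewrite coef_xiE coef_v kronecker_exp_inj.
  by case: (boolP (perm_eq _ _)) => [/perm_mle->|]; rewrite ?ij ?andbF.
apply: (vandermonde_mem infK _ (lt_M i j)) => t t0.
apply: mem_span_of; exists (kronecker_mx t); first exact: kronecker_mx_Bplus.
apply: tensor_end_eq => h k; rewrite coef_pow_kronecker entry_sum.
rewrite (bigD1 (Ordinal (lt_M h k))) //= entryZ coef_v eqxx andbT.
rewrite big1 ?addr0 => [|d dn]; first by case: ifP; rewrite ?mulr1 ?mulr0.
rewrite entryZ coef_v; case: eqP => [ed|]; last by rewrite andbF mulr0.
by rewrite -val_eqE /= ed eqxx in dn.
Qed.

Lemma borel_orbit_inv x : x \in borel_span K m r -> orbit_inv x.
Proof.
move=> xB h k h' k' eqp.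
pose c z : K^o := coef z h k - coef z h' k'.
have c_lin : linear c.
  by move=> e z w; rewrite /c /coef !mxE opprD addrACA -mulrBr.
pose cl : {linear End -> K^o} := HB.pack c (GRing.isLinear.Build _ _ _ _ c c_lin).
suff: x \in lker (linfun cl).
  by rewrite memv_ker lfunE subr_eq0 => /eqP.
apply: (subvP _ _ xB); apply: span_of_subv => _ [g _ ->].
rewrite memv_ker lfunE /= /c !coef_pow subr_eq0; apply/eqP.
have prodE h1 k1 : \prod_rho g (tnth h1 rho) (tnth k1 rho) =
    \prod_(q <- pairs h1 k1) g q.1 q.2 by rewrite pairsE big_map big_enum.
by rewrite !prodE; apply: perm_big.
Qed.

Lemma borel_upper x : x \in borel_span K m r -> upper x.
Proof.
by move=> xB h k hk; have := SB_upper (Subvs xB : SB K m r) hk.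
Qed.

(** Together with borel_orbit_inv and borel_upper this describes S(B^+) by the
    coefficients of its elements. *)
Lemma mem_borel x : orbit_inv x -> upper x -> x \in borel_span K m r.
Proof.
move=> x_inv x_up; rewrite (xi_expansion x_inv); apply: memv_suml => -[h k] /= _.
have [hk | /x_up ->] := boolP (mle h k); last by rewrite scale0r mem0v.
exact/memvZ/xi_borel.
Qed.

Lemma borelM x y : x \in borel_span K m r -> y \in borel_span K m r ->
  x * y \in borel_span K m r.
Proof. by move=> xB yB; apply: (subvP (asubv (borel_schur K m r))); apply: memv_mul. Qed.

End Borel.

End Coefficients.

(** * Right projectives and divided powers *)

Section DividedPowers.

Local Open Scope ring_scope.
Variables (K : fieldType) (m r : nat).
Hypothesis infK : infinite_set [set: K]%classic.
Local Notation n := m.+2.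
Local Notation I := (mindex m r).
Local Notation End := (tensor_end K m r).
Local Notation B := (borel_span K m r).
Local Notation l := (mi_l r).
Implicit Types (h k i j c : I) (x y : End) (mu : weight m) (nu : 'I_m.+1).

Lemma perm_pairs_diag h k j : perm_eq (pairs h k) (pairs j j) = (h == k) && perm_eq h j.
Proof.
have diag i : pairs i i = [seq (v, v) | v <- i] by rewrite /pairs; elim: (val i) => //= v s ->.
apply/idP/andP => [hk | [/eqP<- hj]]; last by rewrite !diag perm_map.
split; last exact: perm_pairs_fst hk.
have : all (fun q => q.1 == q.2) (pairs h k).
  by rewrite (perm_all _ hk) diag all_map; apply/allP => v _ /=.
by rewrite all_pairs => /forallP hkE; apply/eqP/eq_from_tnth => rho; apply/eqP/hkE.
Qed.

Lemma coef_xi_wt mu h k : coef (xi_wt K r mu) h k = ((h == k) && perm_eq h (l mu))%:R.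
Proof. by rewrite coef_xiE perm_pairs_diag. Qed.

Lemma coef_wtl mu x h k : coef (xi_wt K r mu * x) h k = (perm_eq h (l mu))%:R * coef x h k.
Proof.
rewrite Defs.coefM (bigD1 h) //= coef_xi_wt eqxx big1 ?addr0 // => i /negbTE ih.
by rewrite coef_xi_wt eq_sym ih mul0r.
Qed.

Lemma coef_wtr mu x h k : coef (x * xi_wt K r mu) h k = coef x h k * (perm_eq k (l mu))%:R.
Proof.
rewrite Defs.coefM (bigD1 k) //= coef_xi_wt eqxx big1 ?addr0 // => i /negbTE ih.
by rewrite coef_xi_wt ih mulr0.
Qed.

Lemma xi_wt_borel mu : xi_wt K r mu \in B.
Proof. exact/xi_borel/mle_refl. Qed.

Section RightProj.

Variable mu : weight m.
Hypothesis mu_sum : (\sum_(i < n) tnth mu i = r)%N.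

(** The idempotent xi_mu acts as the projection onto the rows of weight mu. *)
Lemma mem_right_proj x :
  x \in right_proj K r mu <-> x \in B /\ (forall h k, ~~ perm_eq h (l mu) -> coef x h k = 0).
Proof.
split=> [/memv_imgP[y yB ->] | [xB x_out]].
  rewrite lfunE /=; split; first by apply: borelM => //; apply: xi_wt_borel.
  by move=> h k /negbTE hl; rewrite coef_wtl hl mul0r.
have -> : x = amull (xi_wt K r mu) x; last exact: memv_img.
apply: tensor_end_eq => h k; rewrite lfunE /= coef_wtl.
by have [|/x_out ->] := boolP (perm_eq h (l mu)); rewrite ?mul1r ?mulr0.
Qed.

Lemma right_proj_borel x : x \in right_proj K r mu -> x \in B.
Proof. by case/mem_right_proj. Qed.

Lemma xi_wt_right_proj x : x \in right_proj K r mu -> xi_wt K r mu * x = x.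
Proof.
case/mem_right_proj => _ x_out; apply: tensor_end_eq => h k; rewrite coef_wtl.
by have [|/x_out ->] := boolP (perm_eq h (l mu)); rewrite ?mul1r ?mulr0.
Qed.

Lemma right_projM x y : x \in right_proj K r mu -> y \in B -> x * y \in right_proj K r mu.
Proof.
move=> /mem_right_proj[xB x_out] yB; apply/mem_right_proj; split; first exact: borelM.
by move=> h k hl; rewrite Defs.coefM big1 // => i _; rewrite x_out ?mul0r.
Qed.

Lemma xi_mem_right_proj j : mle (l mu) j -> xi K (l mu) j \in right_proj K r mu.
Proof.
move=> lj; apply/mem_right_proj; split; first exact: xi_borel.
move=> h k hl; rewrite coef_xiE; case: (boolP (perm_eq _ _)) => // /perm_pairs_fst.
by rewrite (negbTE hl).
Qed.

Lemma Jset_mle j : j \in Jset r mu -> mle (l mu) j.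
Proof. by rewrite mem_JsetE // => /andP[]. Qed.

Lemma coef_xi_Jset i j : i \in Jset r mu -> j \in Jset r mu ->
  coef (xi K (l mu) i) (l mu) j = (i == j)%:R.
Proof.
rewrite !mem_JsetE // => /andP[_ ci] /andP[_ cj]; rewrite coef_xiE.
case: eqVneq => [->|ij]; first by rewrite perm_refl.
case: (boolP (perm_eq _ _)) => // /(lex_sorted_inj cj ci)[_ ji].
by rewrite ji eqxx in ij.
Qed.

Lemma right_proj_expansion x : x \in right_proj K r mu ->
  x = \sum_(j in Jset r mu) coef x (l mu) j *: xi K (l mu) j.
Proof.
case/mem_right_proj=> xB x_out; rewrite {1}(xi_expansion (borel_orbit_inv xB)).
rewrite -(pair_big_dep xpredT (fun h k => lex_sorted h k)
  (fun h k => coef x h k *: xi K h k)) /= (bigD1 (l mu)) //= [X in _ + X]big1 ?addr0.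
  rewrite [LHS](bigID (mle (l mu))) /= [X in _ + X]big1 ?addr0.
    by apply: eq_bigl => j; rewrite mem_JsetE // andbC.
  by move=> j /andP[_ lj]; rewrite (borel_upper xB) ?scale0r.
move=> h hl; rewrite big1 // => k hk; have [hl'|hl'] := boolP (perm_eq h (l mu)).
  by case/eqP: hl; apply: sorted_perm_mi_l => //; apply: lex_sorted_fst hk.
by rewrite x_out ?scale0r.
Qed.

End RightProj.

Section DPow.

Variable nu : 'I_m.+1.
Local Notation a := (Defs.row nu).
Local Notation b := (next_row nu).
Let ab : a != b := row_neq_next nu.

(** The divided power of the root vector of the simple root subgroup nu: the
    coefficient of t^d in the image of 1 + t E_{nu,nu+1} (see
    tensor_pow_transvection).  Unlike xi_{l(nu,d),l} it is defined on all
    weight spaces at once. *)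
Definition dpow (d : nat) : End :=
  \matrix_(h, k) (lowers a b d (enum_val h) (enum_val k))%:R.

Lemma coef_dpow d h k : coef (dpow d) h k = (lowers a b d h k)%:R.
Proof. by rewrite /coef mxE !enum_rankK. Qed.

Lemma dpow_borel d : dpow d \in B.
Proof.
apply: mem_borel => //.
  by move=> h k h' k' hk; rewrite !coef_dpow (perm_lowers _ _ _ hk).
move=> h k; rewrite coef_dpow; case: (boolP (lowers _ _ _ _ _)) => // /lowers_le -> //.
Qed.

Lemma coef_dpowM d x h k : coef (dpow d * x) h k =
  \sum_(D : {set 'I_r} | (D \subset [set rho | tnth h rho == a]) && (#|D| == d))
     coef x (recolor D b h) k.
Proof.
rewrite Defs.coefM -(sum_lowers ab d h (fun c => coef x c k)) [RHS]big_mkcond /=.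
by apply: eq_bigr => i _; rewrite coef_dpow; case: ifP; rewrite ?mul1r ?mul0r.
Qed.

Lemma dpowM d e : dpow d * dpow e = 'C(d + e, d)%:R *: dpow (d + e).
Proof.
apply: tensor_end_eq => h k; rewrite coef_dpowM entryZ coef_dpow -natrM mulnC.
rewrite -(card_lowers_split ab d e h k) -sum1dep_card natr_sum.
rewrite [RHS](eq_bigl (fun D : {set 'I_r} => ((D \subset [set rho | tnth h rho == a])
  && (#|D| == d)) && lowers a b e (recolor D b h) k)); last by move=> D; rewrite -andbA.
rewrite [RHS]big_mkcondr /=; apply: eq_bigr => D _; rewrite coef_dpow.
by case: ifP.
Qed.

Lemma dpow_wt mu d : (\sum_(i < n) tnth mu i = r)%N -> (d <= tnth mu b)%N ->
  dpow d * xi_wt K r mu = xi K (l (wshift mu nu d)) (l mu).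
Proof.
move=> mu_sum d_le; apply: tensor_end_eq => h k; rewrite coef_wtr coef_dpow coef_xiE -natrM mulnb.
have low := lowers_mi_l d_le mu_sum.
congr (_%:R); congr nat_of_bool; apply/andP/idP => [[hk kl] | hk].
  exact: lowers_perm hk low kl.
by rewrite (perm_lowers _ _ _ hk) low (perm_pairs_snd hk).
Qed.

Lemma dpow_wt0 mu d : (\sum_(i < n) tnth mu i = r)%N -> (tnth mu b < d)%N ->
  dpow d * xi_wt K r mu = 0.
Proof.
move=> mu_sum d_gt; apply: tensor_end_eq => h k; rewrite coef_wtr coef_dpow entry0 -natrM mulnb.
case: (boolP (_ && _)) => // /andP[hk kl].
have := lowers_count_snd ab b hk; rewrite eqxx mul1n (seq.permP kl) count_mi_l // => mu_b.
by move: d_gt; rewrite mu_b ltnNge leq_addl.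
Qed.

Lemma tensor_pow_transvection (t : K) :
  tensor_pow r (1%:M + t *: delta_mx a b) = \sum_(d < r.+1) t ^+ d *: dpow d.
Proof.
apply: tensor_end_eq => h k; rewrite coef_pow entry_sum.
under [RHS]eq_bigr do rewrite entryZ coef_dpow.
have [hk | hk] := boolP [forall rho, (tnth h rho == tnth k rho) || (rho \in places a b h k)].
  have c_lt : (#|places a b h k| < r.+1)%N by rewrite ltnS; have := max_card (places a b h k); rewrite card_ord.
  rewrite [RHS](bigD1 (Ordinal c_lt)) //= lowersE hk eqxx mulr1 [X in _ = _ + X]big1 ?addr0; last first.
    move=> d dn; rewrite lowersE hk /= eq_sym.
    by move: dn; rewrite -val_eqE /= => /negbTE->; rewrite mulr0.
  rewrite -prodr_const [RHS]big_mkcond; apply: eq_bigr => rho _; rewrite !mxE.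
  have /forallP/(_ rho) := hk; rewrite inE xpair_eqE.
  case: eqVneq => [->|_] /=; last by move=> ->; rewrite add0r mulr1.
  by rewrite -xpair_eqE diag_neq // mulr0 addr0.
rewrite [RHS]big1 => [|d _]; last by rewrite lowersE (negbTE hk) mulr0.
move: hk; rewrite negb_forall => /existsP[rho]; rewrite inE negb_or xpair_eqE => /andP[ne nab].
by rewrite (bigD1 rho) //= !mxE (negbTE ne) (negbTE nab) mulr0 addr0 mul0r.
Qed.

End DPow.

End DividedPowers.

(** * The last two rows *)

Section LastRow.

Variables m r : nat.
Local Notation n := m.+2.
Local Notation I := (mindex m r).
Local Notation l := (mi_l r).
Implicit Types (h k i j c : I) (D : {set 'I_r}).

Lemma lex_sortedE h k : lex_sorted h k =
  sorted (fun rho sigma => pair_le (tnth h rho, tnth k rho) (tnth h sigma, tnth k sigma))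
    (enum 'I_r).
Proof. by rewrite /lex_sorted pairsE sorted_map. Qed.

(** Changing the same number of pairs (a, b) into (b, b) on both sides preserves
    and reflects being in the same orbit. *)
Lemma perm_recolor (a b : 'I_n) D D' h c c' : a != b ->
    D \subset places a b h c -> D' \subset places a b h c' -> #|D| = #|D'| ->
  perm_eq (pairs (recolor D b h) c) (pairs (recolor D' b h) c') =
  perm_eq (pairs h c) (pairs h c').
Proof.
move=> ab Dc Dc' eqD; apply/allP/allP => eqc q _ /=.
  have /seq.permP/(_ (pred1 q)) /= e : perm_eq (pairs (recolor D b h) c) (pairs (recolor D' b h) c').
    exact/allP.
  by rewrite -(eqn_add2r (#|D| * (q == (b, b)))) -(count_recolor _ Dc) {2}eqD -(count_recolor _ Dc') e eqD.
have /seq.permP/(_ (pred1 q)) /= e : perm_eq (pairs h c) (pairs h c') by apply/allP.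
by rewrite -(eqn_add2r (#|D| * (q == (a, b)))) (count_recolor _ Dc) {2}eqD (count_recolor _ Dc') e eqD.
Qed.

Variables (lam : weight m) (d : nat).
Local Notation a := (Defs.row (ord_max : 'I_m.+1)).
Local Notation b := (ord_max : 'I_n).
Local Notation lam' := (wshift lam ord_max d).
Hypothesis lam_sum : \sum_(i < n) tnth lam i = r.
Hypothesis d_le : d <= tnth lam b.

Lemma next_row_max : next_row (ord_max : 'I_m.+1) = ord_max.
Proof. by apply: val_inj; rewrite /= /bump. Qed.

Let ab : a != b. Proof. by rewrite -next_row_max row_neq_next. Qed.

Let d_le' : d <= tnth lam (next_row ord_max). Proof. by rewrite next_row_max. Qed.

Let lam'_sum : \sum_(i < n) tnth lam' i = r. Proof. by rewrite sum_wshift. Qed.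

Let low : lowers a b d (l lam') (l lam).
Proof. by have := lowers_mi_l d_le' lam_sum; rewrite next_row_max. Qed.

Let le_b (v : 'I_n) : v <= b. Proof. exact: leq_ord. Qed.

Lemma num_last_le j : num_last lam j <= tnth lam a.
Proof.
rewrite num_lastE // -(count_mi_l lam_sum) -(count_fst (l lam) j).
by apply: sub_count => q /= /eqP->.
Qed.

(** Moving entries of the last row to the end of the row above keeps that row
    sorted, because all entries of the last row are equal to n. *)
Lemma Jset_last_row j : j \in Jset r lam -> j \in Jset r lam'.
Proof.
rewrite !mem_JsetE // => /andP[lj lj_srt].
have l'l : mle (l lam') (l lam) by apply: lowers_le low.
rewrite (mle_trans l'l lj) /=; move: lj_srt; rewrite !lex_sortedE => lj_srt.
have := sorted_mi_l lam'_sum; rewrite -(map_tnth_enum (l lam')) sorted_map => l'_srt.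
have := conj l'_srt lj_srt => /andP; rewrite -sorted_relI; apply: sub_sorted => rho sigma /=.
case/andP => le_l'; rewrite /pair_le /= => lj'.
move: low; rewrite lowersE => /andP[/forallP low' _].
move: le_l'; rewrite leq_eqVlt => /orP[/eqP/val_inj el' | -> //].
rewrite el' eqxx ltnn /=; case/orP: lj' => [ll|/andP[]//].
(* Now rho and sigma have the same label in l(lam'), and l increases from rho to
   sigma.  So sigma was moved up from the last row, where the entries are n. *)
have := low' sigma; rewrite inE => /orP[/eqP es | /eqP[_ es]]; last first.
  by move/mleP/(_ sigma): lj; rewrite es => js; rewrite (leq_trans (le_b _) js).
have := low' rho; rewrite inE => /orP[/eqP er | /eqP[_ er]].
  by move: ll; rewrite -er -es el' ltnn.
by move: ll; rewrite er ltnNge le_b.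
Qed.

Lemma places_last_row j : j \in Jset r lam -> places a b (l lam') (l lam) \subset places a b (l lam') j.
Proof.
move=> jJ; have /mleP lj := Jset_mle lam_sum jJ; apply/subsetP => rho; rewrite !inE.
rewrite !xpair_eqE => /andP[-> /eqP lb] /=.
by have := lj rho; rewrite lb => bj; apply/eqP/val_inj/eqP; rewrite eqn_leq le_b.
Qed.

Lemma card_places_last_row j : j \in Jset r lam ->
  #|places a b (l lam') j| = num_last lam j + d.
Proof.
move=> jJ; have := count_recolor (a, b) (places_last_row jJ).
rewrite -(placesE low) eqxx -num_lastE //; move: low; rewrite lowersE => /andP[_ /eqP->].
rewrite muln1 => ->; rewrite count_pairs xpair_eqE (negbTE ab) muln0 addn0.
by apply: eq_card => rho; rewrite !inE.
Qed.

Section Entries.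

Local Open Scope ring_scope.
Variable K : fieldType.
Hypothesis infK : infinite_set [set: K]%classic.

(** The coefficient at (l(n-1, d), c) counts the d-subsets D of the places of row
    n - 1 of the new tableau such that turning those places into n leads to the
    orbit of (l, j).  The places in D must carry the entry n, and then c is a
    rearrangement of j within the rows, hence c = j.  Row n - 1 of the new
    tableau has the entry n exactly a(j) + d times. *)
Lemma arrow_last_row j : j \in Jset r lam ->
  xi K (l lam') (l lam) * xi K (l lam) j =
  'C(num_last lam j + d, d)%:R *: xi K (l lam') j.
Proof.
move=> jJ; have jJ' := Jset_last_row jJ; have lj := Jset_mle lam_sum jJ.
have l'l : mle (l lam') (l lam) by apply: lowers_le low.
have xP : xi K (l lam') (l lam) * xi K (l lam) j \in right_proj K r lam'.
  by apply: right_projM => //; [apply: xi_mem_right_proj | apply: xi_borel].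
suff entry c : c \in Jset r lam' ->
    coef (xi K (l lam') (l lam) * xi K (l lam) j) (l lam') c =
    'C(num_last lam j + d, d)%:R * (c == j)%:R.
  rewrite (right_proj_expansion infK _ xP) // (bigD1 j) //= entry // eqxx mulr1.
  rewrite big1 ?addr0 // => c /andP[cJ /negbTE cj].
  by rewrite entry // cj mulr0 scale0r.
move=> cJ; rewrite -(dpow_wt K lam_sum d_le') -mulrA xi_wt_right_proj //; last exact: xi_mem_right_proj.
rewrite coef_dpowM // next_row_max -card_places_last_row //.
under eq_bigr => D /andP[Da /eqP Dd].
  have -> : coef (xi K (l lam) j) (recolor D b (l lam')) c =
     ((D \subset places a b (l lam') j) && (c == j))%:R :> K.
    rewrite coef_xiE {1}(placesE low); congr (_%:R); congr nat_of_bool.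
    have eqD : #|D| = #|places a b (l lam') (l lam)|.
      by move: low; rewrite lowersE Dd => /andP[_ /eqP->].
    apply/idP/andP => [eqc | [Dj /eqP->]]; last first.
      by rewrite (perm_recolor ab) ?places_last_row.
    have Dc : D \subset places a b (l lam') c.
      apply/subsetP => rho rD; have := subsetP Da rho rD; rewrite !inE xpair_eqE => -> /=.
      have : mle (recolor D b (l lam')) c by rewrite (perm_mle eqc) -(placesE low).
      move/mleP/(_ rho); rewrite tnth_recolor rD => bc.
      by apply/eqP/val_inj/eqP; rewrite eqn_leq le_b.
    move: eqc; rewrite (perm_recolor ab) ?places_last_row // => eqc.
    move: (cJ) (jJ'); rewrite !mem_JsetE // => /andP[_ cs] /andP[_ js].
    by have [_ cj] := lex_sorted_inj cs js eqc; rewrite -cj Dc eqxx.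
  over.
case: eqVneq => [_|_]; last by rewrite mulr0 big1 // => D _; rewrite andbF.
rewrite mulr1 -cards_draws -sum1dep_card natr_sum.
under eq_bigr do rewrite andbT; rewrite [RHS]big_mkcond [LHS]big_mkcond /=.
apply: eq_bigr => D _; case: (boolP (D \subset places _ _ _ _)) => [Dp|_]; last by case: ifP.
rewrite (subset_trans Dp) //; apply/subsetP => rho; rewrite !inE => /eqP[-> _]; exact: eqxx.
Qed.

End Entries.

End LastRow.

(** * The arrows leaving the weight lambda *)

Section Steps.

Local Open Scope ring_scope.
Variables (K : fieldType) (m r p : nat) (lam : weight m).
Local Notation n := m.+2.
Local Notation I := (mindex m r).
Local Notation l := (mi_l r).
Local Notation step := (step r p lam).
Implicit Types (h k i j c : I) (s t : step).

Definition step_size s : nat := (p ^ step_exp s)%N.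

Lemma step_size_gt0 s : (0 < step_size s)%N.
Proof. by case/andP: (valP s). Qed.

Lemma step_size_le s : (step_size s <= tnth lam (next_row (step_row s)))%N.
Proof. by case/andP: (valP s). Qed.

Hypothesis infK : infinite_set [set: K]%classic.
Hypothesis charK : has_char K p.
Hypothesis lam_sum : (\sum_(i < n) tnth lam i = r)%N.

Lemma step_exp0 s : p = 0%N -> step_exp s = 0%N.
Proof.
move=> p0; have := step_size_gt0 s; rewrite /step_size.
by case: (step_exp s) => // e; rewrite p0 exp0n.
Qed.

Lemma pchar_prime : p != 0%N -> prime p.
Proof. by move: charK; rewrite /has_char; case: (p) => // q /pcharf_prime. Qed.

Lemma pchar_mem : p != 0%N -> p \in [pchar K].
Proof. by move: charK; rewrite /has_char; case: (p). Qed.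

Lemma char0_natr (q : nat) : p = 0%N -> q.+1%:R != 0 :> K.
Proof. by move: charK => /[swap] ->; move/pcharf0P => ->. Qed.

Lemma step_val_inj s t : step_row s = step_row t -> step_exp s = step_exp t -> s = t.
Proof.
move=> er ee; apply: val_inj; rewrite [LHS]surjective_pairing [RHS]surjective_pairing.
by congr (_, _) => //; apply: val_inj.
Qed.

Lemma step_size_inj s t : step_row s = step_row t -> step_size s = step_size t -> s = t.
Proof.
move=> er es; apply: step_val_inj => //; have [p0|p_n0] := eqVneq p 0%N.
  by rewrite !step_exp0.
by apply/eqP; rewrite -(eqn_exp2l _ _ (prime_gt1 (pchar_prime p_n0))); apply/eqP.
Qed.

Lemma step_weight_sum s : (\sum_(i < n) tnth (step_weight s) i = r)%N.
Proof. by rewrite sum_wshift ?step_size_le. Qed.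

Lemma step_lowers s : lowers (Defs.row (step_row s)) (next_row (step_row s))
  (step_size s) (l (step_weight s)) (l lam).
Proof. exact: lowers_mi_l (step_size_le s) lam_sum. Qed.

(** Together these elements form a minimal system of generators of the radical of
    the left ideal generated by xi_lambda: entry_mul_arrow_neq shows that none
    can be omitted, and stable_line that they suffice. *)
Definition arrow s : tensor_end K m r := xi K (l (step_weight s)) (l lam).

Lemma arrow_dpow s : arrow s = dpow K r (step_row s) (step_size s) * xi_wt K r lam.
Proof. by rewrite dpow_wt ?step_size_le. Qed.

Lemma step_mle s : mle (l (step_weight s)) (l lam).
Proof.
by apply: lowers_le (step_lowers s); rewrite /= /bump /= add1n leqnSn.
Qed.

Lemma arrow_right_proj s : arrow s \in right_proj K r (step_weight s).
Proof. by apply: xi_mem_right_proj => //; apply: step_mle. Qed.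

Lemma arrow_borel s : arrow s \in borel_span K m r.
Proof. exact/xi_borel/step_mle. Qed.

Hypothesis lam_adm : admissible p lam.

Section LastSteps.

(** This is where the bound on lambda_{n-1} enters: at least one digit of a(j) in
    the positions 0, ..., d is smaller than p - 1. *)
Lemma last_step_exists j : j \in Jset r lam ->
  exists2 s : step, step_row s = ord_max & j \in Jdig r p lam (step_exp s).
Proof.
move=> jJ; case: lam_adm => lam_n digs.
suff [e [e_ok e_r eJ]] : exists e, [/\ (0 < p ^ e <= tnth lam ord_max)%N, (e <= r)%N &
    (p == 0%N) || (first_small_digit p (num_last lam j) == e)].
  have st : is_step p lam (ord_max, Ordinal (e_r : (e < r.+1)%N)) by rewrite /is_step /= next_row_max.
  by exists (Sub (ord_max, Ordinal (e_r : (e < r.+1)%N)) st : step); rewrite // inE jJ.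
have [p0|p_n0] := eqVneq p 0%N.
  by exists 0%N; split; rewrite ?p0 // expn0 /= lt0n lam_n.
have p_gt1 := prime_gt1 (pchar_prime p_n0).
have [d /andP[d_le d_gt] d_lt] := digs p_n0.
have a_lt := leq_ltn_trans (num_last_le lam_sum j) d_lt.
have [_ e_d] := first_small_digitP p_gt1 a_lt.
set e := first_small_digit _ _ in e_d *.
have e_ok : (p ^ e <= tnth lam ord_max)%N.
  by rewrite (leq_trans _ d_le) // leq_exp2l // -ltnS.
exists e; split; rewrite ?eqxx ?orbT //; first by rewrite expn_gt0 (ltnW p_gt1).
rewrite (leq_trans (ltnW (ltn_expl e p_gt1))) // (leq_trans e_ok) // -[X in (_ <= X)%N]lam_sum.
by rewrite (bigD1 (ord_max : 'I_n)) //= leq_addr.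
Qed.

Lemma last_step_uniq s t j : step_row s = ord_max -> step_row t = ord_max ->
  j \in Jdig r p lam (step_exp s) -> j \in Jdig r p lam (step_exp t) -> s = t.
Proof.
move=> sr tr; rewrite !inE => /andP[_ sJ] /andP[_ tJ].
apply: step_val_inj; rewrite ?sr ?tr //; have [p0|p_n0] := eqVneq p 0%N.
  by rewrite !step_exp0.
by move: sJ tJ; rewrite (negbTE p_n0) => /eqP-> /eqP.
Qed.

Lemma last_step_coef s j : j \in Jdig r p lam (step_exp s) ->
  'C(num_last lam j + step_size s, step_size s)%:R != 0 :> K.
Proof.
rewrite inE /step_size => /andP[_ sJ]; have [p0|p_n0] := eqVneq p 0%N.
  by rewrite step_exp0 // expn0 addn1 bin1 char0_natr.
move: sJ; rewrite (negbTE p_n0) /= => /eqP <-.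
have p_gt1 := prime_gt1 (pchar_prime p_n0).
apply: bin_addr_pexp_char; first exact: pchar_mem.
case: lam_adm => _ /(_ p_n0)[d _ d_lt].
have a_lt := leq_ltn_trans (num_last_le lam_sum j) d_lt.
by case: (first_small_digitP p_gt1 a_lt).
Qed.

Lemma arrow_last s j : step_row s = ord_max -> j \in Jset r lam ->
  arrow s * xi K (l lam) j =
  'C(num_last lam j + step_size s, step_size s)%:R *: xi K (l (step_weight s)) j.
Proof.
move=> sr jJ; rewrite /arrow /step_weight sr arrow_last_row //.
by have := step_size_le s; rewrite sr next_row_max.
Qed.

Lemma Jset_step s j : step_row s = ord_max -> j \in Jset r lam -> j \in Jset r (step_weight s).
Proof.
move=> sr jJ; rewrite /step_weight sr; apply: Jset_last_row => //.
by have := step_size_le s; rewrite sr next_row_max.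
Qed.

End LastSteps.

End Steps.

(** * The basis of P_1 *)

Section FreeCat.

Local Open Scope ring_scope.
Variables (K : fieldType) (V : vectType K).

Lemma free_cat_dual (X Y : seq V) : free X -> uniq Y ->
    (forall y, y \in Y -> exists f : 'Hom(V, K^o), [/\ f y != 0,
       forall x, x \in X -> f x = 0 & forall y', y' \in Y -> y' != y -> f y' = 0]) ->
  free (X ++ Y).
Proof.
move=> X_free; elim: Y => [|y Y IHY]; first by rewrite cats0.
case/andP=> yY Y_uniq dualY.
have -> : free (X ++ y :: Y) = free (y :: (X ++ Y)).
  by apply: perm_free; rewrite -(cat1s y Y) perm_catCA.
rewrite free_cons; apply/andP; split; last first.
  apply: IHY => // z zY; have [|f [fz fX fY]] := dualY z; first by rewrite inE zY orbT.
  by exists f; split=> // y' y'Y; apply: fY; rewrite inE y'Y orbT.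
have [|f [fy fX fY]] := dualY y; first exact: mem_head.
apply: contraNN fy => y_span; suff: y \in lker f by rewrite memv_ker.
apply: subvP y_span; apply/span_subvP => z; rewrite mem_cat memv_ker.
case/orP => [/fX -> //|zY]; rewrite fY ?inE ?zY ?orbT //.
by apply: contraNneq yY => <-.
Qed.

End FreeCat.

Section Basis.

Local Open Scope ring_scope.
Variables (K : fieldType) (m r p : nat) (lam : weight m).
Local Notation n := m.+2.
Local Notation I := (mindex m r).
Local Notation l := (mi_l r).
Local Notation step := (step r p lam).
Local Notation AP1 := (P1_ambient K r p lam).
Local Notation P1 := (P1 K r p lam).
Local Notation J := (Jset r).
Implicit Types (h k i j c : I) (s t : step).

Hypothesis infK : infinite_set [set: K]%classic.
Hypothesis charK : has_char K p.
Hypothesis lam_sum : (\sum_(i < n) tnth lam i = r)%N.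
Hypothesis lam_adm : admissible p lam.

Let wsum s : (\sum_(i < n) tnth (step_weight s) i = r)%N := step_weight_sum lam_sum s.

Definition entry s h k (x : AP1) : K^o := coef (x s) h k.

Fact entry_linear s h k : linear (entry s h k).
Proof. by move=> e x y; rewrite /entry /coef !ffunE !mxE. Qed.
HB.instance Definition _ s h k :=
  GRing.isLinear.Build K AP1 K^o _ (entry s h k) (entry_linear s h k).

Lemma P1_inj_sum (v : AP1) : v = \sum_(s : step) P1_inj s (v s).
Proof.
apply/ffunP => s; rewrite sum_ffunE (bigD1 s) //= ffunE eqxx big1 ?addr0 //.
by move=> t /negbTE ts; rewrite ffunE eq_sym ts.
Qed.

Lemma p1E eta : p1 p lam eta = \sum_(s : step) P1_inj s (arrow K s * eta).
Proof. by rewrite [LHS]P1_inj_sum; apply: eq_bigr => s _; rewrite ffunE. Qed.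

Lemma P1_inj_mem s x : x \in right_proj K r (step_weight s) -> P1_inj s x \in P1.
Proof.
move=> xP; apply/mem_P1 => t; rewrite ffunE; case: eqP => [->//|_]; exact: mem0v.
Qed.

Lemma mem_B_free b :
  b \in B_free K r p lam <-> exists (s : step) j, j \in Jstep s /\ b = P1_inj s (xi K (l (step_weight s)) j).
Proof.
split=> [/allpairsPdep[s [j [_ jJ ->]]] | [s [j [jJ ->]]]].
  by exists s, j; rewrite -mem_enum.
by apply/allpairsPdep; exists s, j; rewrite !mem_enum.
Qed.

Lemma mem_B_im b :
  b \in B_im K r p lam <-> exists2 j, j \in J lam & b = p1 p lam (xi K (l lam) j).
Proof.
split=> [/mapP[j jJ ->] | [j jJ ->]]; first by exists j; rewrite // mem_enum in jJ.
by apply/mapP; exists j; rewrite ?mem_enum.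
Qed.

Lemma Jstep_Jset s j : j \in Jstep s -> j \in J (step_weight s).
Proof. by rewrite /Jstep; case: ifP => // _; rewrite in_setD => /andP[]. Qed.

Lemma p1_mem eta : eta \in right_proj K r lam -> p1 p lam eta \in P1.
Proof.
move=> etaP; apply/mem_P1 => s; rewrite ffunE.
by apply: right_projM => //; [apply: arrow_right_proj | apply: right_proj_borel etaP].
Qed.

Lemma xi_J_mem (mu : weight m) j : (\sum_(i < n) tnth mu i = r)%N -> j \in J mu -> xi K (l mu) j \in right_proj K r mu.
Proof. by move=> mu_sum jJ; apply: xi_mem_right_proj => //; apply: Jset_mle. Qed.

Lemma B_all_P1 b : b \in B_all K r p lam -> b \in P1.
Proof.
rewrite mem_cat => /orP[/mem_B_free[s [j [jJ ->]]] | /mem_B_im[j jJ ->]].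
  by apply: P1_inj_mem; apply: xi_J_mem => //; apply: Jstep_Jset.
by apply: p1_mem; apply: xi_J_mem.
Qed.

Lemma entry_inj s t h k x : entry s h k (P1_inj t x) = if s == t then coef x h k else 0.
Proof. by rewrite /entry ffunE; case: eqP => //; rewrite entry0. Qed.

Lemma B_free_uniq : uniq (B_free K r p lam).
Proof.
apply: allpairs_uniq_dep => [|s _|]; rewrite ?enum_uniq //.
move=> _ _ /allpairsPdep[s [j [_ jJ ->]]] /allpairsPdep[t [k [_ kJ ->]]] /=.
rewrite !mem_enum in jJ kJ => /(congr1 (entry s (l (step_weight s)) j)).
rewrite !entry_inj eqxx coef_xi_Jset ?Jstep_Jset // eqxx.
have [st|_ /eqP] := eqVneq s t; last by rewrite oner_eq0.
move: k kJ; rewrite -{t}st => k kJ.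
rewrite coef_xi_Jset ?Jstep_Jset //; case: eqVneq => [->//|_ /eqP]; by rewrite oner_eq0.
Qed.

Lemma entry_last s j k : step_row s = ord_max -> j \in J lam -> k \in J lam ->
  entry s (l (step_weight s)) j (p1 p lam (xi K (l lam) k)) =
  'C(num_last lam k + step_size s, step_size s)%:R * (k == j)%:R.
Proof.
move=> sr jJ kJ; rewrite /entry ffunE -/(arrow K s) arrow_last // entryZ.
by rewrite coef_xi_Jset // Jset_step.
Qed.

(** For nu = n - 1 the element xi_{l(s),j} was removed from the free part when j
    belongs to step s, so that this coordinate only sees p_1(xi_{l,j}). *)
Lemma entry_last_free s j b : step_row s = ord_max -> j \in Jdig r p lam (step_exp s) ->
  b \in B_free K r p lam -> entry s (l (step_weight s)) j b = 0.
Proof.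
move=> sr jd /mem_B_free[t [k [kJ ->]]]; rewrite entry_inj; case: eqP => // st.
move: k kJ; rewrite -{t}st => k kJ.
have jJ : j \in J lam by move: jd; rewrite inE => /andP[].
have jJ' := Jset_step lam_sum sr jJ.
rewrite coef_xi_Jset ?(Jstep_Jset kJ) //; case: eqVneq => // kj; move: kJ; rewrite /Jstep sr eqxx kj.
by rewrite in_setD jd.
Qed.

Lemma p1_xi_inj : {in J lam &, injective (fun j => p1 p lam (xi K (l lam) j))}.
Proof.
move=> j k jJ kJ /=; have [s sr jd] := last_step_exists charK lam_sum lam_adm jJ.
move=> /(congr1 (entry s (l (step_weight s)) j)); rewrite !entry_last // eqxx mulr1.
case: (eqVneq k j) => // _; rewrite mulr0 => /eqP.
by rewrite (negbTE (last_step_coef charK lam_sum lam_adm jd)).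
Qed.

(** In the summands with nu = n - 1 the map p_1 is diagonal by arrow_last, so for each j in J(lambda) the
    coordinate of xi_{l(s),j}, for the step s that j belongs to, separates
    p_1(xi_{l,j}) from the rest of the family. *)
Lemma B_all_free : free (B_all K r p lam).
Proof.
apply: free_cat_dual.
- rewrite -[B_free _ _ _ _]cat0s; apply: free_cat_dual; [exact: nil_free | exact: B_free_uniq |].
  move=> _ /mem_B_free[s [j [jJ ->]]]; exists (linfun (entry s (l (step_weight s)) j)).
  split=> //; first by rewrite lfunE /= entry_inj eqxx coef_xi_Jset ?Jstep_Jset // eqxx oner_eq0.
  move=> _ /mem_B_free[t [k [kJ ->]]] ne; rewrite lfunE /= entry_inj; case: eqP => // st.
  move: k kJ ne; rewrite -{t}st => k kJ ne; rewrite coef_xi_Jset ?Jstep_Jset //.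
  by case: (eqVneq k j) ne => // ->; rewrite eqxx.
- rewrite map_inj_in_uniq ?enum_uniq // => j k; rewrite !mem_enum; exact: p1_xi_inj.
move=> _ /mem_B_im[j jJ ->]; have [s sr jd] := last_step_exists charK lam_sum lam_adm jJ.
exists (linfun (entry s (l (step_weight s)) j)); split.
- rewrite lfunE /= entry_last // eqxx mulr1; exact: last_step_coef jd.
- by move=> b bB; rewrite lfunE /= entry_last_free.
- move=> _ /mem_B_im[k kJ ->] ne; rewrite lfunE /= entry_last //.
  by case: (eqVneq k j) ne => [->|_]; rewrite ?eqxx ?mulr0.
Qed.

(** The only missing basis elements xi_{l(s),j} are recovered from p_1(xi_{l,j}),
    whose component at s is an invertible multiple of xi_{l(s),j} while its
    other components lie in the span of the free part. *)
Lemma P1_sub_span x : x \in P1 -> x \in <<B_all K r p lam>>%VS.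
Proof.
move/mem_P1 => xP; rewrite (P1_inj_sum x).
suff base s j : j \in J (step_weight s) ->
    P1_inj s (xi K (l (step_weight s)) j) \in <<B_all K r p lam>>%VS.
  apply: memv_suml => s _; rewrite (right_proj_expansion infK (wsum s) (xP s)) linear_sum.
  by apply: memv_suml => j jJ; rewrite linearZ; apply/memvZ/base.
have free_mem t k : k \in Jstep t ->
    P1_inj t (xi K (l (step_weight t)) k) \in <<B_all K r p lam>>%VS.
  by move=> kJ; apply: memv_span; rewrite mem_cat; apply/orP; left; apply/mem_B_free; exists t, k.
move=> jJ; have [jS|] := boolP (j \in Jstep s); first exact: free_mem.
rewrite {1}/Jstep; case: eqP => [sr|]; last by rewrite jJ.
rewrite in_setD jJ andbT negbK => jd.
have jJl : j \in J lam by move: jd; rewrite inE => /andP[].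
have : p1 p lam (xi K (l lam) j) \in <<B_all K r p lam>>%VS.
  by apply: memv_span; rewrite mem_cat; apply/orP; right; apply/mem_B_im; exists j.
rewrite p1E (bigD1 s) //= rpredDr; last first.
  apply: rpred_sum => t ts; have [tr|tr] := eqVneq (step_row t) ord_max.
    rewrite arrow_last // linearZ; apply/memvZ/free_mem.
    rewrite /Jstep tr eqxx in_setD Jset_step // andbT; apply: contra ts => jd'.
    exact/eqP/last_step_uniq/jd.
  have /(right_proj_expansion infK (wsum t))-> : arrow K t * xi K (l lam) j \in right_proj K r (step_weight t).
    by apply: right_projM => //; [apply: arrow_right_proj | apply: xi_borel => //; apply: Jset_mle].
  rewrite linear_sum; apply: memv_suml => k kJ; rewrite linearZ; apply/memvZ/free_mem.
  by rewrite /Jstep (negbTE tr).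
rewrite arrow_last // linearZ => /(memvZ ('C(num_last lam j + step_size s, step_size s)%:R^-1)).
by rewrite scalerA mulVf ?scale1r // (last_step_coef charK lam_sum lam_adm jd).
Qed.

End Basis.

(** * The dual of P_1 and its submodules *)

Section Dual.

Local Open Scope ring_scope.
Variables (K : fieldType) (m r p : nat) (lam : weight m).
Local Notation n := m.+2.
Local Notation I := (mindex m r).
Local Notation l := (mi_l r).
Local Notation step := (step r p lam).
Local Notation AP1 := (P1_ambient K r p lam).
Local Notation P1 := (P1 K r p lam).
Local Notation DP1 := (DP1 K r p lam).
Local Notation B_all := (B_all K r p lam).
Local Notation J := (Jset r).
Implicit Types (h k i j c : I) (s t : step) (psi phi : DP1) (u v : AP1).

(** Functionals on P_1 are evaluated at elements of the ambient space, which
    avoids carrying membership proofs in terms; outside of P_1 the value is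
    that at a projection and has no meaning. *)
Definition ev psi v : K^o := (psi : DP1_space K r p lam) (vsproj P1 v).

Definition ev_at v psi : K^o := ev psi v.

Fact ev_linear psi : linear (ev psi).
Proof. by move=> e u v; rewrite /ev !linearP. Qed.
HB.instance Definition _ psi := GRing.isLinear.Build K AP1 K^o _ (ev psi) (ev_linear psi).

Lemma evP e psi phi v : ev (e *: psi + phi) v = e * ev psi v + ev phi v.
Proof. by rewrite /ev add_lfunE scale_lfunE. Qed.

Fact ev_at_linear v : linear (ev_at v).
Proof. by move=> e psi phi; rewrite /ev_at evP. Qed.
HB.instance Definition _ v := GRing.isLinear.Build K DP1 K^o _ (ev_at v) (ev_at_linear v).

Lemma evD psi phi v : ev (psi + phi) v = ev psi v + ev phi v.
Proof. by rewrite /ev add_lfunE. Qed.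

Lemma evB psi phi v : ev (psi - phi) v = ev psi v - ev phi v.
Proof. by rewrite /ev add_lfunE opp_lfunE. Qed.

Lemma evZ e psi v : ev (e *: psi) v = e * ev psi v.
Proof. by rewrite /ev scale_lfunE. Qed.

Lemma ev0 v : ev 0 v = 0.
Proof. by rewrite /ev zero_lfunE. Qed.

Lemma ev_sum (T : Type) (s : seq T) (P : pred T) (F : T -> DP1) v :
  ev (\sum_(t <- s | P t) F t) v = \sum_(t <- s | P t) ev (F t) v.
Proof. by apply: (big_morph (ev^~ v)) => [psi phi|]; rewrite ?evD ?ev0. Qed.

Lemma ev_act (a : SB K m r) psi v : v \in P1 -> ev (act DP1 a psi) v = ev psi (P1_mulr v a).
Proof.
move=> vP; rewrite /ev [LHS]DP1_actE; congr (fun_of_lfun _ _).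
have e : vsval (vsproj P1 (P1_mulr v a)) = P1_mulr v a by rewrite vsprojK // P1_mulr_mem.
by apply: val_inj; rewrite [RHS]e /= vsprojK.
Qed.

Lemma ev_ext psi phi : (forall v, v \in P1 -> ev psi v = ev phi v) -> psi = phi.
Proof.
move=> eq_ev; apply/lfunP => x; have := eq_ev _ (subvsP x).
by rewrite /ev !vsvalK.
Qed.

Lemma p1_mulr eta (a : SB K m r) : P1_mulr (p1 p lam eta) a = p1 p lam (eta * val a).
Proof. by apply/ffunP => s; rewrite !ffunE mulrA. Qed.

Hypothesis infK : infinite_set [set: K]%classic.
Hypothesis charK : has_char K p.
Hypothesis lam_sum : (\sum_(i < n) tnth lam i = r)%N.
Hypothesis lam_adm : admissible p lam.

Let wsum s : (\sum_(i < n) tnth (step_weight s) i = r)%N := step_weight_sum lam_sum s.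
Let Bfree : free B_all := B_all_free infK charK lam_sum lam_adm.

Lemma ev_dual b b' : b \in B_all -> b' \in B_all -> ev (dual_elt b) b' = (b == b')%:R.
Proof.
move=> bB b'B; rewrite /ev lfunE /= /dual_coord.
have b_lt : (index b B_all < size B_all)%N by rewrite index_mem.
have b'_lt : (index b' B_all < size B_all)%N by rewrite index_mem.
rewrite insubT /= vsprojK; last exact: (B_all_P1 infK lam_sum).
have -> : b' = (in_tuple B_all)`_(Ordinal b'_lt) by rewrite /= nth_index.
rewrite coord_free // -val_eqE /= nth_index //; congr (_%:R); congr nat_of_bool.
by apply/eqP/eqP => [e|->//]; rewrite -(nth_index 0 bB) -(nth_index 0 b'B) e.
Qed.

Lemma ev_ext_B psi phi : (forall b, b \in B_all -> ev psi b = ev phi b) -> psi = phi.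
Proof.
move=> eq_ev; apply: ev_ext => v /(P1_sub_span infK charK lam_sum lam_adm) vB.
suff: v \in lker (linfun (ev (psi - phi))).
  by rewrite memv_ker lfunE /= evB subr_eq0 => /eqP.
apply: subvP vB; apply/span_subvP => b /eq_ev eb.
by rewrite memv_ker lfunE /= evB subr_eq0; apply/eqP.
Qed.

Lemma dual_expansion psi : psi = \sum_(b <- B_all) ev psi b *: dual_elt b.
Proof.
apply: ev_ext_B => b bB; rewrite ev_sum (bigD1_seq b) ?(free_uniq Bfree) //=.
rewrite evZ ev_dual // eqxx mulr1 big_seq_cond big1 ?addr0 // => b' /andP[b'B ne].
by rewrite evZ ev_dual // (negbTE ne) mulr0.
Qed.

Lemma B_free_sub b : b \in B_free K r p lam -> b \in B_all.
Proof. by move=> bB; rewrite mem_cat bB. Qed.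

Lemma B_im_sub b : b \in B_im K r p lam -> b \in B_all.
Proof. by move=> bB; rewrite mem_cat bB orbT. Qed.

Lemma B_free_im b b' : b \in B_free K r p lam -> b' \in B_im K r p lam -> (b == b') = false.
Proof.
move=> bF b'I; apply: contraTF (free_uniq Bfree) => /eqP bb'.
rewrite cat_uniq !negb_and; apply/orP; right; apply/orP; left.
by rewrite negbK; apply/hasP; exists b'; rewrite //= -bb'.
Qed.

Lemma p1_xi_mem j : j \in J lam -> p1 p lam (xi K (l lam) j) \in B_im K r p lam.
Proof. by move=> jJ; apply/mem_B_im; exists j. Qed.

Lemma ev_p1_ext psi (f : {linear tensor_end K m r -> K^o}) :
    (forall j, j \in J lam -> ev psi (p1 p lam (xi K (l lam) j)) = f (xi K (l lam) j)) ->
  forall eta, eta \in right_proj K r lam -> ev psi (p1 p lam eta) = f eta.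
Proof.
move=> ev_f eta etaP; rewrite (right_proj_expansion infK lam_sum etaP).
have p1_lin : linear (@p1 K m r p lam).
  by move=> e x y; apply/ffunP => s; rewrite !ffunE mulrDr scalerAr.
pose g : {linear tensor_end K m r -> AP1} := HB.pack (@p1 K m r p lam) (GRing.isLinear.Build _ _ _ _ _ p1_lin).
rewrite -[p1 p lam _]/(g _) linear_sum [LHS]linear_sum [RHS]linear_sum.
by apply: eq_bigr => j jJ; rewrite linearZ [LHS]linearZ [RHS]linearZ; congr (_ *: _); apply: ev_f.
Qed.

(** The dual basis elements of the free part span the annihilator of the remaining
    basis elements, which span p_1(e S). *)
Lemma mem_Uspace psi : psi \in Uspace K r p lam <->
  (forall eta, eta \in right_proj K r lam -> ev psi (p1 p lam eta) = 0).
Proof.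
split=> [psiU | psi0].
  apply: (@ev_p1_ext psi \0) => j jJ; have jB := p1_xi_mem jJ.
  suff: psi \in lker (linfun (ev_at (p1 p lam (xi K (l lam) j)))).
    by rewrite memv_ker lfunE => /eqP.
  apply: subvP psiU; apply/span_subvP => _ /mapP[b bF ->].
  rewrite memv_ker lfunE /= /ev_at (ev_dual (B_free_sub bF) (B_im_sub jB)).
  by rewrite (B_free_im bF jB).
rewrite (dual_expansion psi) big_cat /= rpredD //; rewrite big_seq_cond rpred_sum // => b.
  by rewrite andbT => bF; apply/memvZ/memv_span/map_f.
rewrite andbT => /mem_B_im[j jJ ->]; rewrite psi0 ?scale0r ?mem0v //.
exact: xi_J_mem.
Qed.

Lemma l_mem_J : l lam \in J lam.
Proof.
rewrite mem_JsetE // mle_refl lex_sortedE.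
have := sorted_mi_l lam_sum; rewrite -(map_tnth_enum (l lam)) sorted_map.
apply: sub_sorted => rho sigma /=; rewrite leq_eqVlt /pair_le => /orP[/eqP/val_inj->|->//].
by rewrite /= eqxx leqnn orbT.
Qed.

Definition coef_at h k (x : tensor_end K m r) : K^o := coef x h k.
Fact coef_at_linear h k : linear (coef_at h k).
Proof. by move=> e x y; rewrite /coef_at /coef !mxE. Qed.
HB.instance Definition _ h k :=
  GRing.isLinear.Build K (tensor_end K m r) K^o _ (coef_at h k) (coef_at_linear h k).

Lemma ev_z eta : eta \in right_proj K r lam ->
  ev (z_elt K p lam (l lam)) (p1 p lam eta) = coef eta (l lam) (l lam).
Proof.
apply: (@ev_p1_ext _ (coef_at (l lam) (l lam))) => j jJ; rewrite /= /coef_at.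
have lJ := l_mem_J; rewrite ev_dual ?B_im_sub ?p1_xi_mem //.
rewrite coef_xi_Jset // eq_sym; congr (_%:R); congr nat_of_bool.
by apply/eqP/eqP => [|->//]; apply: (p1_xi_inj infK charK lam_sum lam_adm).
Qed.

Lemma mem_EspaceP (w : amb_mod K r p lam) : w \in Espace K r p lam <->
  (forall eta, eta \in right_proj K r lam ->
     ev w.1 (p1 p lam eta) = (w.2 : K) * coef eta (l lam) (l lam)).
Proof.
rewrite mem_Espace mem_Uspace; split=> H eta etaP; have := H eta etaP.
  rewrite -scaleNr addrC evP ev_z // mulNr addrC => /eqP.
  by rewrite subr_eq0 => /eqP.
by rewrite -scaleNr addrC evP ev_z // mulNr addrC => ->; rewrite subrr.
Qed.

End Dual.

(** * Generators of the Borel group *)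

Section BorelGeneration.

Local Open Scope ring_scope.
Variables (K : fieldType) (m : nat).
Local Notation n := m.+2.
Implicit Types (g : 'M[K]_n) (a b c : 'I_n) (t : K).

Lemma in_BplusE g : in_Bplus g =
  [forall i : 'I_n, g i i != 0] && [forall i : 'I_n, forall j : 'I_n, (j < i)%N ==> (g i j == 0)].
Proof.
rewrite /in_Bplus andbC; have [tg|tg] /= := boolP (is_trig_mx g^T); last first.
  apply/esym/negbTE; rewrite negb_and; apply/orP; right; apply: contra tg => /forallP tg.
  by apply/is_trig_mxP => i j ij; rewrite mxE; have /forallP/(_ i)/implyP/(_ ij)/eqP := tg j.
have -> : [forall i : 'I_n, forall j : 'I_n, (j < i)%N ==> (g i j == 0)].
  apply/forallP => i; apply/forallP => j; apply/implyP => ji.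
  by move/is_trig_mxP/(_ j i ji): tg; rewrite mxE => ->.
rewrite andbT unitmxE -det_tr det_trig // unitfE; apply/prodf_neq0/forallP => gi i.
  by have := gi i isT; rewrite mxE.
by move=> _; rewrite mxE.
Qed.

Lemma in_BplusP g : reflect ((forall i, g i i != 0) /\ (forall i j : 'I_n, (j < i)%N -> g i j = 0)) (in_Bplus g).
Proof.
rewrite in_BplusE; apply: (iffP andP) => -[gd gt]; split.
- exact/forallP.
- by move=> i j ji; move/forallP/(_ i)/forallP/(_ j)/implyP/(_ ji)/eqP: gt.
- exact/forallP.
- by apply/forallP => i; apply/forallP => j; apply/implyP => ji; rewrite gt.
Qed.

Definition transvection a b t : 'M[K]_n := 1%:M + t *: delta_mx a b.

Lemma transvectionE a b t i j :
  transvection a b t i j = (i == j)%:R + t * ((i == a) && (j == b))%:R.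
Proof. by rewrite !mxE. Qed.

Lemma transvection_Bplus a b t : (a < b)%N -> in_Bplus (transvection a b t).
Proof.
move=> ab; apply/in_BplusP; split=> [i | i j ji]; rewrite transvectionE.
  rewrite eqxx; case: (boolP (_ && _)) => [/andP[/eqP-> /eqP e]|_]; last by rewrite mulr0 addr0 oner_eq0.
  by rewrite e ltnn in ab.
have /negbTE-> : i != j by rewrite neq_ltn ji orbT.
case: (boolP (_ && _)) => [/andP[/eqP ia /eqP jb]|_]; last by rewrite mulr0 addr0.
by move: ji; rewrite ia jb ltnNge ltnW.
Qed.

(** With X = t E_{ac} and Y = E_{cb} one has XY = t E_{ab}, while all other
    products of two of X, Y vanish. *)
Lemma transvection_commutator a c b t : (a < c)%N -> (c < b)%N ->
  transvection a b t = transvection a c t *m transvection c b 1 *m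
                       transvection a c (- t) *m transvection c b (- 1).
Proof.
move=> ac cb; rewrite /transvection scale1r !scaleNr scale1r.
set X : 'M[K]_n := t *: delta_mx a c; set Y : 'M[K]_n := delta_mx c b.
have zero a1 b1 a2 b2 : b1 != a2 -> delta_mx a1 b1 *m delta_mx a2 b2 = 0 :> 'M[K]_n.
  by move=> ne; rewrite mul_delta_mx_0.
have XY : X *m Y = t *: delta_mx a b by rewrite -scalemxAl mul_delta_mx.
have ca : c != a by rewrite neq_ltn ac orbT.
have bc : b != c by rewrite neq_ltn cb orbT.
have ba : b != a by rewrite neq_ltn (ltn_trans ac cb) orbT.
have XX : X *m X = 0 by rewrite -scalemxAl -scalemxAr zero // !scaler0.
have YY : Y *m Y = 0 by rewrite zero.
have YX : Y *m X = 0 by rewrite -scalemxAr zero // scaler0.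
have XYX : X *m Y *m X = 0 by rewrite XY -scalemxAl -scalemxAr zero // !scaler0.
have XYY : X *m Y *m Y = 0 by rewrite XY -scalemxAl zero // scaler0.
have e1 : (1%:M + X) *m (1%:M + Y) = (1%:M + X *m Y) *m ((1%:M + Y) *m (1%:M + X)).
  rewrite !(mulmxDl, mulmxDr, mul1mx, mulmx1) !mulmxA XYX XYY YX !mul0mx !addr0.
  by rewrite -!addrA; congr (_ + _); rewrite addrCA; congr (_ + _); rewrite addrC.
have e2 Z : Z *m Z = 0 -> (1%:M + Z) *m (1%:M - Z) = 1%:M :> 'M[K]_n.
  move=> ZZ; rewrite !(mulmxDl, mulmxDr, mul1mx, mulmx1) mulmxN ZZ oppr0 addr0.
  by rewrite -addrA addNr addr0.
by rewrite e1 -!mulmxA [(1%:M + X) *m _]mulmxA e2 // mul1mx e2 // mulmx1 XY.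
Qed.

Section Induction.

Variable P : 'M[K]_n -> Prop.
Hypothesis P_mul : forall g g', in_Bplus g -> in_Bplus g' -> P g -> P g' -> P (g *m g').
Hypothesis P_simple : forall (nu : 'I_m.+1) t, P (transvection (Defs.row nu) (next_row nu) t).
Hypothesis P_diag : forall g, in_Bplus g -> is_diag_mx g -> P g.

Lemma Bplus_ind_transvection a b t : (a < b)%N -> P (transvection a b t).
Proof.
move: {2}(b - a)%N (leqnn (b - a)) => d; elim: d a b t => [|d IHd] a b t.
  by rewrite leqn0 subn_eq0 leqNgt => /negP.
move=> ba_d ab; have [ab1|ab1] := eqVneq (val b) a.+1.
  have a_lt : (a < m.+1)%N by have := ltn_ord b; rewrite ab1.
  have := P_simple (Ordinal a_lt) t.
  rewrite (_ : Defs.row _ = a); last exact: val_inj.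
  by rewrite (_ : next_row _ = b) //; apply: val_inj; rewrite /= ab1 /bump.
have a1b : (a.+1 < b)%N by rewrite ltn_neqAle eq_sym ab1.
pose c : 'I_n := Ordinal (ltn_trans a1b (ltn_ord b)).
have ac : (a < c)%N by rewrite /=.
have cb : (c < b)%N by rewrite /=.
have Pac u : P (transvection a c u) by apply: IHd => //=; lia.
have Pcb u : P (transvection c b u) by apply: IHd => //=; lia.
rewrite (transvection_commutator t ac cb).
by do !apply: P_mul => //; rewrite ?in_BplusM ?transvection_Bplus.
Qed.

(** The Borel group is generated by the torus and the simple root subgroups:
    commutators yield all root subgroups, and row operations clear the entries
    above the diagonal one at a time. *)
Lemma Bplus_ind g : in_Bplus g -> P g.
Proof.
pose off g := [set q : 'I_n * 'I_n | (q.1 < q.2)%N && (g q.1 q.2 != 0)].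
move: {2}#|off g| (leqnn #|off g|) => N; elim: N g => [|N IHN] g.
  rewrite leqn0 cards_eq0 => /eqP off0 gB; apply: P_diag => //.
  apply/is_diag_mxP => i j ij; have [_ gt] := in_BplusP _ gB.
  case: (ltngtP i j) => [ij'|/gt//|/val_inj e]; last by rewrite e eqxx in ij.
  have : (i, j) \notin off g by rewrite off0 inE.
  by rewrite inE /= ij' /= negbK => /eqP.
move=> offN gB; have [off0|[q0 q0P]] := set_0Vmem (off g).
  by apply: IHN; rewrite // off0 cards0.
have [gd gt] := in_BplusP _ gB.
case: (arg_maxnP (P := [in off g]) (fun q : 'I_n * 'I_n => val q.2) q0P) => -[a b] /=.
rewrite inE /= => /andP[ab gab] maxb.
(* Since b is maximal, row b of g is a multiple of a unit vector, so that a
   row operation clears the entry (a, b) without changing any other. *)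
have row_b c : c != b -> g b c = 0.
  move=> cb; case: (ltngtP c b) => [/gt//|bc|/val_inj e]; last by rewrite e eqxx in cb.
  apply/eqP; apply: contraT => gbc.
  by move: (maxb (b, c)); rewrite inE /= bc gbc leqNgt bc => /(_ isT).
pose g' : 'M[K]_n := \matrix_(i, j) if (i == a) && (j == b) then 0 else g i j.
have b_a : b != a by rewrite neq_ltn ab orbT.
have g'B : in_Bplus g'.
  apply/in_BplusP; split=> [i | i j ji]; rewrite mxE; last by case: ifP => // _; apply: gt.
  case: ifP => // /andP[/eqP ia /eqP ib].
  by move: b_a; rewrite -ia -ib eqxx.
have tB := transvection_Bplus (g a b / g b b) ab.
have -> : g = transvection a b (g a b / g b b) *m g'.
  apply/matrixP => i j; rewrite mulmxDl mul1mx -scalemxAl !mxE (bigD1 b) //= big1 ?addr0.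
    rewrite !mxE eqxx andbT (negbTE b_a) /=.
    have [ia|ia] := eqVneq i a; last by rewrite mul0r mulr0 addr0.
    have [->|jb] := eqVneq j b; first by rewrite ia add0r mul1r divfK.
    by rewrite (row_b _ jb) /= !mulr0 addr0.
  by move=> c /negbTE cb; rewrite mxE cb andbF mul0r.
apply: P_mul => //; first exact: Bplus_ind_transvection.
apply: IHN => //; rewrite -ltnS (leq_trans _ offN) //; apply: proper_card.
apply/properP; split.
  by apply/subsetP => -[i j]; rewrite !inE /= mxE; case: ifP; rewrite ?eqxx ?andbF.
exists (a, b); first by rewrite inE /= ab.
by rewrite inE /= mxE !eqxx andbF.
Qed.

End Induction.

End BorelGeneration.

(** * Vectors killed by all arrows *)

Section Generation.

Local Open Scope ring_scope.
Variables (K : fieldType) (m r p : nat) (lam : weight m).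
Local Notation n := m.+2.
Local Notation I := (mindex m r).
Local Notation l := (mi_l r).
Local Notation step := (step r p lam).
Local Notation B := (borel_span K m r).
Implicit Types (h k i j c : I) (s t : step) (w : tensor_end K m r).

Hypothesis infK : infinite_set [set: K]%classic.
Hypothesis charK : has_char K p.
Hypothesis lam_sum : (\sum_(i < n) tnth lam i = r)%N.

Definition sb w : SB K m r := vsproj (borel_schur K m r) w.

Lemma val_sb w : w \in B -> val (sb w) = w.
Proof. exact: vsprojK. Qed.

Lemma sb_val (a : SB K m r) : sb (val a) = a.
Proof. exact: vsvalK. Qed.

Lemma sbM w w' : w \in B -> w' \in B -> sb (w * w') = sb w * sb w'.
Proof.
move=> wB w'B; apply: val_inj; rewrite val_sb; last exact: borelM.
by rewrite /= !val_sb.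
Qed.

(** The step with the largest p-power below d, cf. bin_leading_pexp_char. *)
Lemma exists_step (nu : 'I_m.+1) d : (0 < d <= tnth lam (next_row nu))%N ->
  exists s, [/\ step_row s = nu, (step_size s <= d)%N & 'C(d, step_size s)%:R != 0 :> K].
Proof.
case/andP=> d_gt0 d_le.
suff [e [e_gt0 e_d binE]] : exists e, [/\ (0 < p ^ e)%N, (p ^ e <= d)%N & 'C(d, p ^ e)%:R != 0 :> K].
  have e_r : (e < r.+1)%N.
    have [p0|p_n0] := eqVneq p 0%N; first by move: e_gt0; rewrite p0; case: (e) => [|e'] //; rewrite exp0n.
    rewrite ltnS (leq_trans (ltnW (ltn_expl e (prime_gt1 (pchar_prime charK p_n0))))) //.
    rewrite (leq_trans e_d) // (leq_trans d_le) // -[X in (_ <= X)%N]lam_sum.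
    by rewrite (bigD1 (next_row nu)) //= leq_addr.
  have st : is_step p lam (nu, Ordinal e_r) by rewrite /is_step /= e_gt0 (leq_trans e_d).
  by exists (Sub (nu, Ordinal e_r) st : step).
have [p0|p_n0] := eqVneq p 0%N.
  by exists 0%N; rewrite expn0 bin1 -(prednK d_gt0) (char0_natr charK).
have p_gt1 := prime_gt1 (pchar_prime charK p_n0).
have /andP[e_le e_gt] := trunc_log_bounds p_gt1 d_gt0.
exists (trunc_log p d); split; rewrite ?expn_gt0 ?(ltnW p_gt1) //.
by apply: bin_leading_pexp_char; rewrite ?pchar_mem ?e_le.
Qed.

Section KilledVector.

Variables (X : fdmod (SB K m r)) (x : X).
Hypothesis x_wt : act X (sb (xi_wt K r lam)) x = x.
Hypothesis x_killed : forall s, act X (sb (arrow K s)) x = 0.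

Definition act_on w : X := act X (sb w) x.

Lemma act_on_linear : linear act_on.
Proof. by move=> e w w'; rewrite /act_on /sb !linearP add_lfunE scale_lfunE. Qed.
HB.instance Definition _ := GRing.isLinear.Build K (tensor_end K m r) X _ act_on act_on_linear.

Lemma act_onM w w' : w \in B -> w' \in B -> act_on (w * w') = act X (sb w) (act_on w').
Proof. by move=> wB w'B; rewrite /act_on sbM // actM comp_lfunE. Qed.

Lemma act_on_wt w : w \in B -> act_on w = act_on (w * xi_wt K r lam).
Proof. by move=> wB; rewrite act_onM ?xi_wt_borel // /act_on x_wt. Qed.

(** The divided power of order d is, up to an invertible binomial coefficient, a
    left multiple of one whose order is the size of a step, and that one acts on
    a vector of weight lambda as an arrow. *)
Lemma act_on_dpow nu d : (0 < d)%N -> act_on (dpow K r nu d) = 0.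
Proof.
move=> d_gt0; have [d_le|d_gt] := leqP d (tnth lam (next_row nu)); last first.
  by rewrite act_on_wt ?dpow_borel // dpow_wt0 // linear0.
have [|s [snu s_le bin0]] := @exists_step nu d; first by rewrite d_gt0.
(* dpow (d - q) * dpow q is 'C(d, q) times dpow d, for q the size of s. *)
have := dpowM K r nu (d - step_size s) (step_size s); rewrite subnK // bin_sub //.
move/(congr1 act_on); rewrite linearZ act_onM ?dpow_borel // [act_on (dpow _ _ _ (step_size s))]act_on_wt ?dpow_borel //.
have := arrow_dpow K lam_sum s; rewrite snu => <-.
by rewrite /act_on x_killed linear0 => /esym/eqP; rewrite scaler_eq0 (negbTE bin0) => /eqP.
Qed.

(** The image of 1 + t E_{nu,nu+1} is the sum of the t^d times the divided powers of
    order d, of which only the one of order 0, the identity, acts nontrivially. *)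
Lemma act_on_transvection nu (u : K) : act_on (tensor_pow r (transvection (Defs.row nu) (next_row nu) u)) = x.
Proof.
have -> : x = act_on 1.
  by rewrite /act_on (_ : sb 1 = 1) ?act1 ?id_lfunE //; apply: val_inj; rewrite val_sb ?borel_span1 //= algid_borel.
have -> : 1 = dpow K r nu 0.
  have := tensor_pow_transvection r nu (0 : K); rewrite scale0r addr0 tensor_pow1 => ->.
  by rewrite big_ord_recl expr0 scale1r big1 ?addr0 // => d _; rewrite exprS mul0r scale0r.
rewrite /transvection tensor_pow_transvection linear_sum big_ord_recl expr0 scale1r.
by rewrite big1 ?addr0 // => d _; rewrite linearZ /= act_on_dpow ?scaler0.
Qed.

Lemma Bplus_borel g : in_Bplus g -> tensor_pow r g \in B.
Proof. by move=> gB; apply: mem_span_of; exists g. Qed.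

Lemma act_on_diag g : in_Bplus g -> is_diag_mx g -> act_on (tensor_pow r g) \in <[x]>%VS.
Proof.
move=> gB /is_diag_mxP g_diag; rewrite act_on_wt ?Bplus_borel //.
have -> : tensor_pow r g * xi_wt K r lam =
    (\prod_(v <- l lam) g v v) *: xi_wt K r lam.
  apply: tensor_end_eq => h k; rewrite coef_wtr entryZ coef_xi_wt coef_pow.
  have [<-|hk] := eqVneq h k; last first.
    rewrite mulr0; have [rho hkr] : exists rho, tnth h rho != tnth k rho.
      apply/existsP; apply: contraNT hk; rewrite negb_exists => /forallP hk.
      by apply/eqP/eq_from_tnth => rho; apply/eqP; move: (hk rho); rewrite negbK.
    by rewrite (bigD1 rho) //= g_diag ?mul0r.
  case: (boolP (perm_eq _ _)) => [hl|_]; last by rewrite !mulr0.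
  by rewrite !mulr1 -(perm_big _ hl) big_tuple.
by rewrite linearZ /= /act_on x_wt; apply/memvZ/memv_line.
Qed.

(** As the image of the Borel group spans S(B^+), it suffices that generators of
    the group preserve the line of x. *)
Lemma stable_line (a : SB K m r) : act X a x \in <[x]>%VS.
Proof.
suff: (B <= linfun act_on @^-1: <[x]>)%VS.
  by move/subvP/(_ _ (subvsP a)); rewrite -memv_preim lfunE /= /act_on sb_val.
apply: span_of_subv => _ [g gB ->]; rewrite -memv_preim lfunE /=.
apply: (@Bplus_ind K m (fun g => act_on (tensor_pow r g) \in <[x]>%VS)) gB.
- move=> g1 g2 g1B g2B /= g1x /vlineP[e g2x].
  by rewrite tensor_powM act_onM ?Bplus_borel // g2x linearZ; apply: memvZ.
- by move=> nu t; rewrite act_on_transvection memv_line.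
- exact: act_on_diag.
Qed.

End KilledVector.

End Generation.

(** * The exact sequence and its non-splitting *)

Section ModuleActions.

Local Open Scope ring_scope.
Variables (K : fieldType) (A : falgType K).

Lemma submod_actE (M : fdmod A) (U : {vspace M}) (hU : is_submod U) a (z : submod hU) :
  vsval (act (submod hU) a z) = act M a (vsval z).
Proof. by rewrite [act _ _ _]lfunE. Qed.

Lemma summod_actE (M N : fdmod A) a (w : summod M N) :
  act (summod M N) a w = (act M a w.1, act N a w.2).
Proof. exact: lfunE. Qed.

End ModuleActions.

Section Sequence.

Local Open Scope ring_scope.
Variables (K : fieldType) (m r p : nat) (lam : weight m).
Local Notation n := m.+2.
Local Notation I := (mindex m r).
Local Notation l := (mi_l r).
Local Notation step := (step r p lam).
Local Notation B := (borel_span K m r).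
Local Notation AP1 := (P1_ambient K r p lam).
Local Notation P1 := (P1 K r p lam).
Local Notation DP1 := (DP1 K r p lam).
Local Notation U := (Uspace K r p lam).
Local Notation E := (Espace K r p lam).
Local Notation S := (simple_mod K r lam).
Implicit Types (h k i j c : I) (s t : step) (a : SB K m r).

Hypothesis infK : infinite_set [set: K]%classic.
Hypothesis charK : has_char K p.
Hypothesis lam_sum : (\sum_(i < n) tnth lam i = r)%N.
Hypothesis lam_adm : admissible p lam.

Lemma coef_diagM (x y : tensor_end K m r) h : upper x -> upper y -> coef (x * y) h h = coef x h h * coef y h h.
Proof.
move=> xU yU; rewrite Defs.coefM (bigD1 h) //= big1 ?addr0 // => i ih.
have [hi | /xU->] := boolP (mle h i); last by rewrite mul0r.
have [/(mle_anti hi) eq | /yU->] := boolP (mle i h); last by rewrite mulr0.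
by rewrite eq eqxx in ih.
Qed.

Lemma sb_upper a : upper (val a).
Proof. exact: borel_upper (subvsP a). Qed.

Lemma simple_actE a (e : S) : act S a e = coef (val a) (l lam) (l lam) * (e : K) :> K.
Proof. by rewrite /= /simple_act scale_lfunE id_lfunE. Qed.

Lemma Uspace_submod : is_submod U.
Proof.
move=> a psi /(mem_Uspace infK charK lam_sum lam_adm) psiU.
apply/(mem_Uspace infK charK lam_sum lam_adm) => eta etaP.
rewrite ev_act ?p1_mem // p1_mulr; apply: psiU.
by apply: right_projM => //; apply: subvsP.
Qed.

Lemma Espace_submod : is_submod E.
Proof.
move=> a w /(mem_EspaceP infK charK lam_sum lam_adm) wE.
apply/(mem_EspaceP infK charK lam_sum lam_adm) => eta etaP.
rewrite summod_actE /=.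
rewrite [LHS]ev_act ?p1_mem // p1_mulr wE; last first.
  by apply: right_projM => //; apply: subvsP.
rewrite simple_actE coef_diagM; [| exact: borel_upper (right_proj_borel infK etaP) | exact: sb_upper].
by rewrite [RHS]mulrC [_ * (w.2 : K)]mulrC mulrCA.
Qed.

Local Notation hU := Uspace_submod.
Local Notation hE := Espace_submod.

Lemma AR_exact : short_exact (AR_f hU hE) (AR_g hE).
Proof.
split.
- move=> a z; apply: val_inj; rewrite [LHS]AR_fE submod_actE.
  by rewrite [RHS]submod_actE AR_fE summod_actE; congr pair; apply/esym; rewrite [LHS]simple_actE mulr0.
- by move=> a w; rewrite !AR_gE submod_actE summod_actE.
- apply/eqP; rewrite -subv0; apply/subvP => z; rewrite memv_ker memv0 => /eqP z0.
  by apply/eqP/val_inj; have := congr1 (fun w => (vsval w).1) z0; rewrite AR_fE.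
- apply/eqP; rewrite eqEsubv; apply/andP; split; apply/subvP => w.
    by case/memv_imgP => z _ ->; rewrite memv_ker AR_gE AR_fE.
  rewrite memv_ker AR_gE => /eqP w2; apply/memv_imgP.
  have wU : (vsval w).1 \in U.
    by have := subvsP w; rewrite mem_Espace w2 scale0r subr0.
  exists (Subvs wU); first exact: memvf.
  by apply: val_inj; rewrite [RHS]AR_fE /= -w2 -surjective_pairing.
apply/vspaceP => c; rewrite memvf; apply/memv_imgP.
have wE : (((c : K) *: z_elt K p lam (l lam), c) : amb_mod K r p lam) \in E.
  by rewrite mem_Espace /= subrr mem0v.
by exists (Subvs wE); rewrite ?memvf // AR_gE.
Qed.

Lemma arrow_step_l_neq s : coef (arrow K s) (l lam) (l lam) = 0.
Proof.
rewrite coef_xiE perm_sym perm_pairs_diag; case: eqP => //= ll.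
have := step_lowers lam_sum s; rewrite ll => /andP[_].
have := step_size_gt0 s; case: eqP => // <-; rewrite -has_count => /hasP[q].
rewrite pairsE => /mapP[rho _ ->] /= /eqP[-> e].
by have := row_neq_next (step_row s); rewrite -e eqxx.
Qed.

Lemma P1_mulr_inj s x a : P1_mulr (P1_inj s x : AP1) a = P1_inj s (x * val a).
Proof. by apply/ffunP => t; rewrite !ffunE; case: eqP; rewrite ?mul0r. Qed.

(** A splitting provides w = (z, 1) in E such that z is killed by the elements of
    S(B^+) with coefficient 0 along xi_lambda, in particular by the arrows.  But
    p_1(xi_lambda) is the sum of the e_s a_s, and z takes the value 1 there. *)
Lemma AR_nonsplit : ~ split_epi (AR_g hE).
Proof.
case=> f [f_hom gf]; set w := vsval (f (1 : K)).
have w2 : w.2 = 1 by rewrite -AR_gE -comp_lfunE gf id_lfunE.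
have /(mem_EspaceP infK charK lam_sum lam_adm) wE : w \in E := subvsP _.
have killed a : coef (val a) (l lam) (l lam) = 0 -> act DP1 a w.1 = 0.
  move=> a0; have a10 : act S a (1 : K) = 0 by rewrite [LHS]simple_actE a0 mul0r.
  have f0 : f 0 = 0 by apply/eqP; rewrite -memv_ker mem0v.
  have := f_hom a (1 : K); rewrite a10 f0 => /(congr1 vsval); rewrite submod_actE summod_actE.
  by move/(congr1 fst) => e; rewrite -[LHS]e.
have eP : xi_wt K r lam \in right_proj K r lam by apply: xi_mem_right_proj => //; apply: mle_refl.
have := wE _ eP; rewrite w2 mul1r coef_xi_wt eqxx perm_refl p1E linear_sum big1 => [/esym/eqP|s _].
  by rewrite oner_eq0.
have sP : xi_wt K r (step_weight s) \in right_proj K r (step_weight s).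
  by apply: xi_mem_right_proj => //; apply: mle_refl.
have -> : P1_inj s (arrow K s * xi_wt K r lam) = P1_mulr (P1_inj s (xi_wt K r (step_weight s))) (sb (arrow K s)) :> AP1.
  rewrite P1_mulr_inj val_sb ?arrow_borel // xi_wt_right_proj ?arrow_right_proj //.
  by congr P1_inj; rewrite [in LHS]arrow_dpow // -mulrA xi_wt_right_proj // -arrow_dpow.
rewrite /= -ev_act ?P1_inj_mem // killed ?ev0 //.
by rewrite val_sb ?arrow_borel // arrow_step_l_neq.
Qed.

Lemma simple_indecomposable : indecomposable S.
Proof.
split.
  apply/eqP => /vspaceP/(_ (1 : K)); rewrite memvf memv0 => /esym/eqP/eqP.
  by rewrite oner_eq0.
move=> V W _ _ _ VW0; have [->|V0] := eqVneq V 0%VS; [by left | right].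
apply/eqP; rewrite -subv0 -VW0; apply/subvP => w wW; rewrite memv_cap wW andbT.
have v0 : vpick V != 0 by rewrite vpick0.
have -> : w = ((w : K) / (vpick V : K)) *: vpick V by rewrite -[RHS]/(_ * _) divfK.
exact/memvZ/memv_pick.
Qed.

End Sequence.

(** * Lifting homomorphisms to E *)

Section Factorization.

Local Open Scope ring_scope.
Variables (K : fieldType) (m r p : nat) (lam : weight m).
Local Notation n := m.+2.
Local Notation I := (mindex m r).
Local Notation l := (mi_l r).
Local Notation step := (step r p lam).
Local Notation AP1 := (P1_ambient K r p lam).
Local Notation P1 := (P1 K r p lam).
Local Notation DP1 := (DP1 K r p lam).
Local Notation U := (Uspace K r p lam).
Local Notation E := (Espace K r p lam).
Local Notation S := (simple_mod K r lam).
Implicit Types (s t : step) (a : SB K m r).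

Hypothesis infK : infinite_set [set: K]%classic.
Hypothesis charK : has_char K p.
Hypothesis lam_sum : (\sum_(i < n) tnth lam i = r)%N.
Hypothesis lam_adm : admissible p lam.

Local Notation hU := (Uspace_submod infK charK lam_sum lam_adm).
Local Notation hE := (Espace_submod infK charK lam_sum lam_adm).

Variables (X : fdmod (SB K m r)) (h : 'Hom(X, S)).
Hypothesis h_hom : is_hom h.

Definition arrows_fun (x : X) : {ffun step -> X} := [ffun s => act X (sb (arrow K s)) x].

Fact arrows_linear : linear arrows_fun.
Proof. by move=> e x y; apply/ffunP => s; rewrite !ffunE linearP. Qed.
HB.instance Definition _ := GRing.isLinear.Build K X {ffun step -> X} _ arrows_fun arrows_linear.

Definition arrows : 'Hom(X, {ffun step -> X}) := linfun arrows_fun.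

Lemma arrowsE x s : arrows x s = act X (sb (arrow K s)) x.
Proof. by rewrite lfunE ffunE. Qed.

(** Projecting x to weight lambda does not change h x.  The projection y spans a
    submodule, which is a complement of the kernel of h. *)
Lemma killed_invertible x : indecomposable X -> arrows x = 0 -> h x != 0 -> invertible_hom h.
Proof.
move=> [_ X_ind] x0 hx0.
pose y := act X (sb (xi_wt K r lam)) x.
have hy : h y = h x.
  by rewrite /y h_hom simple_actE val_sb ?xi_wt_borel // coef_xi_wt eqxx perm_refl mul1r.
have y_wt : act X (sb (xi_wt K r lam)) y = y.
  rewrite /y -comp_lfunE -actM -sbM ?xi_wt_borel // xi_wt_right_proj //.
  by apply: xi_mem_right_proj => //; apply: mle_refl.
have y_killed s : act X (sb (arrow K s)) y = 0.
  rewrite /y -comp_lfunE -actM -sbM ?xi_wt_borel ?arrow_borel //.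
  rewrite [in X in sb X]arrow_dpow // -mulrA xi_wt_right_proj ?arrow_dpow -?arrow_dpow //.
    by rewrite -arrowsE x0 ffunE.
  by apply: xi_mem_right_proj => //; apply: mle_refl.
have line := stable_line infK charK lam_sum y_wt y_killed.
have y_sub : is_submod <[y]>%VS.
  by move=> a _ /vlineP[e ->]; rewrite linearZ; apply/memvZ/line.
have k_sub : is_submod (lker h).
  move=> a z; rewrite !memv_ker h_hom => /eqP ->.
  by rewrite simple_actE mulr0.
have hy0 : h y != 0 by rewrite hy.
have cap : (<[y]> :&: lker h = 0)%VS.
  apply/eqP; rewrite -subv0; apply/subvP => z; rewrite memv_cap memv_ker => /andP[/vlineP[e ->]].
  by rewrite linearZ scaler_eq0 (negbTE hy0) orbF => /eqP->; rewrite scale0r mem0v.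
have sum : (<[y]> + lker h = fullv)%VS.
  apply/vspaceP => z; rewrite memvf; apply/memv_addP.
  exists (((h z : K) / (h y : K)) *: y); first by apply/memvZ/memv_line.
  exists (z - ((h z : K) / (h y : K)) *: y); last by rewrite addrC subrK.
  by rewrite memv_ker linearB linearZ subr_eq0 -[X in _ == X]/(_ * _) divfK.
case: (X_ind _ _ y_sub k_sub sum cap) => [y0 | ker0].
  by move: hy0; have : y \in <[y]>%VS := memv_line y; rewrite y0 memv0 => /eqP->; rewrite linear0 eqxx.
have h_inj : injective h by apply/lker0P/eqP.
have hhV c : h (h^-1%VF c) = c.
  apply: limg_lfunVK; have -> : c = ((c : K) / (h y : K)) *: h y by rewrite -[RHS]/(_ * _) divfK.
  exact/memvZ/memv_img/memvf.
exists (h^-1)%VF; split.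
- by move=> a c; apply: h_inj; rewrite h_hom !hhV.
- by apply/lfunP => z; apply: h_inj; rewrite comp_lfunE hhV id_lfunE.
- by apply/lfunP => c; rewrite comp_lfunE hhV id_lfunE.
Qed.

Hypothesis ker_sub : forall x, arrows x = 0 -> h x = 0.

(** As h vanishes on the kernel of arrows, it factors through its image; the
    pseudo-inverse extends the resulting functional to all families. *)
Definition coarrows : 'Hom({ffun step -> X}, K^o) := (h \o arrows^-1)%VF.

Lemma coarrowsE x : coarrows (arrows x) = h x.
Proof.
rewrite comp_lfunE; apply/eqP; rewrite -subr_eq0 -linearB; apply/eqP/ker_sub.
have e : arrows (arrows^-1%VF (arrows x)) = arrows x by apply: limg_lfunVK; apply: memv_img; apply: memvf.
by rewrite linearB; apply/eqP; rewrite subr_eq0; apply/eqP.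
Qed.

Definition act_family (x : X) (y : AP1) : {ffun step -> X} := [ffun s => act X (sb (y s)) x].

Fact act_family_linear x : linear (act_family x).
Proof.
move=> e y z; apply/ffunP => s.
by rewrite !ffunE /sb !linearP add_lfunE scale_lfunE.
Qed.
HB.instance Definition _ x :=
  GRing.isLinear.Build K AP1 {ffun step -> X} _ (act_family x) (act_family_linear x).

(** The functional y |-> omega((y_s x)_s) on P_1, for omega = coarrows; at
    y = p_1(eta) it takes the value h(eta x). *)
Definition lift_functional (x : X) (y : subvs_of P1) : K^o := coarrows (act_family x (vsval y)).

Fact lift_functional_linear x : linear (lift_functional x).
Proof. by move=> e y z; rewrite /lift_functional !linearP. Qed.
HB.instance Definition _ x :=
  GRing.isLinear.Build K (subvs_of P1) K^o _ (lift_functional x) (lift_functional_linear x).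

Definition lift_dual (x : X) : DP1 := linfun (lift_functional x).

Lemma ev_lift_dual x v : v \in P1 -> ev (lift_dual x) v = coarrows (act_family x v).
Proof. by move=> vP; rewrite /ev lfunE /= /lift_functional vsprojK. Qed.

Lemma P1_borel v s : v \in P1 -> v s \in borel_span K m r.
Proof. by move/mem_P1/(_ s)/(right_proj_borel infK). Qed.

Lemma lift_mem x : ((lift_dual x, h x) : amb_mod K r p lam) \in E.
Proof.
apply/(mem_EspaceP infK charK lam_sum lam_adm) => eta etaP /=.
rewrite ev_lift_dual ?p1_mem //.
have etaB := right_proj_borel infK etaP.
have -> : act_family x (p1 p lam eta) = arrows (act X (sb eta) x).
  apply/ffunP => s; rewrite arrowsE !ffunE -/(arrow K s) sbM ?arrow_borel //.
  by rewrite actM comp_lfunE.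
by rewrite coarrowsE h_hom simple_actE val_sb // mulrC.
Qed.

Definition lift_fun (x : X) : submod hE := Subvs (lift_mem x).

Fact lift_fun_linear : linear lift_fun.
Proof.
move=> e x y; apply: val_inj; congr pair; last by rewrite linearP.
apply: ev_ext => v vP; rewrite evP !ev_lift_dual //.
have -> : act_family (e *: x + y) v = e *: act_family x v + act_family y v.
  by apply/ffunP => s; rewrite !ffunE linearP.
exact: linearP.
Qed.
HB.instance Definition _ := GRing.isLinear.Build K X (submod hE) _ lift_fun lift_fun_linear.

Lemma factor_through : exists k : 'Hom(X, submod hE), is_hom k /\ h = (AR_g hE \o k)%VF.
Proof.
exists (linfun lift_fun); split; last first.
  by apply/lfunP => x; rewrite comp_lfunE AR_gE lfunE.
have kE y : linfun lift_fun y = lift_fun y by rewrite lfunE.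
move=> a x; rewrite !kE; apply: val_inj; rewrite [RHS]submod_actE summod_actE.
congr pair; last by rewrite /= h_hom.
apply: ev_ext => v vP; rewrite ev_act // !ev_lift_dual ?P1_mulr_mem //.
congr (coarrows _); apply/ffunP => s; rewrite !ffunE sbM ?P1_borel //; last exact: subvsP.
by rewrite actM comp_lfunE sb_val.
Qed.

End Factorization.

(** * Minimality of the presentation *)

Section Minimality.

Local Open Scope ring_scope.
Variables (K : fieldType) (m r p : nat) (lam : weight m).
Local Notation n := m.+2.
Local Notation I := (mindex m r).
Local Notation l := (mi_l r).
Local Notation step := (step r p lam).
Local Notation B := (borel_span K m r).
Implicit Types (h k i j c : I) (s t : step) (x y : tensor_end K m r).

Hypothesis infK : infinite_set [set: K]%classic.
Hypothesis charK : has_char K p.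
Hypothesis lam_sum : (\sum_(i < n) tnth lam i = r)%N.

(** This sum is monotone along chains of multi-indices and separates l(s) from l by
    the size of s, which makes the algebra triangular. *)
Definition index_sum i : nat := (\sum_rho val (tnth i rho))%N.

Lemma perm_index_sum i j : perm_eq i j -> index_sum i = index_sum j.
Proof.
have sumE i' : index_sum i' = (\sum_(v <- i') val v)%N by rewrite big_tuple.
by move=> ij; rewrite !sumE; apply: perm_big.
Qed.

Lemma mle_index_sum_eq i j : mle i j -> (index_sum j <= index_sum i)%N -> i = j.
Proof.
move=> /mleP ij; rewrite leqNgt => /negP sum_ij; apply: eq_from_tnth => rho; apply/val_inj/eqP.
rewrite eqn_leq ij leqNgt; apply/negP => lt; apply: sum_ij.
rewrite /index_sum (bigD1 rho) //= [X in (_ < X)%N](bigD1 rho) //= -addSn leq_add //.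
by apply: leq_sum => sigma _; apply: ij.
Qed.

Lemma mle_perm_eq i j : mle i j -> perm_eq i j -> i = j.
Proof. by move=> ij /perm_index_sum e; apply: mle_index_sum_eq; rewrite // e. Qed.

Lemma lowers_index_sum (nu : 'I_m.+1) d h c :
  lowers (Defs.row nu) (next_row nu) d h c -> index_sum c = (index_sum h + d)%N.
Proof.
rewrite lowersE => /andP[/forallP hc /eqP<-]; rewrite /index_sum -sum1_card [X in (_ + X)%N]big_mkcond /= -big_split /=.
apply: eq_bigr => rho _; have := hc rho; rewrite inE xpair_eqE.
case: (boolP (_ && _)) => [/andP[/eqP -> /eqP->] _|_]; last by rewrite orbF addn0 => /eqP->.
by rewrite /= /bump add1n addn1.
Qed.

Lemma step_index_sum s : index_sum (l lam) = (index_sum (l (step_weight s)) + step_size s)%N.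
Proof. exact: lowers_index_sum (step_lowers lam_sum s). Qed.

Lemma next_row_inj : injective (@next_row m).
Proof. exact: lift_inj. Qed.

Lemma step_l_inj s t : l (step_weight s) = l (step_weight t) -> s = t.
Proof.
move=> e; have sz : step_size s = step_size t.
  by apply/eqP; rewrite -(eqn_add2l (index_sum (l (step_weight s)))) {2}e -!step_index_sum.
apply: (step_size_inj charK) => //; have := step_lowers lam_sum s.
rewrite lowersE e => /andP[_ /eqP pl].
have /card_gt0P[rho] : (0 < #|places (Defs.row (step_row s)) (next_row (step_row s)) (l (step_weight t)) (l lam)|)%N.
  by rewrite pl step_size_gt0.
rewrite inE xpair_eqE => /andP[/eqP ta /eqP tb].
have := step_lowers lam_sum t; rewrite lowersE => /andP[/forallP/(_ rho) + _].
rewrite inE xpair_eqE ta tb (negbTE (row_neq_next _)) /= => /andP[_ /eqP].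
exact: next_row_inj.
Qed.

Lemma entry_mul_arrow_eq x t : x \in B ->
  coef (x * arrow K t) (l (step_weight t)) (l lam) = coef x (l (step_weight t)) (l (step_weight t)).
Proof.
move=> /(borel_upper) xU; rewrite Defs.coefM (bigD1 (l (step_weight t))) //= coef_xiE perm_refl mulr1.
rewrite big1 ?addr0 // => i it; rewrite coef_xiE.
have [ti | /xU->] := boolP (mle (l (step_weight t)) i); last by rewrite mul0r.
case: (boolP (perm_eq _ _)) => [/perm_pairs_fst pe|_]; last by rewrite mulr0.
by move: it; rewrite (mle_perm_eq ti) ?eqxx // perm_sym.
Qed.

Lemma entry_arrow_mul x t : x \in B ->
  coef (arrow K t * x) (l (step_weight t)) (l lam) = coef x (l lam) (l lam).
Proof.
move=> /(borel_upper) xU; rewrite Defs.coefM (bigD1 (l lam)) //= coef_xiE perm_refl mul1r.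
rewrite big1 ?addr0 // => i it; rewrite coef_xiE.
have [ti | /xU->] := boolP (mle i (l lam)); last by rewrite mulr0.
case: (boolP (perm_eq _ _)) => [/perm_pairs_snd pe|_]; last by rewrite mul0r.
by move: it; rewrite (mle_perm_eq ti) ?eqxx.
Qed.

(** If l(t) <= i <= l and i differs from l by a step s, then the changes of s are
    among those of t, so that s and t concern the same row. *)
Lemma lowers_between s t i : mle (l (step_weight t)) i ->
    lowers (Defs.row (step_row s)) (next_row (step_row s)) (step_size s) i (l lam) ->
  [/\ step_row s = step_row t, (step_size s <= step_size t)%N &
      lowers (Defs.row (step_row t)) (next_row (step_row t)) (step_size t - step_size s) (l (step_weight t)) i].
Proof.
move=> /mleP ti low_i; have low_t := step_lowers lam_sum t.
have il : mle i (l lam) by apply: lowers_le low_i; rewrite /= /bump add1n leqnSn.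
move: low_i low_t; rewrite !lowersE => /andP[/forallP i_l /eqP ci] /andP[/forallP t_l /eqP ct].
have rows : step_row s = step_row t.
  have /card_gt0P[rho] : (0 < #|places (Defs.row (step_row s)) (next_row (step_row s)) i (l lam)|)%N.
    by rewrite ci step_size_gt0.
  rewrite inE xpair_eqE => /andP[/eqP ia /eqP lb].
  have := t_l rho; rewrite inE xpair_eqE lb; case/orP => [/eqP tb | /andP[_ /eqP]].
    by have := ti rho; rewrite tb ia /= /bump add1n ltnn.
  exact: next_row_inj.
rewrite rows in i_l ci *.
set a := Defs.row _ in i_l ci t_l ct *; set b := next_row _ in i_l ci t_l ct *.
have ab : a != b := row_neq_next _.
have sub : places a b i (l lam) \subset places a b (l (step_weight t)) (l lam).
  apply/subsetP => rho; rewrite inE xpair_eqE => /andP[/eqP ia /eqP lb].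
  have := t_l rho; case/orP => // /eqP tb.
  by have := ti rho; rewrite tb lb ia /= /bump add1n ltnn.
split=> //; first by rewrite -ci -ct subset_leq_card.
have -> : places a b (l (step_weight t)) i = places a b (l (step_weight t)) (l lam) :\: places a b i (l lam).
  apply/setP => rho; rewrite !inE !xpair_eqE; have := i_l rho; rewrite inE xpair_eqE.
  have := t_l rho; rewrite inE xpair_eqE.
  case: (eqVneq (tnth i rho) a) => [->|ia] /=; first by rewrite (negbTE ab) andbF; case: (_ == b); rewrite ?andbF.
  by rewrite orbF => _ /eqP->.
rewrite cardsD (setIidPr sub) ci ct eqxx andbT; apply/forallP => rho.
rewrite !inE !xpair_eqE; have := i_l rho; have := t_l rho; rewrite !inE !xpair_eqE.
case/orP => [/eqP tl | /andP[/eqP ta /eqP lb]].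
  move=> _; apply/orP; left; apply/eqP/val_inj/eqP; rewrite eqn_leq ti /= tl.
  exact: (mleP _ _ il).
by rewrite ta lb !eqxx /= => _; rewrite !andbT eq_sym orbN.
Qed.

(** Minimality of the arrows: a_t does not occur in y a_s for s <> t.  By
    lowers_between, the coefficient can only be nonzero if s is a smaller step
    in the same row; then y acts as a multiple of a divided power, and the
    product of the two divided powers is 'C(p^i, p^j) = 0 times the divided power of
    order p^i.  In characteristic 0 each row has a single step. *)
Lemma entry_mul_arrow_neq x s t : x \in B -> s != t ->
  coef (x * arrow K s) (l (step_weight t)) (l lam) = 0.
Proof.
move=> xB st; have xU := borel_upper xB; have xI := borel_orbit_inv xB.
rewrite Defs.coefM.
set a := Defs.row (step_row s); set b := next_row (step_row s).
have arrowE i : coef (arrow K s) i (l lam) = (lowers a b (step_size s) i (l lam))%:R.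
  rewrite coef_xiE; congr (_%:R); congr nat_of_bool; apply/idP/idP => [e|low].
    by rewrite (perm_lowers _ _ _ e) step_lowers.
  by apply: (lowers_perm (row_neq_next (step_row s)) low (step_lowers lam_sum s)); apply: perm_refl.
(* All i that contribute form one orbit together with l(t), so that the
   coefficient of x at (l(t), i) can be read off at a single i0. *)
case: (pickP (fun i => mle (l (step_weight t)) i && lowers a b (step_size s) i (l lam))) => [i0|none]; last first.
  rewrite big1 // => i _; rewrite arrowE; have := none i.
  have [ti | /xU->] := boolP (mle _ i); last by rewrite mul0r.
  by rewrite /= => ->; rewrite mulr0.
case/andP => ti0 low0; have [rows s_le low_t] := lowers_between ti0 low0.
have s_lt : (step_size s < step_size t)%N.
  rewrite ltn_neqAle s_le andbT; apply: contra st => /eqP sz.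
  by apply/eqP; apply: (step_size_inj charK).
rewrite /a /b rows in arrowE low0 * => {a b}.
rewrite (eq_bigr (fun i => coef x (l (step_weight t)) i0 *
  (coef (dpow K r (step_row t) (step_size t - step_size s)) (l (step_weight t)) i *
   coef (dpow K r (step_row t) (step_size s)) i (l lam)))); last first.
  move=> i _; rewrite arrowE !coef_dpow.
  case: (boolP (lowers _ _ (step_size s) i (l lam))) => [low_i|_]; last by rewrite !mulr0.
  rewrite !mulr1; have [ti|ti] := boolP (mle (l (step_weight t)) i); last first.
    rewrite xU //; case: (boolP (lowers _ _ _ _ _)) => [/lowers_le|_]; last by rewrite mulr0.
    by rewrite (negbTE ti) => /(_ (leqnSn _)).
  have low_i' := low_i; rewrite -rows in low_i'.
  have [_ _ low_ti] := lowers_between ti low_i'.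
  rewrite low_ti mulr1; apply: xI.
  apply: (lowers_perm (row_neq_next _) low_ti low_t).
  have pe := lowers_perm (row_neq_next _) low_i low0 (perm_refl (l lam)).
  exact: perm_pairs_fst pe.
rewrite -big_distrr /= -Defs.coefM dpowM entryZ subnK //.
have -> : 'C(step_size t, step_size t - step_size s)%:R = 0 :> K; last by rewrite mul0r mulr0.
rewrite bin_sub //; have [p0|p_n0] := eqVneq p 0%N.
  by move: s_lt; rewrite /step_size !step_exp0 ?ltnn.
apply/eqP; rewrite -(dvdn_pcharf (pchar_mem charK p_n0)).
by apply: dvdn_bin_pexp; rewrite ?(pchar_prime charK) // step_size_gt0.
Qed.

(** The space e_s S e_s is spanned by e_s, as i <= j of equal weight are equal. *)
Lemma right_proj_mul_eq s x y : y \in right_proj K r (step_weight s) -> x \in right_proj K r (step_weight s) ->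
  y * x = coef y (l (step_weight s)) (l (step_weight s)) *: x.
Proof.
move=> /(mem_right_proj infK)[yB y_out] /(mem_right_proj infK)[xB x_out].
apply: tensor_end_eq => h k; rewrite Defs.coefM entryZ (bigD1 h) //= big1 ?addr0; last first.
  move=> i ih; have [hs|hs] := boolP (perm_eq h (l (step_weight s))); last by rewrite y_out ?mul0r.
  have [is_|is_] := boolP (perm_eq i (l (step_weight s))); last by rewrite x_out ?mulr0.
  have [hi|hi] := boolP (mle h i); last by rewrite (borel_upper yB) ?mul0r.
  move: ih; rewrite (mle_perm_eq hi) ?eqxx //.
  by rewrite (seq.permPl hs) perm_sym.
have [hs|hs] := boolP (perm_eq h (l (step_weight s))); last by rewrite x_out ?mulr0.
congr (_ * _); apply: (borel_orbit_inv yB).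
by rewrite perm_pairs_diag eqxx.
Qed.

Lemma right_proj_mul_neq s t x y : y \in right_proj K r (step_weight t) -> x \in right_proj K r (step_weight s) ->
  t != s -> (step_size t <= step_size s)%N -> y * x = 0.
Proof.
move=> /(mem_right_proj infK)[yB y_out] /(mem_right_proj infK)[xB x_out] ts sz.
apply: tensor_end_eq => h k; rewrite Defs.coefM entry0 big1 // => i _.
have [ht|ht] := boolP (perm_eq h (l (step_weight t))); last by rewrite y_out ?mul0r.
have [is_|is_] := boolP (perm_eq i (l (step_weight s))); last by rewrite x_out ?mulr0.
have [hi|hi] := boolP (mle h i); last by rewrite (borel_upper yB) ?mul0r.
have e : h = i.
  apply: mle_index_sum_eq => //; rewrite (perm_index_sum ht) (perm_index_sum is_).
  by rewrite -(leq_add2r (step_size s)) -step_index_sum (step_index_sum t) leq_add2l.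
case/eqP: ts; apply: step_l_inj; apply: sorted_perm_mi_l.
- exact: step_weight_sum.
- exact/sorted_mi_l/step_weight_sum.
- by rewrite -(seq.permPl ht) e.
Qed.

End Minimality.

(** * Indecomposability of U *)

Section IndecomposableKernel.

Local Open Scope ring_scope.
Variables (K : fieldType) (m r p : nat) (lam : weight m).
Local Notation n := m.+2.
Local Notation I := (mindex m r).
Local Notation l := (mi_l r).
Local Notation step := (step r p lam).
Local Notation B := (borel_span K m r).
Local Notation AP1 := (P1_ambient K r p lam).
Local Notation P1 := (P1 K r p lam).
Local Notation DP1 := (DP1 K r p lam).
Local Notation U := (Uspace K r p lam).
Local Notation e_ s := (xi_wt K r (step_weight s)).
Implicit Types (h k i j c : I) (s t : step) (x y : tensor_end K m r) (psi : DP1) (v : AP1).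

Hypothesis infK : infinite_set [set: K]%classic.
Hypothesis charK : has_char K p.
Hypothesis lam_sum : (\sum_(i < n) tnth lam i = r)%N.
Hypothesis lam_adm : admissible p lam.

Let UP psi := @mem_Uspace K m r p lam infK charK lam_sum lam_adm psi.
Let wsum s : (\sum_(i < n) tnth (step_weight s) i = r)%N := step_weight_sum lam_sum s.

Lemma dual_free_mem b : b \in B_free K r p lam -> dual_elt b \in U.
Proof. by move=> bF; apply/memv_span/map_f. Qed.

Lemma Uspace_expansion psi : psi \in U -> psi = \sum_(b <- B_free K r p lam) ev psi b *: dual_elt b.
Proof.
move=> /UP psi0; rewrite {1}(dual_expansion infK charK lam_sum lam_adm psi) big_cat /= [X in _ + X]big_seq_cond.
rewrite [X in _ + X]big1 ?addr0 // => b; rewrite andbT => /mem_B_im[j jJ ->].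
by rewrite psi0 ?scale0r //; apply: xi_J_mem.
Qed.

Lemma P1_eq0 v : v \in P1 -> (forall psi, ev psi v = 0) -> v = 0.
Proof.
move=> vP v0; apply/ffunP => s; apply: tensor_end_eq => h k; rewrite ffunE entry0.
pose psi : DP1 := linfun (entry s h k \o @vsval _ _ P1).
by have := v0 psi; rewrite /ev lfunE /= vsprojK.
Qed.

Lemma P1_expansion v : v \in P1 -> v = \sum_(b <- B_all K r p lam) ev (dual_elt b) v *: b.
Proof.
move=> vP; apply/eqP; rewrite -subr_eq0; apply/eqP/P1_eq0 => [|psi].
  rewrite memvB // big_seq_cond memv_suml // => b; rewrite andbT => bB.
  by apply/memvZ/(B_all_P1 infK lam_sum).
rewrite linearB linear_sum /= [in X in X - _](dual_expansion infK charK lam_sum lam_adm psi).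
rewrite ev_sum -sumrB big1 // => b _; rewrite linearZ evZ /=.
by rewrite -[X in _ - X]/(_ * _) mulrC subrr.
Qed.

(** The double annihilator of p_1(e S) is p_1(e S). *)
Lemma Uspace_separates v : v \in P1 -> (forall psi, psi \in U -> ev psi v = 0) ->
  exists2 eta, eta \in right_proj K r lam & v = p1 p lam eta.
Proof.
move=> vP v0; exists (\sum_(j in Jset r lam) ev (z_elt K p lam j) v *: xi K (l lam) j).
  by apply: memv_suml => j jJ; apply/memvZ/xi_J_mem.
rewrite {1}(P1_expansion vP) big_cat /= big_seq_cond big1 ?add0r; last first.
  by move=> b; rewrite andbT => /dual_free_mem/v0->; rewrite scale0r.
rewrite big_map big_enum /=; apply/ffunP => s; rewrite sum_ffunE ffunE mulr_sumr.
by apply: eq_bigr => j _; rewrite -[RHS]scalerAr !ffunE.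
Qed.

(** For a step s with nu = n - 1, the element xi_{l(s),l(s)} belongs to the free part
    of the basis, since l(s) is strictly below l and so not in J(lambda). *)
Lemma Uspace_neq0 : U != 0%VS.
Proof.
have [|s [sr _ _]] := @exists_step K m r p lam charK lam_sum ord_max 1.
  by rewrite next_row_max /= lt0n; case: lam_adm.
have jJ : l (step_weight s) \in Jstep s.
  rewrite /Jstep sr eqxx in_setD (l_mem_J (wsum s)) andbT inE negb_and; apply/orP; left.
  rewrite mem_JsetE // negb_and; apply/orP; left; apply/negP => ls.
  have := step_index_sum lam_sum s; rewrite (mle_anti ls (step_mle lam_sum s)).
  by move/eqP; rewrite -{1}[index_sum _]addn0 eqn_add2l eq_sym (gtn_eqF (step_size_gt0 s)).
have bF : P1_inj s (xi K (l (step_weight s)) (l (step_weight s))) \in B_free K r p lam.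
  by apply/mem_B_free; exists s, (l (step_weight s)).
apply: contraTneq (dual_free_mem bF) => ->; rewrite memv0.
have bB := B_free_sub bF; apply/eqP => b0.
have := ev_dual infK charK lam_sum lam_adm bB bB; rewrite b0 ev0 eqxx => /eqP.
by rewrite eq_sym oner_eq0.
Qed.

Section Decomposition.

Variables V W : {vspace DP1}.
Hypotheses (V_sub : is_submod V) (W_sub : is_submod W).
Hypotheses (VW : (V + W = U)%VS) (VW0 : (V :&: W = 0)%VS).

Definition summand_proj : 'End(DP1) := daddv_pi V W.
Local Notation pi := summand_proj.

Lemma pi_id psi : psi \in V -> pi psi = psi.
Proof. exact: daddv_pi_id. Qed.

Lemma pi_0 psi : psi \in W -> pi psi = 0.
Proof.
move=> psiW; have WV0 : (W :&: V = 0)%VS by rewrite capvC.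
have := daddv_pi_add VW0 (subvP (addvSr V W) _ psiW).
by rewrite (daddv_pi_id WV0 psiW) -[RHS]add0r => /addIr.
Qed.

Lemma pi_mem psi : pi psi \in U.
Proof. by rewrite -VW; apply: (subvP (addvSl V W)); apply: memv_pi. Qed.

Lemma pi_hom (a : SB K m r) psi : psi \in U -> pi (act DP1 a psi) = act DP1 a (pi psi).
Proof.
rewrite -VW => /memv_addP[psi1 V1 [psi2 W2 ->]].
have -> : act DP1 a (psi1 + psi2) = act DP1 a psi1 + act DP1 a psi2 by apply: linearD.
have piD psi3 psi4 : pi (psi3 + psi4) = pi psi3 + pi psi4 by apply: linearD.
by rewrite !piD (pi_id (V_sub a V1)) (pi_0 (W_sub a W2)) (pi_id V1) (pi_0 W2) !addr0.
Qed.

(** The element y_s of P_1 with (pi psi)(e_s) = psi(y_s) for psi in U; the sum is the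
    expansion of the functional psi |-> (pi psi)(e_s) in the basis of U. *)
Definition pi_lift s : AP1 :=
  \sum_(b <- B_free K r p lam) ev (pi (dual_elt b)) (P1_inj s (e_ s)) *: b.

Lemma pi_lift_mem s : pi_lift s \in P1.
Proof.
rewrite /pi_lift big_seq_cond memv_suml // => b; rewrite andbT => bF.
by apply/memvZ/(B_all_P1 infK lam_sum)/B_free_sub.
Qed.

Lemma e_mem s : e_ s \in right_proj K r (step_weight s).
Proof. by apply: xi_mem_right_proj => //; apply: mle_refl. Qed.

Lemma ev_pi_idempotent s psi : psi \in U -> ev (pi psi) (P1_inj s (e_ s)) = ev psi (pi_lift s).
Proof.
move=> psiU; rewrite {1}(Uspace_expansion psiU) !linear_sum ev_sum; apply: eq_bigr => b _.
by rewrite linearZ evZ linearZ -[RHS]/(_ * _) mulrC.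
Qed.

Lemma ev_pi s x psi : psi \in U -> x \in right_proj K r (step_weight s) ->
  ev (pi psi) (P1_inj s x) = ev psi (P1_mulr (pi_lift s) (sb x)).
Proof.
move=> psiU xP; have xB := right_proj_borel infK xP.
have -> : P1_inj s x = P1_mulr (P1_inj s (e_ s)) (sb x) :> AP1.
  by rewrite P1_mulr_inj val_sb // xi_wt_right_proj.
rewrite -ev_act ?P1_inj_mem ?e_mem // -pi_hom // ev_pi_idempotent.
  by rewrite ev_act // pi_lift_mem.
exact: Uspace_submod.
Qed.

(** For psi in U the functional pi psi vanishes at p_1(e), so psi vanishes at
    sum_s y_s a_s, which therefore equals p_1(eta) for some eta.  The
    coefficient of a_t in the component at t is that of y_t along e_t on one
    side, by minimality of the arrows, and that of eta along e on the other. *)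
Lemma pi_lift_diagonal : exists c : K, forall t,
  coef (pi_lift t t) (l (step_weight t)) (l (step_weight t)) = c.
Proof.
pose z : AP1 := \sum_s P1_mulr (pi_lift s) (sb (arrow K s)).
have zP : z \in P1 by apply: memv_suml => s _; apply/P1_mulr_mem/pi_lift_mem.
have [psi psiU|eta etaP zE] := Uspace_separates zP.
  rewrite /z linear_sum (eq_bigr (fun s => ev (pi psi) (P1_inj s (arrow K s)))) /=; last first.
    by move=> s _; rewrite ev_pi ?arrow_right_proj.
  have pi0 : ev (pi psi) (p1 p lam (xi_wt K r lam)) = 0.
    by have /UP := pi_mem psi; apply; apply: xi_mem_right_proj => //; apply: mle_refl.
  rewrite -[RHS]pi0 p1E linear_sum; apply: eq_bigr => s _; congr (ev _ (P1_inj s _)).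
  by rewrite [in RHS]arrow_dpow // -mulrA xi_wt_right_proj -?arrow_dpow //; apply: xi_mem_right_proj => //; apply: mle_refl.
exists (coef eta (l lam) (l lam)) => t.
have etaB := right_proj_borel infK etaP.
rewrite -(entry_arrow_mul t etaB) -/(entry t (l (step_weight t)) (l lam) (p1 p lam eta)).
have -> : coef (arrow K t * eta) (l (step_weight t)) (l lam) = coef (z t) (l (step_weight t)) (l lam).
  by rewrite zE ffunE.
have -> : z t = \sum_s pi_lift s t * arrow K s.
  rewrite /z sum_ffunE; apply: eq_bigr => s _.
  by rewrite ffunE val_sb // arrow_borel.
have yB s : pi_lift s t \in B by apply/P1_borel/pi_lift_mem.
rewrite [in RHS]entry_sum [RHS](bigD1 t) //= entry_mul_arrow_eq // [X in _ = _ + X]big1 ?addr0 //.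
by move=> s st; rewrite entry_mul_arrow_neq.
Qed.

(** Evaluate at the summand e_s S of largest size on which psi does not vanish:
    (pi psi)(x) = psi(y_s x), where the components of y_s x vanish at the other
    steps t unless t is larger than s, in which case psi vanishes there. *)
Lemma pi_eigenvector (c : K) psi :
    (forall t, coef (pi_lift t t) (l (step_weight t)) (l (step_weight t)) = c) ->
  psi \in U -> psi != 0 -> exists v, ev psi v != 0 /\ ev (pi psi) v = c * ev psi v.
Proof.
move=> diag psiU psi0.
pose Q s := [exists j in Jset r (step_weight s), ev psi (P1_inj s (xi K (l (step_weight s)) j)) != 0].
have Q0 s : ~~ Q s -> forall x, x \in right_proj K r (step_weight s) -> ev psi (P1_inj s x) = 0.
  rewrite negb_exists => /forallP none x xP.
  rewrite (right_proj_expansion infK (wsum s) xP) !linear_sum big1 // => j jJ.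
  rewrite !linearZ; have := none j; rewrite jJ /= negbK => /eqP->.
  by rewrite -[LHS]/(_ * _) mulr0.
have [s0 Qs0] : exists s, Q s.
  apply/existsP; apply: contraNT psi0; rewrite negb_exists => /forallP none; apply/eqP.
  apply: ev_ext => v /mem_P1 vP; rewrite ev0 (P1_inj_sum v).
  by rewrite linear_sum big1 // => s _; rewrite /= Q0.
case: (arg_maxnP (fun s => step_size s) Qs0) => s /existsP[j /andP[jJ evj]] maxs.
have xP := xi_J_mem infK (wsum s) jJ; set x := xi K _ j in evj xP.
exists (P1_inj s x); split=> //; rewrite ev_pi //.
have -> : P1_mulr (pi_lift s) (sb x) = \sum_t P1_inj t (pi_lift s t * x).
  rewrite [LHS]P1_inj_sum; apply: eq_bigr => t _.
  by rewrite ffunE val_sb // (right_proj_borel infK xP).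
have yP t : pi_lift s t \in right_proj K r (step_weight t) by have /mem_P1 := pi_lift_mem s; apply.
rewrite linear_sum (bigD1 s) //= (right_proj_mul_eq infK (yP s) xP) diag !linearZ big1 ?addr0 // => t ts.
have [Qt|Qt] := boolP (Q t); last first.
  by apply: (Q0 t Qt); apply: (right_projM infK (yP t)); apply: right_proj_borel xP.
by rewrite (right_proj_mul_neq infK charK lam_sum (yP t) xP ts (maxs t Qt)) !linear0.
Qed.

(** The scalar c is 1 if there is a nonzero psi in V, and 0 if there is one in W. *)
Lemma Uspace_no_decomposition : V = 0%VS \/ W = 0%VS.
Proof.
have [->|V0] := eqVneq V 0%VS; [by left | right].
apply/eqP; apply: contraT => W0; have [c diag] := pi_lift_diagonal.
have VU : vpick V \in U by rewrite -VW; apply: (subvP (addvSl V W)); apply: memv_pick.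
have WU : vpick W \in U by rewrite -VW; apply: (subvP (addvSr V W)); apply: memv_pick.
have [|v [ev0' evc]] := pi_eigenvector diag VU; first by rewrite vpick0.
have [|w [ew0 ewc]] := pi_eigenvector diag WU; first by rewrite vpick0.
move: ewc; rewrite pi_0 ?memv_pick // ev0 => /esym/eqP; rewrite mulf_eq0 (negbTE ew0) orbF => /eqP c0.
by move: evc; rewrite pi_id ?memv_pick // c0 mul0r => /eqP; rewrite (negbTE ev0').
Qed.

End Decomposition.

Lemma Uspace_indecomposable (hU : is_submod U) : indecomposable (submod hU).
Proof.
split.
  apply/eqP => full0; case/eqP: Uspace_neq0; apply/eqP; rewrite -subv0; apply/subvP => z zU.
  have : Subvs zU \in (fullv : {vspace submod hU}) := memvf _.
  by rewrite full0 !memv0 => /eqP/(congr1 vsval)/= ->.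
move=> V W V_sub W_sub VW VW0.
pose f : 'Hom(submod hU, DP1) := linfun (@vsval _ _ U).
have fE z : f z = vsval z by rewrite lfunE.
have f_inj : lker f = 0%VS.
  by apply/eqP/lker0P => z z'; rewrite !fE => /val_inj.
have f_sub (V' : {vspace submod hU}) : is_submod V' -> is_submod (f @: V')%VS.
  move=> V'_sub a _ /memv_imgP[z zV ->]; rewrite fE -submod_actE -fE.
  exact/memv_img/V'_sub.
have f_full : (f @: fullv = U)%VS.
  apply/vspaceP => psi; apply/memv_imgP/idP => [[z _ ->]|psiU]; first by rewrite fE subvsP.
  by exists (Subvs psiU); rewrite ?memvf // fE.
have f0 (V' : {vspace submod hU}) : (f @: V' = 0)%VS -> V' = 0%VS.
  by move=> /eqP; rewrite -lkerE f_inj subv0 => /eqP.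
have cap : (f @: V :&: f @: W = 0)%VS.
  apply/eqP; rewrite -subv0; apply/subvP => psi; rewrite memv_cap => /andP[].
  case/memv_imgP => z zV ->; rewrite !fE => /memv_imgP[z' z'W]; rewrite fE => /val_inj zz'.
  have : z \in (V :&: W)%VS by rewrite memv_cap zV zz'.
  by rewrite VW0 !memv0 => /eqP->.
have sum : (f @: V + f @: W = U)%VS by rewrite -limgD VW.
by case: (Uspace_no_decomposition (f_sub _ V_sub) (f_sub _ W_sub) sum cap) => /f0; [left|right].
Qed.

End IndecomposableKernel.

Theorem theorem3p6 (K : fieldType) (m r p : nat) (lam : weight m)
    (infK : infinite_set [set: K]%classic)
    (charK : has_char K p)
    (r_gt0 : 0 < r)
    (lam_sum : \sum_(i < m.+2) tnth lam i = r)
    (lam_adm : admissible p lam) :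
  exists (hU : is_submod (Uspace K r p lam)) (hE : is_submod (Espace K r p lam)),
    auslander_reiten (AR_f hU hE) (AR_g hE).
Proof.
exists (Uspace_submod infK charK lam_sum lam_adm), (Espace_submod infK charK lam_sum lam_adm).
split.
- exact: AR_exact.
- exact: AR_nonsplit.
- exact: simple_indecomposable.
- exact: Uspace_indecomposable.
move=> X h X_ind h_hom h_ninv; apply: factor_through => // x x0.
apply/eqP/contraT => hx; case: h_ninv.
exact: (killed_invertible infK charK lam_sum h_hom X_ind x0 hx).
Qed.
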